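(* Let $n\ge 2$ be an integer and $p\ge 1$ a real number. Let $\mu_p$ be the generalized Gaussian distribution on $\mathbb{R}^n$, i.e. the Borel measure with $$d\mu_p=\frac{\Gamma(\frac{n}{2})}{2\pi^{\frac n2}p^{\frac np-1}\Gamma(\frac np)}\,e^{-\frac{|x|^p}{p}}\,dx .$$ Let $\alpha_p(n)$ be the largest number such that the inequality $$\mu_p(\lambda K+(1-\lambda)L)^{\alpha_p(n)}\ge \lambda\,\mu_p(K)^{\alpha_p(n)}+(1-\lambda)\,\mu_p(L)^{\alpha_p(n)}$$ holds for all convex bodies $K,L$ in $\mathbb{R}^n$ containing the origin and all $\lambda\in[0,1]$. Then $$\frac1n\, e^{\frac{(p-1)n}{p}}\Big(\frac{(p-1)n}{p}\Big)^{\frac np}\Gamma\Big(1-\frac np,\frac{(p-1)n}{p}\Big)\le \alpha_p(n)\le 1-\frac{p}{n-1}\,\frac{\Gamma(\frac{n+p-2}{p})\,\Gamma(\frac np)}{\Gamma(\frac{n-1}{p})^2},$$ where for $p=1$ the left-hand side is interpreted as its limit as $p\to1^+$, which equals $0$.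
   Context: $|x|$ is the Euclidean norm. A convex body in $\mathbb{R}^n$ is a compact convex set with nonempty interior; ''containing the origin'' means the origin is an element of the body (possibly on its boundary). $\lambda K+(1-\lambda)L=\{\lambda x+(1-\lambda)y: x\in K,\ y\in L\}$ is the Minkowski combination. $\Gamma(\cdot)$ is the Gamma function and $\Gamma(s,x)=\int_x^{+\infty}t^{s-1}e^{-t}\,dt$ ($s\in\mathbb{R}$, $x>0$) is the upper incomplete gamma function. The Brunn-Minkowski inequality with exponent $0$ is interpreted in the limiting sense, i.e. as $\mu(\lambda K+(1-\lambda)L)\ge\mu(K)^{\lambda}\mu(L)^{1-\lambda}$. *)

(* Defs.v *)
From HB Require Import structures.
From mathcomp Require Import all_boot all_order all_algebra.
From mathcomp Require Import all_classical all_reals all_analysis.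
From mathcomp Require Import measurable_realfun.

Set Implicit Arguments.
Unset Strict Implicit.
Unset Printing Implicit Defensive.

Import Order.TTheory GRing.Theory Num.Theory.
Import numFieldNormedType.Exports.

Local Open Scope classical_set_scope.
Local Open Scope ring_scope.

(* The type 'rV[R]_n equipped with its Borel sigma-algebra. *)
Notation borelRV R n := (g_sigma_algebraType (@open 'rV[R]_n)).

Section lebesgue_rV.
Context {R : realType}.

Definition rV_cons n (x : measurableTypeR R * borelRV R n) : borelRV R n.+1 :=
  row_mx (x.1%:M : 'rV[R]_1) (x.2 : 'rV[R]_n).

Lemma rV_cons0 n x : (@rV_cons n x : 'rV[R]_(1 + n)) 0 0 = x.1.
Proof.
have -> : 0 = lshift n 0 :> 'I_(1 + n) by exact/val_inj.
by rewrite /rV_cons row_mxEl mxE eqxx.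
Qed.

Lemma rV_consS n x j :
  (@rV_cons n x : 'rV[R]_(1 + n)) 0 (rshift 1 j) = (x.2 : 'rV[R]_n) 0 j.
Proof. by rewrite /rV_cons row_mxEr. Qed.

Lemma rV_cons_ball n (c : 'rV[R]_(1 + n)) (e : R) : 0 < e ->
  @rV_cons n @^-1` ball c e = ball (c 0 0) e `*` ball (rsubmx c) e.
Proof.
move=> e0; apply/seteqP; split => [x [_ xe]|x [/= x1 [_ x2]]].
  split; first by have := xe 0 0; rewrite rV_cons0.
  by split=> // i j; rewrite (ord1 i) mxE -rV_consS; exact: xe.
split=> // i j; rewrite (ord1 i); case: (split_ordP j) => k ->.
  have -> : lshift n k = 0 by rewrite (ord1 k); exact/val_inj.
  by rewrite rV_cons0.
by have := x2 0 k; rewrite mxE rV_consS.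
Qed.

Lemma measurable_rV_cons n : measurable_fun setT (@rV_cons n).
Proof.
apply: (@measurability _ _ (measurableTypeR R * borelRV R n)%type
  (borelRV R n.+1) setT (@rV_cons n) (@open 'rV[R]_n.+1) erefl).
move=> _ [U oU <-]; rewrite setTI.
pose c (q : {ffun 'I_n.+1 -> rat}) : 'rV[R]_(1 + n) := \row_j ratr (q j).
have cE q j : c [ffun i => q i] 0 j = ratr (q j) by rewrite mxE ffunE.
pose B (i : {ffun 'I_n.+1 -> rat} * nat) := ball (c i.1) i.2.+1%:R^-1.
have k0 k : 0 < k.+1%:R^-1 :> R by rewrite invr_gt0.
have -> : @rV_cons n @^-1` U =
    \bigcup_i (if `[< B i `<=` U >] then @rV_cons n @^-1` B i else set0).
  apply/seteqP; split => [x /= Ux|x [i _]]; last first.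
    by case: asboolP => // Ii xi; exact: Ii.
  have /nbhs_ballP[e /= e0 eU] : nbhs (rV_cons x : 'rV[R]_n.+1) U.
    exact: open_nbhs_nbhs.
  pose k := Num.truncn (e / 2)^-1.
  have ke : k.+1%:R^-1 < e / 2 by rewrite invf_plt ?posrE ?divr_gt0// truncnS_gt.
  have Hq (j : 'I_n.+1) : exists q : rat,
      `|ratr q - (rV_cons x : 'rV[R]_n.+1) 0 j| < k.+1%:R^-1.
    set y := (rV_cons x : 'rV[R]_n.+1) 0 j.
    have : y - k.+1%:R^-1 < y + k.+1%:R^-1.
      by rewrite ltrD2l (lt_trans _ (k0 k))// oppr_lt0.
    move=> /rat_in_itvoo[q]; rewrite in_itv/= => /andP[q1 q2].
    by exists q; rewrite ltr_distl q1.
  have {Hq}[q Hq] := choice Hq.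
  exists ([ffun j => q j], k) => //; rewrite asboolT => [|y [_ /= By]]; last first.
    apply: eU; split => // i j.
    have := By i j; rewrite /ball/= (ord1 i) cE => H.
    rewrite (splitr e) (le_lt_trans (ler_distD (ratr (q j)) _ _))//.
    rewrite ltrD//; apply: lt_trans ke; last exact: H.
    by rewrite distrC; exact: Hq.
  split => // i j; rewrite /ball/= (ord1 i) cE.
  exact: Hq.
apply: countable_bigcupT_measurable => [|[q k] /=]; first exact: countableP.
case: asboolP => // _; rewrite rV_cons_ball//.
apply: measurableX; first exact: (open_measurable (ball_open _ _)).
by apply: sub_sigma_algebra; exact: ball_open.
Qed.

Definition rV_head n (v : borelRV R n.+1) : measurableTypeR R :=
  (v : 'rV[R]_(1 + n)) 0 0.

Definition rV_tail n (v : borelRV R n.+1) : borelRV R n :=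
  rsubmx (v : 'rV[R]_(1 + n)).

Lemma measurable_rV_head n : measurable_fun setT (@rV_head n).
Proof.
apply: (@measurability _ _ (borelRV R n.+1) (measurableTypeR R) setT
  (@rV_head n) _ (RGenOpens.measurableE R)).
move=> _ [U [a [b ->]] <-]; rewrite setTI; apply: sub_sigma_algebra.
apply: (@open_comp 'rV[R]_n.+1 R (fun v => v 0 0)); last exact: interval_open.
by move=> x _; exact: coord_continuous.
Qed.

Lemma measurable_rV_tail n : measurable_fun setT (@rV_tail n).
Proof.
apply: (@measurability _ _ (borelRV R n.+1) (borelRV R n) setT
  (@rV_tail n) (@open 'rV[R]_n) erefl).
move=> _ [U oU <-]; rewrite setTI; apply: sub_sigma_algebra.
rewrite openE => v /= Uv.
have /nbhs_ballP[e /= e0 eU] : nbhs (rV_tail v : 'rV[R]_n) U.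
  exact: open_nbhs_nbhs.
apply/nbhs_ballP; exists e => //= w [_ vw]; apply: eU; split=> // i j.
by rewrite /rV_tail !mxE (ord1 i); exact: vw.
Qed.

Section lebesgue_rV_cons.
Local Open Scope ereal_scope.
Variables (n : nat) (m : {sigma_finite_measure set (borelRV R n) -> \bar R}).

Definition lebesgue_rV_cons : set (borelRV R n.+1) -> \bar R :=
  pushforward (lebesgue_measure \x m) (@rV_cons n).

Let mc0 : lebesgue_rV_cons set0 = 0.
Proof. by rewrite /lebesgue_rV_cons /pushforward preimage_set0 measure0. Qed.

Let mc_ge0 A : 0 <= lebesgue_rV_cons A.
Proof. by rewrite /lebesgue_rV_cons /pushforward; exact: measure_ge0. Qed.

Let mc_additive : semi_sigma_additive lebesgue_rV_cons.
Proof.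
exact: (@measure_semi_sigma_additive _ _ _
  (@measure_function_pushforward__canonical__measure_function_Measure
    _ _ _ _ _ (lebesgue_measure \x m) _ (@measurable_rV_cons n))).
Qed.

HB.instance Definition _ := isMeasure.Build _ _ _ lebesgue_rV_cons
  mc0 mc_ge0 mc_additive.

Let mc_sigma_finite : sigma_finite setT lebesgue_rV_cons.
Proof.
have /sigma_finiteP[F [FT ndF Foo]] := @sigma_finiteT _ _ _ (@lebesgue_measure R).
have /sigma_finiteP[G [GT ndG Goo]] := sigma_finiteT m.
exists (fun k => @rV_head n @^-1` F k `&` @rV_tail n @^-1` G k).
  apply/seteqP; split => // v _.
  have [k _ Fk] : (\bigcup_k F k) (rV_head v) by rewrite -FT.
  have [l _ Gl] : (\bigcup_k G k) (rV_tail v) by rewrite -GT.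
  exists (maxn k l) => //; split.
  - by have /subsetPset sF := ndF _ _ (leq_maxl k l); exact: sF.
  - by have /subsetPset sG := ndG _ _ (leq_maxr k l); exact: sG.
move=> k; have [mF Fk] := Foo k; have [mG Gk] := Goo k; split.
  apply: measurableI; rewrite -[X in measurable X]setTI.
  - exact: measurable_rV_head.
  - exact: measurable_rV_tail.
rewrite /lebesgue_rV_cons /pushforward.
rewrite (_ : _ @^-1` _ = F k `*` G k); last first.
  apply/funext => -[a b] /=.
  by rewrite /rV_head rV_cons0 /rV_tail /rV_cons row_mxKr.
by rewrite product_measure1E// lte_mul_pinfty// ge0_fin_numE.
Qed.

HB.instance Definition _ := Measure_isSigmaFinite.Build _ _ _ lebesgue_rV_cons
  mc_sigma_finite.

End lebesgue_rV_cons.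

Fixpoint lebesgue_rV n : {sigma_finite_measure set (borelRV R n) -> \bar R} :=
  if n is n'.+1 then lebesgue_rV_cons (lebesgue_rV n')
  else @dirac _ (borelRV R 0) (0 : 'rV[R]_0) R.

Lemma lebesgue_rVS n (A : set (measurableTypeR R)) (B : set (borelRV R n)) :
  measurable A -> measurable B ->
  (lebesgue_rV n.+1 (@rV_head n @^-1` A `&` @rV_tail n @^-1` B) =
   lebesgue_measure A * lebesgue_rV n B)%E.
Proof.
move=> mA mB; rewrite /= /lebesgue_rV_cons /pushforward.
rewrite (_ : _ @^-1` _ = A `*` B) ?product_measure1E//.
apply/funext => -[a b] /=.
by rewrite /rV_head rV_cons0 /rV_tail /rV_cons row_mxKr.
Qed.

End lebesgue_rV.

Section generalized_gaussian.
Context {R : realType}.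

(* The norm `|x| of the library on 'rV[R]_n is the sup norm. *)
Definition enorm n (x : 'rV[R]_n) : R := Num.sqrt (\sum_(i < n) x 0 i ^+ 2).

Definition Gamma (s : R) : R :=
  \int[lebesgue_measure]_(t in `]0, +oo[) (t `^ (s - 1) * expR (- t)).

Definition upper_Gamma (s x : R) : R :=
  \int[lebesgue_measure]_(t in `[x, +oo[) (t `^ (s - 1) * expR (- t)).

Definition gen_gauss_cst (n : nat) (p : R) : R :=
  Gamma (n%:R / 2) /
  (2 * pi `^ (n%:R / 2) * p `^ (n%:R / p - 1) * Gamma (n%:R / p)).

Definition gen_gauss (n : nat) (p : R) (A : set (borelRV R n)) : \bar R :=
  (\int[lebesgue_rV n]_(x in A)
     (gen_gauss_cst n p * expR (- (enorm (x : 'rV[R]_n) `^ p / p)))%:E)%E.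

Definition convex_body n (K : set 'rV[R]_n) : Prop :=
  [/\ compact K, convex_set K & interior K !=set0].

Definition minkowski_comb n (lambda : R) (K L : set 'rV[R]_n) : set 'rV[R]_n :=
  [set lambda *: z.1 + (1 - lambda) *: z.2 | z in K `*` L].

(* mu K and mu L are positive and finite for the measures and bodies considered,
   so `^ is the ordinary real power. At exponent 0 the inequality is understood in the limiting sense. *)
Definition brunn_minkowski n (mu : set 'rV[R]_n -> \bar R) (alpha lambda : R)
    (K L : set 'rV[R]_n) : Prop :=
  let M := minkowski_comb lambda K L in
  (if alpha == 0%R then mu K `^ lambda * mu L `^ (1 - lambda) <= mu M
   else lambda%:E * mu K `^ alpha + (1 - lambda)%:E * mu L `^ alpha
        <= mu M `^ alpha)%E.

Definition bm_exponents (n : nat) (p : R) : set R :=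
  [set alpha | forall (K L : set 'rV[R]_n) (lambda : R),
    convex_body K -> convex_body L -> K 0 -> L 0 -> 0 <= lambda <= 1 ->
    brunn_minkowski (@gen_gauss n p) alpha lambda K L].

Definition is_largest (A : set R) (a : R) : Prop := A a /\ ubound A a.

Definition bm_lower_expr (n : nat) (p : R) : R :=
  let x := (p - 1) * n%:R / p in
  n%:R^-1 * expR x * x `^ (n%:R / p) * upper_Gamma (1 - n%:R / p) x.

(* For p = 1 the incomplete gamma factor is a divergent integral at x = 0. *)
Definition bm_lower (n : nat) (p : R) : R :=
  if p == 1 then lim (bm_lower_expr n q @[q --> 1^'+]) else bm_lower_expr n p.

Definition bm_upper (n : nat) (p : R) : R :=
  1 - p / (n%:R - 1) *
      (Gamma ((n%:R + p - 2) / p) * Gamma (n%:R / p) /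
       Gamma ((n%:R - 1) / p) ^+ 2).

End generalized_gaussian.

(* Main.v *)
Require Import Defs.
From mathcomp Require Import all_boot all_order all_algebra.
From mathcomp Require Import all_classical all_reals all_analysis.
From mathcomp Require Import measurable_realfun.
From mathcomp Require Import ring lra.

(** Write V(x) = |x|^p / p, and nu for the measure of density exp (- V); the
    normalizing constant cancels in the inequality.

    Lower bound.  Let M be the midpoint of two bodies A and B.  An induction
    on the dimension, whose one-dimensional step compares superlevel sets
    (functional_inequality), turns a pointwise inequality at midpoints into
    one for integrals, and each integration gains what the arithmetic mean
    gains over the geometric one.  The potential gains as well, since not only
    V but V^(1/p) is convex.  If a = ln (nu B) - ln (nu A) is small, the best
    that A and B can do against both gains is
      sqrt (nu A * nu B) <= int_M exp (- V(z) - (1 - o(1)) * k(z) * a^2 / 8) dz,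
    with k(z) = 1 / (n + V(z) / (1 - 1/p)) (mass_local).  When M contains the
    origin it is star-shaped, and k decreases along rays, so that the average
    of k over M is at least its average over the whole space (star_average).
    In polar coordinates the latter is the average of a Stieltjes kernel
    x / (x + s) against a Gamma law, which an incomplete Gamma function
    expresses: it is the constant c of the lower bound.  Hence
      nu M >= sqrt (nu A * nu B) * exp ((1 - o(1)) * c * a^2 / 8),
    which is to second order what concavity of nu^c demands at the midpoint;
    along the segment joining two bodies this local information propagates
    (tilted_log_concave).  At p = 1 the constant degenerates to 0 and
    log-concavity suffices.

    Upper bound.  The cones with apex at - t on the first axis, truncated at
    height h, form a concave family in t.  As their aperture tends to 0 their
    mass becomes, up to a factor, g(t) = int_(-t)^h (r + t)^(n-1) e^(-|r|^p/p) dr,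
    so an admissible exponent alpha > 0 makes g^alpha satisfy the tangent
    inequality at 0.  To second order in t that reads
    g(0) g''(0) <= (1 - alpha) g'(0)^2, and for h -> oo the three numbers are
    moments of e^(-r^p/p), that is, Gamma values
    (exponent_moment_inequality).

    The largest exponent exists because the admissible exponents are bounded
    above and every positive limit of admissible exponents is admissible. *)

Set Implicit Arguments.
Unset Strict Implicit.
Unset Printing Implicit Defensive.

Import Order.TTheory GRing.Theory Num.Theory.
Import numFieldNormedType.Exports.

Local Open Scope classical_set_scope.
Local Open Scope ring_scope.

(** * Affine substitutions on the line *)

Section affine.
Context {R : realType}.
Local Notation mu := (@lebesgue_measure R).
Local Open Scope ereal_scope.

Definition affine (a b : R) (x : measurableTypeR R) : measurableTypeR R := (a * x + b)%R.

Lemma measurable_affine a b : measurable_fun setT (affine a b).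
Proof. by apply: measurable_funD => //; exact: measurable_funM. Qed.

Lemma lebesgue_measure_affine (a b : R) (A : set R) : (0 < a)%R -> measurable A ->
  mu (affine a b @^-1` A) = (a^-1)%:E * mu A.
Proof.
move=> a0 mA.
pose m := mscale (NngNum (ltW a0))
  (measure_function_pushforward__canonical__measure_function_Measure mu
     (measurable_affine a b)).
have mE X : m X = a%:E * mu (affine a b @^-1` X) by [].
suff -> : mu A = a%:E * mu (affine a b @^-1` A).
  by rewrite muleA -EFinM mulVf ?mul1e// gt_eqF.
rewrite -mE; apply: lebesgue_measure_unique => //= _ [[c d]] _ <-.
pose J : set R := `]c, d]%classic.
change (mu J = a%:E * mu (affine a b @^-1` J)); rewrite /J.
have -> : affine a b @^-1` `]c, d]%classic = `]((c - b) / a)%R, ((d - b) / a)%R]%classic.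
  apply/seteqP; split => x /=; rewrite !in_itv/= /affine;
   by rewrite ltr_pdivrMr// ler_pdivlMr// ltrBlDr lerBrDr mulrC.
rewrite !lebesgue_measure_itv/= !lte_fin ltr_pM2r ?invr_gt0// ltrD2r.
case: ifP => cd; last by rewrite mule0.
rewrite -!EFinB -EFinM; congr EFin; field; exact: lt0r_neq0.
Qed.

Lemma ge0_integral_affine (a b : R) (f : R -> \bar R) : (0 < a)%R ->
  measurable_fun setT f -> (forall x, 0 <= f x) ->
  \int[mu]_x f (a * x + b)%R = (a^-1)%:E * \int[mu]_x f x.
Proof.
move=> a0 mf f0.
have -> : \int[mu]_x f (a * x + b)%R = \int[pushforward mu (affine a b)]_x f x.
  rewrite ge0_integral_pushforward ?preimage_setT//; exact: measurable_affine.
have ia0 : (0 <= a^-1)%R by rewrite invr_ge0 ltW.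
have -> : \int[pushforward mu (affine a b)]_x f x = \int[mscale (NngNum ia0) mu]_x f x.
  apply: eq_measure_integral => [|? A mA _]; first exact: measurable_affine.
  exact: lebesgue_measure_affine.
by rewrite ge0_integral_mscale.
Qed.

Lemma ge0_integral_linear (a c : R) (f : R -> \bar R) : (0 < a)%R -> (0 <= c)%R ->
  measurable_fun setT f -> (forall x, 0 <= f x) ->
  \int[mu]_x (c%:E * f (a * x)%R) = (a^-1 * c)%:E * \int[mu]_x f x.
Proof.
move=> a0 c0 mf f0; rewrite ge0_integralZl//; last first.
  by apply: (measurableT_comp mf); exact: measurable_funM.
under eq_integral do rewrite -[X in f X]addr0.
by rewrite ge0_integral_affine// muleA -EFinM mulrC.
Qed.
End affine.

(** * Lebesgue measure on row vectors *)

Section borel_rV.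
Context {R : realType}.

Lemma open_borelRV n (U : set 'rV[R]_n) : open U -> measurable (U : set (borelRV R n)).
Proof. by move=> oU; exact: sub_sigma_algebra. Qed.

Lemma closed_borelRV n (U : set 'rV[R]_n) : closed U ->
  measurable (U : set (borelRV R n)).
Proof.
move=> cU; rewrite -[U]setCK; apply: measurableC; apply: open_borelRV.
exact: closed_openC.
Qed.

Lemma continuous_borelRV n (f : 'rV[R]_n -> R) : continuous f ->
  measurable_fun setT (f : borelRV R n -> measurableTypeR R).
Proof.
move=> cf.
apply: (@measurability _ _ (borelRV R n) (measurableTypeR R) setT
  f _ (RGenOpens.measurableE R)).
move=> _ [U [a [b ->]] <-]; rewrite setTI; apply: open_borelRV.
by apply: open_comp; [move=> x _; exact: cf|exact: interval_open].
Qed.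

Lemma measurable_coord n (j : 'I_n) :
  measurable_fun setT ((fun v => v 0 j) : borelRV R n -> measurableTypeR R).
Proof. by apply: continuous_borelRV => x; exact: coord_continuous. Qed.

Lemma rV_cons_head_tail n (v : borelRV R n.+1) : rV_cons (rV_head v, rV_tail v) = v.
Proof.
apply/rowP => j; case: (split_ordP (j : 'I_(1 + n))) => k ->.
  rewrite (_ : lshift n k = 0 :> 'I_(1 + n)) ?rV_cons0//.
  by rewrite (ord1 k); exact/val_inj.
by rewrite rV_consS /rV_tail mxE.
Qed.

(** Induction on n: a vector is its head followed by its tail. *)
Lemma measurable_rV_coord d (T : measurableType d) n (F : T -> borelRV R n) :
  (forall j, measurable_fun setT (fun t => (F t : 'rV[R]_n) 0 j : measurableTypeR R)) ->
  measurable_fun setT F.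
Proof.
elim: n F => [|n IH] F mF.
  rewrite (_ : F = cst (0 : 'rV[R]_0)); first exact: measurable_cst.
  by apply/funext => t; apply/rowP => -[].
rewrite (_ : F = @rV_cons R n \o (fun t => (rV_head (F t), rV_tail (F t)))).
  apply: measurableT_comp; first exact: measurable_rV_cons.
  apply: measurable_fun_pair; first exact: mF.
  apply: IH => j.
  rewrite (_ : (fun t => _) = (fun t => (F t : 'rV[R]_(1 + n)) 0 (rshift 1 j))).
    exact: mF.
  by apply/funext => t; rewrite mxE.
by apply/funext => t /=; rewrite rV_cons_head_tail.
Qed.

Lemma measurable_rV_scale n : measurable_fun setT
  ((fun u => u.1 *: (u.2 : 'rV[R]_n)) : measurableTypeR R * borelRV R n -> borelRV R n).
Proof.
apply: measurable_rV_coord => j.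
rewrite (_ : (fun t => _) =
  (fun t : measurableTypeR R * borelRV R n => t.1 * (t.2 : 'rV[R]_n) 0 j)%R); last first.
  by apply/funext => t; rewrite mxE.
apply: measurable_funM; first exact: measurable_fst.
by apply: (measurableT_comp (measurable_coord j)); exact: measurable_snd.
Qed.

End borel_rV.

Section integral_lebesgue_rV.
Context {R : realType}.
Local Notation mu := (@lebesgue_measure R).
Local Open Scope ereal_scope.

Lemma ge0_integral_rV0 (f : borelRV R 0 -> \bar R) :
  \int[lebesgue_rV 0]_x f x = f (0 : 'rV[R]_0)%R.
Proof.
rewrite /= (_ : f = cst (f 0%R)); last by apply/funext => x /=; rewrite [x]thinmx0.
by rewrite integral_dirac//= diracT mul1e.
Qed.

Lemma ge0_integral_rVS n (f : borelRV R n.+1 -> \bar R) :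
  measurable_fun setT f -> (forall x, 0 <= f x) ->
  \int[lebesgue_rV n.+1]_x f x = \int[mu]_a \int[lebesgue_rV n]_b f (rV_cons (a, b)).
Proof.
move=> mf f0.
transitivity (\int[pushforward (mu \x lebesgue_rV n) (@rV_cons R n)]_x f x) => //.
rewrite ge0_integral_pushforward ?preimage_setT//; last exact: measurable_rV_cons.
rewrite (fubini_tonelli1 (f \o @rV_cons R n))//; last by move=> x /=.
by apply: (measurableT_comp mf); exact: measurable_rV_cons.
Qed.

Lemma measurable_rV_section n (f : borelRV R n.+1 -> \bar R) a :
  measurable_fun setT f -> measurable_fun setT (fun b => f (rV_cons (a, b))).
Proof.
move=> mf; apply: (measurableT_comp mf).
apply: (measurableT_comp (@measurable_rV_cons R n)).
exact: measurable_pair1.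
Qed.

Lemma measurable_rV_marginal n (f : borelRV R n.+1 -> \bar R) :
  measurable_fun setT f -> (forall x, 0 <= f x) ->
  measurable_fun setT (fun a : measurableTypeR R => \int[lebesgue_rV n]_b f (rV_cons (a, b))).
Proof.
move=> mf f0.
apply: (@measurable_fun_fubini_tonelli_F _ _ _ _ R (lebesgue_rV n)
   (fun z => f (rV_cons z))) => //.
by apply: measurableT_comp => //; exact: measurable_rV_cons.
Qed.

Lemma rV_cons_scale n (t : R) (a : R) (b : 'rV[R]_n) :
  (t *: (rV_cons (a, (b : borelRV R n)) : 'rV[R]_n.+1)
  = (rV_cons (t * a, t *: b) : 'rV[R]_n.+1))%R.
Proof. by rewrite /rV_cons (scale_row_mx t (a%:M : 'M[R]_1)%R b) scale_scalar_mx. Qed.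

(** Each coordinate contributes one factor t, by Tonelli. *)
Lemma ge0_integral_rV_scale n (t : R) (f : borelRV R n -> \bar R) : (0 < t)%R ->
  measurable_fun setT f -> (forall x, 0 <= f x) ->
  \int[lebesgue_rV n]_x f (t *: (x : 'rV[R]_n))%R =
  ((t ^+ n)^-1)%:E * \int[lebesgue_rV n]_x f x.
Proof.
move=> t0; elim: n f => [|n IH] f mf f0.
  by rewrite !ge0_integral_rV0 scaler0 expr0 invr1 mul1e.
have msc : measurable_fun setT (fun x : borelRV R n.+1 => f (t *: (x : 'rV[R]_n.+1))%R).
  have := measurableT_comp (@measurable_rV_scale R n.+1) (@measurable_pair1 _ _ _ _ t).
  exact: measurableT_comp.
rewrite ge0_integral_rVS// [in RHS]ge0_integral_rVS//.
pose H a := \int[lebesgue_rV n]_b f (rV_cons (a, b)).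
have mH : measurable_fun setT (H : measurableTypeR R -> \bar R).
  exact: measurable_rV_marginal mf f0.
have H0 a : 0 <= H a by exact: integral_ge0.
transitivity (\int[mu]_a (((t ^+ n)^-1)%:E * H (t * a)%R)).
  apply: eq_integral => a _; under eq_integral do rewrite rV_cons_scale.
  by rewrite (IH (fun b => f (rV_cons (t * a, b)%R)))//; exact: measurable_rV_section.
rewrite -/(H _) (ge0_integral_linear t0 _ mH H0); last by rewrite invr_ge0 exprn_ge0// ltW.
by rewrite exprS invfM.
Qed.

End integral_lebesgue_rV.

(** * The Brunn-Minkowski inequality on the line *)

Section brunn_minkowski_line.
Context {R : realType}.
Local Notation mu := (@lebesgue_measure R).
Local Open Scope ereal_scope.

(** C contains l * A + (1 - l) * b0 and l * a0 + (1 - l) * B. If b0 is close to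
    the infimum of B and a0 to the supremum of A, the first set lies to the left
    of the second one, up to an overlap that tends to 0. *)
Lemma brunn_minkowski_line (l : R) (A B C : set R) : (0 < l < 1)%R ->
  measurable A -> measurable B -> measurable C ->
  A !=set0 -> B !=set0 -> has_ubound A -> has_lbound B ->
  (forall a b, A a -> B b -> C (l * a + (1 - l) * b)%R) ->
  l%:E * mu A + (1 - l)%:E * mu B <= mu C.
Proof.
move=> /andP[l0 l1] mA mB mC A0 B0 ubA lbB ABC.
have k0 : (0 < 1 - l)%R by rewrite subr_gt0.
apply/lee_addgt0Pr => e e0.
have [a Aa sa] := sup_adherent e0 (conj A0 ubA).
have [b Bb ib] := inf_adherent e0 (conj B0 lbB).
set c := (l * a + (1 - l) * b)%R.
pose A' := affine l^-1 (- ((1 - l) * b / l)) @^-1` A.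
pose B' := affine (1 - l)^-1 (- (l * a / (1 - l))) @^-1` B.
have A'P z : A' z -> exists2 x, A x & z = (l * x + (1 - l) * b)%R.
  move=> A'z; exists (affine l^-1 (- ((1 - l) * b / l)) z) => //.
  by rewrite /affine; field; exact: lt0r_neq0.
have B'P z : B' z -> exists2 y, B y & z = (l * a + (1 - l) * y)%R.
  move=> B'z; exists (affine (1 - l)^-1 (- (l * a / (1 - l))) z) => //.
  by rewrite /affine; field; exact: lt0r_neq0.
have mA' : measurable A'.
  by rewrite -[A']setTI; apply: measurable_affine.
have mB' : measurable B'.
  by rewrite -[B']setTI; apply: measurable_affine.
have -> : l%:E * mu A = mu A'.
  by rewrite lebesgue_measure_affine ?invr_gt0// invrK.
have -> : (1 - l)%:E * mu B = mu B'.
  by rewrite lebesgue_measure_affine ?invr_gt0// invrK.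
pose A1 := A' `&` `]-oo, c]%classic; pose A2 : set R := `]c, (c + l * e)%R]%classic.
pose B1 := B' `&` `]c, +oo[%classic; pose B2 : set R := `[(c - (1 - l) * e)%R, c]%classic.
have mA1 : measurable A1 by exact: measurableI.
have mB1 : measurable B1 by exact: measurableI.
have hA : mu A' <= mu A1 + (l * e)%:E.
  have -> : (l * e)%:E = mu A2.
    rewrite lebesgue_measure_itv/= lte_fin ltrDl mulr_gt0//.
    by rewrite -EFinB addrAC subrr add0r.
  apply: le_trans (measureU2 mu mA1 _); last exact: measurable_itv.
  apply: le_measure; rewrite ?inE//.
    by apply: measurableU => //; exact: measurable_itv.
  move=> z A'z; have [x Ax zE] := A'P z A'z.
  have [zc|cz] := leP z c; first by left; split => //=; rewrite in_itv.
  right; rewrite /A2/= in_itv/=.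
  rewrite cz zE /c addrAC lerD2r -mulrDr ler_pM2l//.
  have := ub_le_sup ubA Ax; lra.
have hB : mu B' <= mu B1 + ((1 - l) * e)%:E.
  have -> : ((1 - l) * e)%:E = mu B2.
    rewrite lebesgue_measure_itv/= lte_fin gtrDl oppr_lt0 mulr_gt0//.
    by rewrite -EFinB opprB addrCA subrr addr0.
  apply: le_trans (measureU2 mu mB1 _); last exact: measurable_itv.
  apply: le_measure; rewrite ?inE//.
    by apply: measurableU => //; exact: measurable_itv.
  move=> z B'z; have [y By zE] := B'P z B'z.
  have [zc|cz] := leP z c; last by left; split => //=; rewrite in_itv/= cz.
  right; rewrite /B2/= in_itv/= zc andbT zE /c -addrA lerD2l -mulrBr ler_pM2l//.
  have := ge_inf lbB By; lra.
have AB : mu A1 + mu B1 <= mu C.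
  rewrite -measureU//; last first.
    apply/seteqP; split => // z [[_ /=]]; rewrite in_itv/= => zc [_ /=].
    by rewrite in_itv/= andbT ltNge zc.
  apply: le_measure; rewrite ?inE//; first exact: measurableU.
  move=> z [[/A'P[x Ax ->] _]|[/B'P[y By ->] _]]; exact: ABC.
apply: (le_trans (leeD hA hB)).
rewrite addeACA -EFinD (_ : l * e + (1 - l) * e = e)%R; last by ring.
by rewrite leeD2r.
Qed.

End brunn_minkowski_line.

(** * Functional inequalities on the line *)

Section layer_cake.
Context {R : realType} d (T : measurableType d) (m : {sigma_finite_measure set T -> \bar R}).
Local Notation mu := (@lebesgue_measure R).
Local Open Scope ereal_scope.

Lemma measurable_subgraph (f : T -> \bar R) : measurable_fun setT f ->
  measurable [set z : T * measurableTypeR R | z.2%:E < f z.1].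
Proof.
move=> mf.
have -> : [set z : T * measurableTypeR R | z.2%:E < f z.1] =
    setT `&` [set z : T * measurableTypeR R | 0 < f z.1 - z.2%:E].
  by rewrite setTI; apply/funext => z; rewrite /mkset sube_gt0.
apply: emeasurable_fun_o_infty => //.
apply: emeasurable_funB; first exact: measurableT_comp.
by apply/measurable_EFinP; exact: measurable_snd.
Qed.

Lemma measurable_superlevel (f : T -> \bar R) D : measurable_fun setT f ->
  measurable_fun D (fun t : measurableTypeR R => m [set x | t%:E < f x]).
Proof.
move=> /measurable_subgraph mA; apply: measurable_funTS.
rewrite (_ : (fun t => _) = m \o ysection [set z : T * measurableTypeR R | z.2%:E < f z.1]).
  exact: measurable_fun_ysection.
by apply/funext => t; rewrite /= ysectionE.
Qed.

(** Tonelli for the indicator of the subgraph of f. *)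
Lemma layer_cake (f : T -> \bar R) : measurable_fun setT f -> (forall x, 0 <= f x) ->
  \int[m]_x f x = \int[mu]_(t in `]0%R, +oo[) m [set x | t%:E < f x].
Proof.
move=> mf f0.
pose A : set (T * measurableTypeR R) :=
  (setT `&` snd @^-1` `]0%R, +oo[%classic) `&` [set z | z.2%:E < f z.1].
have AE : A = [set z | (0 < z.2)%R /\ z.2%:E < f z.1].
  by apply/seteqP; split => z; rewrite /A/= in_itv/= andbT; [case=> -[]|case].
have mA : measurable A.
  apply: measurableI; last exact: measurable_subgraph.
  by apply: measurable_snd => //; exact: measurable_itv.
have := indic_fubini_tonelli m mu mA.
rewrite indic_fubini_tonelli_FE// indic_fubini_tonelli_GE//.
have -> : mu \o xsection A = f.
  apply/funext => x; rewrite /= xsectionE AE.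
  transitivity (mu [set t : R | (0 < t)%R /\ t%:E < f x]) => //.
  have := f0 x; case: (f x) => [r||]//= r0.
  - rewrite (_ : [set _ | _] = `]0%R, r[%classic).
      rewrite lebesgue_measure_itv/= lte_fin.
      case: ltP => [_|]; first by rewrite sube0.
      by move=> r0'; apply/le_anti; rewrite r0 lee_fin.
    apply/seteqP; split => t /=; rewrite in_itv/= ?lte_fin; first by case=> -> ->.
    by case/andP.
  - rewrite (_ : [set _ | _] = `]0%R, +oo[%classic).
      by rewrite lebesgue_measure_itv/= ltry.
    apply/seteqP; split => t /=; rewrite in_itv/= andbT; first by case.
    by move=> t0; split => //; exact: ltry.
move=> ->; rewrite [RHS]integral_mkcond; apply: eq_integral => t _.
rewrite patchE [LHS]/= ysectionE AE; case: ifPn; rewrite ?inE ?notin_setE/= in_itv/= andbT => t0.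
  by congr (m _); apply/seteqP; split => x /=; [case|split].
rewrite (_ : _ @^-1` _ = set0) ?measure0//.
by apply/seteqP; split => x //= -[].
Qed.

End layer_cake.

Section functional_inequality_line.
Context {R : realType}.
Local Notation mu := (@lebesgue_measure R).

(** What is needed for one integration to turn a bound by M into a bound by M':
    M accounts for the suprema A and B of the two functions, s and t for the
    heights of superlevel sets relative to them, and F / A and G / B for the
    integrals of the functions divided by their suprema. *)
Definition mean_step (l : R) (M M' : R -> R -> R) :=
  [/\ forall A B, 0 < A -> 0 < B -> 0 < M A B,
      forall A B s t, 0 < A -> 0 < B -> 0 < s -> 0 < t ->
        Num.min s t * M A B <= M (A * s) (B * t) &
      forall A B F G, 0 < A -> 0 < B -> 0 < F -> 0 < G ->
        M' F G <= M A B * (l * (F / A) + (1 - l) * (G / B))].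

Local Open Scope ereal_scope.

(** Divide F and G by their suprema A and B. For t < 1 the superlevel sets of the
    quotients at height t are nonempty, and their combination lies in the set
    where H exceeds t * M A B. The Brunn-Minkowski inequality on the line bounds
    the measure of that set, and integrating over t gives the claim. *)
Lemma functional_inequality_line (l : R) (M M' : R -> R -> R) (N c : R)
    (F G : measurableTypeR R -> R) (H : measurableTypeR R -> \bar R) :
  (0 < l < 1)%R -> mean_step l M M' ->
  measurable_fun setT F -> measurable_fun setT G -> measurable_fun setT H ->
  (forall x, 0 <= F x <= c)%R -> (forall x, 0 <= G x <= c)%R -> (forall x, 0 <= H x) ->
  (forall x, 0 < F x -> `|x| <= N)%R -> (forall x, 0 < G x -> `|x| <= N)%R ->
  (forall x y, (0 < F x)%R -> (0 < G y)%R ->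
     (M (F x) (G y))%:E <= H (l * x + (1 - l) * y)%R) ->
  forall IF IG : R, (0 < IF)%R -> (0 < IG)%R ->
    \int[mu]_x (F x)%:E = IF%:E -> \int[mu]_x (G x)%:E = IG%:E ->
    (M' IF IG)%:E <= \int[mu]_x H x.
Proof.
move=> /andP[l0 l1] [M0 Mmin Mstep] mF mG mH Fc Gc H0 FN GN FGH IF IG IF0 IG0 FE GE.
have key (f : measurableTypeR R -> R) (I : R) : measurable_fun setT f ->
    (forall x, 0 <= f x <= c)%R -> (0 < I)%R -> \int[mu]_x (f x)%:E = I%:E ->
    exists A, [/\ (0 < A)%R, forall x, (f x <= A)%R,
      forall t, (t < 1)%R -> exists x, (t * A < f x)%R &
      (I / A)%:E = \int[mu]_(t in `]0%R, 1%R[) mu [set x | (t * A < f x)%R] ].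
  move=> mf fc I0 fI.
  have f0 x : (0 <= f x)%R by case/andP: (fc x).
  have hs : has_sup (range f).
    split; first by exists (f 0%R), 0%R.
    by exists c => _ [x _ <-]; case/andP: (fc x).
  have fA x : (f x <= sup (range f))%R by apply: ub_le_sup; [exact: (proj2 hs)|exists x].
  have A0 : (0 < sup (range f))%R.
    rewrite lt0r (le_trans (f0 0%R) (fA _)) andbT; apply/eqP => A0.
    move: fI; rewrite integral0_eq => [/eqP|x _].
      by rewrite eq_sym gt_eqF ?lte_fin.
    by congr EFin; apply/le_anti; rewrite f0 -A0 fA.
  exists (sup (range f)); split => //.
    move=> t t1.
    have e0 : (0 < (1 - t) * sup (range f))%R by rewrite mulr_gt0// subr_gt0.
    have [_ [x _ <-] h] := sup_adherent e0 hs.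
    by exists x; apply: le_lt_trans h; rewrite mulrBl mul1r opprB addrCA subrr addr0.
  set A := sup (range f) in fA A0 *.
  have -> : (I / A)%:E = \int[mu]_x (A^-1 * f x)%:E.
    under eq_integral do rewrite EFinM.
    rewrite ge0_integralZl//.
    - by rewrite fI -EFinM mulrC.
    - exact/measurable_EFinP.
    - by move=> x _; rewrite lee_fin.
    - by rewrite lee_fin invr_ge0 ltW.
  rewrite (layer_cake mu)//; last 2 first.
    by apply/measurable_EFinP; exact: measurable_funM.
    by move=> x; rewrite lee_fin mulr_ge0// invr_ge0 ltW.
  rewrite [LHS]integral_mkcond [RHS]integral_mkcond.
  apply: eq_integral => t _; rewrite !patchE.
  have setE : [set x | t%:E < (A^-1 * f x)%:E] = [set x | (t * A < f x)%R].
    by apply/seteqP; split => x /=; rewrite lte_fin (mulrC (A^-1)%R) ltr_pdivlMr.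
  rewrite setE.
  have [t1|t1] := ltP t 1%R.
    by congr (if _ then _ else _); apply/idP/idP; rewrite !inE/= !in_itv/= t1 andbT.
  rewrite [X in _ = if X then _ else _](_ : _ = false); last first.
    by apply/negP; rewrite inE/= in_itv/= (ltNge t) t1 andbF.
  case: ifP => // _; rewrite (_ : [set _ | _] = set0) ?measure0//.
  apply/seteqP; split => x //=; apply/negP; rewrite -leNgt.
  by apply: (le_trans (fA x)); rewrite ler_peMl// ltW.
have [A [A0 FA FAx FAI]] := key F IF mF Fc IF0 FE.
have [B [B0 GB GBx GBI]] := key G IG mG Gc IG0 GE.
have m0 := M0 _ _ A0 B0.
apply: (@le_trans _ _ ((M A B)%:E * (l%:E * (IF / A)%:E + (1 - l)%:E * (IG / B)%:E))).
  by rewrite -!EFinM lee_fin; exact: Mstep.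
have -> : \int[mu]_x H x = (M A B)%:E * \int[mu]_x ((M A B)^-1%:E * H x).
  rewrite ge0_integralZl//; last by rewrite lee_fin invr_ge0 ltW.
  by rewrite muleA -EFinM mulfV ?gt_eqF// mul1e.
rewrite lee_pmul2l//.
rewrite (layer_cake mu); last 2 first.
- exact: measurable_funeM.
- by move=> x; rewrite mule_ge0// lee_fin invr_ge0 ltW.
have ms (f : measurableTypeR R -> R) a : measurable_fun setT f ->
    measurable [set x | (a < f x)%R].
  move=> mf; rewrite -[X in measurable X]setTI.
  rewrite (_ : [set x | _] = f @^-1` `]a, +oo[%classic); last first.
    by apply/seteqP; split => x /=; rewrite in_itv/= andbT.
  by apply: mf => //; exact: measurable_itv.
rewrite FAI GBI.
have msf D (f : measurableTypeR R -> R) (a : R) : (0 < a)%R -> measurable_fun setT f ->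
    measurable_fun D (fun t : measurableTypeR R => mu [set x | (t * a < f x)%R]).
  move=> a0 mf.
  rewrite (_ : (fun t => _) = (fun t : measurableTypeR R => mu [set x | t%:E < (f x / a)%:E])).
    by apply: measurable_superlevel; apply/measurable_EFinP; exact: measurable_funM.
  apply/funext => t; congr (mu _); apply/seteqP; split => x /=;
  by rewrite lte_fin ltr_pdivlMr.
rewrite -ge0_integralZl//; [|exact: msf|by rewrite lee_fin ltW].
rewrite -ge0_integralZl//; [|exact: msf|by rewrite lee_fin subr_ge0 ltW].
rewrite -ge0_integralD//; last 4 first.
- by move=> t _; rewrite mule_ge0// lee_fin ltW.
- by apply: measurable_funeM; exact: msf.
- by move=> t _; rewrite mule_ge0// lee_fin subr_ge0 ltW.
- by apply: measurable_funeM; exact: msf.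
apply: (@le_trans _ _ (\int[mu]_(t in `]0%R, 1%R[) mu [set x | t%:E < (M A B)^-1%:E * H x])); last first.
  apply: ge0_subset_integral => //.
    by apply: measurable_superlevel; exact: measurable_funeM.
  by move=> t /=; rewrite !in_itv/= => /andP[->].
apply: ge0_le_integral => //.
- by move=> t _; rewrite adde_ge0// mule_ge0// lee_fin ?subr_ge0 ltW.
- by apply: emeasurable_funD; apply: measurable_funeM; exact: msf.
- by apply: measurable_superlevel; exact: measurable_funeM.
move=> t /=; rewrite in_itv/= => /andP[t0 t1].
have bnd (f : measurableTypeR R -> R) a : (0 < a)%R -> (forall x, 0 < f x -> `|x| <= N)%R ->
    forall x, (t * a < f x)%R -> (`|x| <= N)%R.
  by move=> a0 fN x tx; apply: fN; apply: lt_trans tx; exact: mulr_gt0.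
apply: brunn_minkowski_line; rewrite ?l0//; try exact: ms.
- rewrite -[X in measurable X]setTI; apply: emeasurable_fun_o_infty => //.
  exact: measurable_funeM.
- exact: FAx.
- exact: GBx.
- by exists N => x /= /(bnd _ _ A0 FN); rewrite ler_norml => /andP[].
- by exists (- N)%R => x /= /(bnd _ _ B0 GN); rewrite ler_norml => /andP[].
move=> x y /= tx ty.
have Fx0 : (0 < F x)%R by apply: lt_trans tx; exact: mulr_gt0.
have Gy0 : (0 < G y)%R by apply: lt_trans ty; exact: mulr_gt0.
rewrite muleC lte_pdivlMr//.
apply: lt_le_trans (FGH _ _ Fx0 Gy0).
rewrite -EFinM lte_fin.
have := Mmin _ _ (F x / A)%R (G y / B)%R A0 B0 (divr_gt0 Fx0 A0) (divr_gt0 Gy0 B0).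
rewrite !(mulrC A) !(mulrC B) !divfK ?gt_eqF//; apply: lt_le_trans.
by rewrite ltr_pM2r// lt_min !ltr_pdivlMr// tx ty.
Qed.

End functional_inequality_line.

(** * Functional inequalities in dimension n *)

Section functional_inequality.
Context {R : realType}.
Local Notation mu := (@lebesgue_measure R).
Local Open Scope ereal_scope.

Definition supported_in_cube n (N : R) (f : borelRV R n -> R) :=
  forall x, (0 < f x)%R -> forall j, (`|(x : 'rV[R]_n) 0 j| <= N)%R.

Lemma supported_section n N (f : borelRV R n.+1 -> R) a :
  supported_in_cube N f -> supported_in_cube N (fun b => f (rV_cons (a, b))).
Proof. by move=> fN b /fN/(_ (rshift 1 _)) h j; have := h j; rewrite rV_consS. Qed.

Lemma supported_head n N (f : borelRV R n.+1 -> R) a b :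
  supported_in_cube N f -> (0 < f (rV_cons (a, b)))%R -> (`|a| <= N)%R.
Proof. by move=> fN /fN/(_ (0%R : 'I_n.+1)); rewrite rV_cons0. Qed.

(** Stated for functions rather than sets so that the induction on the dimension
    can integrate one variable at a time. *)
Lemma integral_le_cube n (N c : R) (f : borelRV R n -> R) : (0 <= N)%R -> (0 <= c)%R ->
  measurable_fun setT f -> (forall x, 0 <= f x <= c)%R -> supported_in_cube N f ->
  \int[lebesgue_rV n]_x (f x)%:E <= (c * (2 * N) ^+ n)%:E.
Proof.
move=> N0 c0; elim: n f => [|n IH] f mf fc fN.
  by rewrite ge0_integral_rV0 expr0 mulr1 lee_fin; case/andP: (fc 0%R).
have f0 x : 0 <= (f x)%:E by rewrite lee_fin; case/andP: (fc x).
have mfE : measurable_fun setT (fun x => (f x)%:E) by exact/measurable_EFinP.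
rewrite ge0_integral_rVS//.
apply: (@le_trans _ _ (\int[mu]_(a in `[(- N)%R, N]) (cst (c * (2 * N) ^+ n)%:E a))); last first.
  rewrite integral_cst//= lebesgue_measure_itv/= lte_fin.
  case: ltP => [_|NN]; last by rewrite mule0 lee_fin mulr_ge0// exprn_ge0// mulr_ge0.
  rewrite -EFinB opprK -EFinM lee_fin exprSr mulrA.
  by rewrite (_ : N + N = 2 * N)%R//; ring.
rewrite [leRHS]integral_mkcond; apply: ge0_le_integral => //.
- by move=> a _; exact: integral_ge0.
- exact: (measurable_rV_marginal mfE).
- by apply: (proj1 (measurable_restrictT _ _)) => //; exact: measurable_itv.
move=> a _; rewrite patchE; case: ifPn => aN.
  apply: IH => //; first by apply/measurable_EFinP; exact: (measurable_rV_section a mfE).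
  exact: supported_section.
rewrite integral0_eq// => b _; congr EFin; apply/eqP.
rewrite eq_le; apply/andP; split; last by rewrite -lee_fin.
rewrite leNgt; apply: contra aN => fab.
by rewrite inE/= in_itv/= -ler_norml; exact: (supported_head fN fab).
Qed.

(** M j is the mean that governs masses after j integrations. The induction
    hypothesis, applied to the sections of f, g and h over the first coordinate,
    brings the problem to the line. *)
Lemma functional_inequality n (l : R) (M : nat -> R -> R -> R) (N c : R)
    (f g : borelRV R n -> R) (h : borelRV R n -> \bar R) :
  (0 < l < 1)%R -> (0 <= N)%R -> (0 <= c)%R ->
  (forall j, (j < n)%N -> mean_step l (M j) (M j.+1)) ->
  measurable_fun setT f -> measurable_fun setT g -> measurable_fun setT h ->
  (forall x, 0 <= f x <= c)%R -> (forall x, 0 <= g x <= c)%R -> (forall x, 0 <= h x) ->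
  supported_in_cube N f -> supported_in_cube N g ->
  (forall x y : 'rV[R]_n, (0 < f x)%R -> (0 < g y)%R ->
     (M 0 (f x) (g y))%:E <= h (l *: x + (1 - l) *: y)%R) ->
  forall If Ig : R, (0 < If)%R -> (0 < Ig)%R ->
    \int[lebesgue_rV n]_x (f x)%:E = If%:E -> \int[lebesgue_rV n]_x (g x)%:E = Ig%:E ->
    (M n If Ig)%:E <= \int[lebesgue_rV n]_x h x.
Proof.
move=> l01 N0 c0; elim: n f g h => [|n IH] f g h MS mf mg mh fc gc h0 fN gN fgh If Ig If0 Ig0.
  rewrite !ge0_integral_rV0 => -[fE] [gE]; rewrite -fE -gE.
  have := fgh 0%R 0%R; rewrite fE gE => /(_ If0 Ig0).
  by rewrite !scaler0 addr0.
pose marg (u : borelRV R n.+1 -> R) (a : measurableTypeR R) : R :=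
  fine (\int[lebesgue_rV n]_b (u (rV_cons (a, b)))%:E).
have C0 : (0 <= c * (2 * N) ^+ n)%R by rewrite mulr_ge0// exprn_ge0// mulr_ge0.
have margP (u : borelRV R n.+1 -> R) : measurable_fun setT u -> (forall x, 0 <= u x <= c)%R ->
    supported_in_cube N u ->
    [/\ forall a, (marg u a)%:E = \int[lebesgue_rV n]_b (u (rV_cons (a, b)))%:E,
        measurable_fun setT (marg u),
        forall a, (0 <= marg u a <= c * (2 * N) ^+ n)%R,
        forall a, (0 < marg u a -> `|a| <= N)%R &
        \int[mu]_a (marg u a)%:E = \int[lebesgue_rV n.+1]_x (u x)%:E].
  move=> mu' uc uN.
  have u0 x : 0 <= (u x)%:E by rewrite lee_fin; case/andP: (uc x).
  have mfE : measurable_fun setT (fun x => (u x)%:E) by exact/measurable_EFinP.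
  have le (a : R) : \int[lebesgue_rV n]_b (u (rV_cons (a, b)))%:E <= (c * (2 * N) ^+ n)%:E.
    apply: integral_le_cube => //; last exact: supported_section.
    by apply/measurable_EFinP; exact: (measurable_rV_section a mfE).
  have ge (a : R) : 0 <= \int[lebesgue_rV n]_b (u (rV_cons (a, b)))%:E by exact: integral_ge0.
  have E (a : R) : (marg u a)%:E = \int[lebesgue_rV n]_b (u (rV_cons (a, b)))%:E.
    by rewrite fineK// ge0_fin_numE// (le_lt_trans (le a))// ltry.
  split => //.
  - apply/measurable_EFinP; rewrite (_ : EFin \o _ = fun a => \int[lebesgue_rV n]_b (u (rV_cons (a, b)))%:E).
      exact: (measurable_rV_marginal mfE).
    by apply/funext => a /=.
  - by move=> a; rewrite -!lee_fin E le ge.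
  - move=> a ma; rewrite leNgt; apply/negP => Na.
    move: ma; rewrite -lte_fin E integral0_eq ?ltxx// => b _.
    congr EFin; apply/eqP; rewrite eq_le -[X in _ && X]lee_fin u0 andbT.
    by rewrite leNgt; apply/negP => /(supported_head uN); rewrite leNgt Na.
  - by rewrite ge0_integral_rVS//; apply: eq_integral => a _.
have [FE mF Fc FN FI] := margP f mf fc fN.
have [GE mG Gc GN GI] := margP g mg gc gN.
rewrite -FI -GI => IfE IgE.
rewrite ge0_integral_rVS//.
apply: (functional_inequality_line l01 (MS n (ltnSn n)) mF mG _ Fc Gc _ FN GN _ If0 Ig0 IfE IgE).
- exact: (measurable_rV_marginal mh).
- by move=> a; exact: integral_ge0.
move=> a b Fa Gb.
apply: (IH (fun x => f (rV_cons (a, x))) (fun x => g (rV_cons (b, x)))) => //.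
- by move=> j jn; apply: MS; exact: ltnW.
- apply/measurable_EFinP.
  by apply: (@measurable_rV_section _ _ (EFin \o f) a); exact/measurable_EFinP.
- apply/measurable_EFinP.
  by apply: (@measurable_rV_section _ _ (EFin \o g) b); exact/measurable_EFinP.
- exact: measurable_rV_section.
- exact: (@supported_section _ _ _ a fN).
- exact: (@supported_section _ _ _ b gN).
move=> x y fx gy; have := fgh _ _ fx gy.
rewrite !rV_cons_scale (_ : (rV_cons _ + rV_cons _)%R =
  (rV_cons (l * a + (1 - l) * b, l *: x + (1 - l) *: y) : 'rV[R]_n.+1)%R)//.
by rewrite /rV_cons/= (add_row_mx ((l * a)%:M : 'M[R]_1)) -raddfD.
Qed.

End functional_inequality.

(** * Second-order inequalities for real functions *)

Section second_order.
Context {R : realType}.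

Lemma derive_ge0_le (f df : R -> R) (x : R) : 0 <= x ->
  (forall t, 0 <= t <= x -> is_derive t 1 f (df t)) ->
  (forall t, 0 <= t <= x -> 0 <= df t) -> f 0 <= f x.
Proof.
move=> x0 fdf df0.
have d1 t : t \in `]0, x[%R -> is_derive t 1 f (df t).
  by rewrite in_itv/= => /andP[/ltW t0 /ltW tx]; apply: fdf; rewrite t0.
have cf : {within `[0, x], continuous f}.
  apply: derivable_within_continuous => t; rewrite in_itv/= => h.
  by have [] := fdf t h.
have [c] := MVT_segment x0 d1 cf.
rewrite in_itv/= => h /eqP; rewrite subr_eq => /eqP ->.
by rewrite lerDr subr0 mulr_ge0// df0.
Qed.

Lemma second_derivative_ge0 (f f' f'' : R -> R) (x : R) : 0 <= x ->
  (forall t, 0 <= t <= x -> is_derive t 1 f (f' t)) ->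
  (forall t, 0 <= t <= x -> is_derive t 1 f' (f'' t)) ->
  (forall t, 0 <= t <= x -> 0 <= f'' t) -> f' 0 = 0 -> f 0 <= f x.
Proof.
move=> x0 d1 d2 f2 f'0; apply: (derive_ge0_le x0 d1) => t /andP[t0 tx].
rewrite -f'0; apply: (derive_ge0_le t0 _ _) => [s|s] /andP[s0 st].
  by apply: d2; rewrite s0 (le_trans st).
by apply: f2; rewrite s0 (le_trans st).
Qed.

Lemma cosh_ge (x : R) : 2 + x ^+ 2 <= expR x + expR (- x).
Proof.
wlog x0 : x / 0 <= x.
  move=> H; have [/H//|/ltW x0] := leP 0 x.
  by have := H (- x); rewrite oppr_ge0 => /(_ x0); rewrite sqrrN opprK [leRHS]addrC.
pose f (t : R) := expR t + expR (- t) - t ^+ 2.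
pose f' (t : R) := expR t - expR (- t) - 2 * t.
pose f'' (t : R) := expR t + expR (- t) - 2.
suff : f 0 <= f x by rewrite /f oppr0 expR0 expr0n/=; lra.
apply: (@second_derivative_ge0 f f' f'').
- exact: x0.
- move=> t _; apply: is_derive_eq; rewrite /f' /GRing.scale/=; ring.
- move=> t _; apply: is_derive_eq; rewrite /f'' /GRing.scale/=; ring.
- by move=> t _; rewrite /f''; have := expR_ge1Dx t; have := expR_ge1Dx (- t); lra.
- by rewrite /f' oppr0 expR0; ring.
Qed.

(** For t < 1 the right side minus the left side vanishes at 0 together with its
    derivative and has a nonnegative second derivative. The endpoint t = 1, where
    the left side is not differentiable, follows by scaling and approximation. *)
Lemma powR_second_difference (s t : R) : 0 < s <= 1 -> 0 <= t <= 1 ->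
  (1 + t) `^ s + (1 - t) `^ s <= 2 - s * (1 - s) * t ^+ 2.
Proof.
move=> /andP[s0 s1].
have lt1 x : 0 <= x < 1 -> (1 + x) `^ s + (1 - x) `^ s <= 2 - s * (1 - s) * x ^+ 2.
  move=> /andP[x0 x1].
  pose f (t : R) := - s * (1 - s) * t ^+ 2 - expR (s * ln (1 + t)) - expR (s * ln (1 - t)).
  pose f' (t : R) := - 2 * s * (1 - s) * t - s * expR ((s - 1) * ln (1 + t))
     + s * expR ((s - 1) * ln (1 - t)).
  pose f'' (t : R) := - 2 * s * (1 - s) + s * (1 - s) * expR ((s - 2) * ln (1 + t))
     + s * (1 - s) * expR ((s - 2) * ln (1 - t)).
  have p (y : R) : 0 < y -> forall r, y `^ r = expR (r * ln y).
    by move=> y0 r; rewrite /powR gt_eqF.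
  suff : f 0 <= f x.
    by rewrite /f !p ?addr0 ?subr0 ?ln1 ?mulr0 ?expR0 ?expr0n/=; lra.
  have pos (y : R) : 0 <= y <= x -> (0 < 1 + y) /\ (0 < 1 - y) by lra.
  have dpow (c r : R) (y : R) : 0 < 1 + c * y ->
      is_derive y 1 (fun t : R => expR (r * ln (1 + c * t)))
        (c * r * expR ((r - 1) * ln (1 + c * y))).
    move=> y0.
    have d1 : is_derive y 1 (fun t : R => 1 + c * t) c.
      by apply: is_derive_eq; rewrite /GRing.scale/=; ring.
    have d2 := @is_derive1_comp R (@ln R) (fun t => 1 + c * t) y _ _ (is_derive1_ln y0) d1.
    have d3 : is_derive y 1 (fun t : R => r * ln (1 + c * t)) (r * ((1 + c * y)^-1 * c)).
      exact: is_deriveZ.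
    have d4 := @is_derive1_comp R expR (fun t => r * ln (1 + c * t)) y _ _ (is_derive_expR _) d3.
    apply: (is_derive_eq d4).
    rewrite mulrBl mul1r expRB lnK ?posrE//; ring.
  have dpow1 (r y : R) : 0 < 1 + y -> is_derive y 1 (fun t : R => expR (r * ln (1 + t)))
      (r * expR ((r - 1) * ln (1 + y))).
    have := dpow 1 r y; rewrite !mul1r => h /h.
    by congr (is_derive _ _ _ _); apply/funext => z; rewrite mul1r.
  have dpowN (r y : R) : 0 < 1 - y -> is_derive y 1 (fun t : R => expR (r * ln (1 - t)))
      (- r * expR ((r - 1) * ln (1 - y))).
    have := dpow (-1) r y; rewrite !mulN1r => h /h.
    by congr (is_derive _ _ _ _); apply/funext => z; rewrite mulN1r.
  apply: (@second_derivative_ge0 f f' f'' x x0).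
  - move=> y /pos[y1 y2].
    have h1 := dpow1 s _ y1; have h2 := dpowN s _ y2.
    have h0 : is_derive y 1 (fun t : R => - s * (1 - s) * t ^+ 2) (- s * (1 - s) * (2 * y)).
      by apply: is_derive_eq; rewrite /GRing.scale/=; ring.
    apply: (is_derive_eq (is_deriveB (is_deriveB h0 h1) h2)); rewrite /f'; ring.
  - move=> y /pos[y1 y2].
    have h1 := dpow1 (s - 1) _ y1; have h2 := dpowN (s - 1) _ y2.
    have h0 : is_derive y 1 (fun t : R => - 2 * s * (1 - s) * t) (- 2 * s * (1 - s)).
      by apply: is_derive_eq; rewrite /GRing.scale/=; ring.
    apply: (is_derive_eq (is_deriveD (is_deriveB h0 (is_deriveZ s h1)) (is_deriveZ s h2))).
    rewrite /f'' /GRing.scale/= (_ : s - 1 - 1 = s - 2); ring.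
  - move=> y /pos[y1 y2]; rewrite /f''.
    have h3 := expR_ge1Dx ((s - 2) * ln (1 + y)); have h4 := expR_ge1Dx ((s - 2) * ln (1 - y)).
    have h1 : ln (1 + y) <= y by apply: le_ln1Dx; lra.
    have h2 : ln (1 - y) <= - y by apply: le_ln1Dx; lra.
    have h5 : 0 <= (2 - s) * (0 - ln (1 + y) - ln (1 - y)) by apply: mulr_ge0; lra.
    have h6 : 0 <= s * (1 - s) by apply: mulr_ge0; lra.
    have h7 : 0 <= s * (1 - s) * (expR ((s - 2) * ln (1 + y)) + expR ((s - 2) * ln (1 - y)) - 2).
      by apply: mulr_ge0 => //; lra.
    lra.
  - rewrite /f' addr0 subr0 ln1 !mulr0 expR0; ring.
move=> /andP[t0]; rewrite le_eqVlt => /predU1P[->|t1]; last by apply: lt1; rewrite t0.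
have s0' : s != 0 by rewrite gt_eqF.
rewrite subrr powR0// addr0 expr1n mulr1.
have c0 : 0 <= s * (1 - s) by apply: mulr_ge0; lra.
have c1 : s * (1 - s) <= 1 by nra.
have H d : 0 < d < 1 -> (1 + 1) `^ s * (2 - d) <= 2 * (2 - s * (1 - s) * (1 - d) ^+ 2).
  move=> d01; have := lt1 (1 - d) ltac:(lra).
  have := powR_ge0 (1 - (1 - d)) s => h0 h1.
  have h2 : (1 + 1) `^ s <= 2 / (2 - d) * (1 + (1 - d)) `^ s.
    have -> : 1 + 1 = 2 / (2 - d) * (1 + (1 - d)) :> R by field; lra.
    rewrite powRM; [|apply: divr_ge0; lra|lra].
    rewrite ler_wpM2r ?powR_ge0// ler1_powR//.
    rewrite ler_pdivlMr; lra.
  have h3 : 2 / (2 - d) * (1 + (1 - d)) `^ s <= 2 / (2 - d) * (2 - s * (1 - s) * (1 - d) ^+ 2).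
    rewrite ler_wpM2l; [by []|apply: divr_ge0; lra|lra].
  by have := le_trans h2 h3; rewrite [leRHS]mulrAC ler_pdivlMr//; lra.
have P4 : 0 <= (1 + 1) `^ s by exact: powR_ge0.
rewrite leNgt; apply/negP => lt.
set P := (1 + 1) `^ s in H P4 lt *; set c := s * (1 - s) in H c0 c1 lt *.
pose e := P - (2 - c).
have e0 : 0 < e by rewrite /e; lra.
have K : 0 < P + 4 by lra.
pose d := Num.min 2^-1 (e / (P + 4)).
have d0 : 0 < d by rewrite /d lt_min invr_gt0 ltr0n divr_gt0.
have d1 : d < 1 by rewrite /d gt_min; apply/orP; left; lra.
have d2 : d * (P + 4) <= e by rewrite -ler_pdivlMr// /d ge_min lexx orbT.
have := H d ltac:(lra); rewrite /e in d2.
nra.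
Qed.

End second_order.

(** * Means that survive integration *)

Section means.
Context {R : realType}.

Definition geometric_mean (l a b : R) : R := expR (l * ln a + (1 - l) * ln b).

Lemma weighted_AM_GM (l u v : R) : 0 <= l <= 1 ->
  expR (l * u + (1 - l) * v) <= l * expR u + (1 - l) * expR v.
Proof.
move=> /andP[l0 l1]; set m := l * u + (1 - l) * v.
have := expR_ge1Dx (u - m); have := expR_ge1Dx (v - m); rewrite !expRB.
have e0 := expR_gt0 m; rewrite !ler_pdivlMr// => hv hu.
have l1' : 0 <= 1 - l by lra.
have := ler_wpM2l l0 hu; have := ler_wpM2l l1' hv.
by rewrite /m; lra.
Qed.

(** The third condition is the weighted arithmetic-geometric mean inequality. *)
Lemma geometric_mean_step (l : R) : 0 < l < 1 ->
  mean_step l (geometric_mean l) (geometric_mean l).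
Proof.
move=> /andP[l0 l1]; split.
- by move=> A B _ _; exact: expR_gt0.
- move=> A B s t A0 B0 s0 t0.
  rewrite -[Num.min s t]lnK; last by rewrite posrE lt_min s0.
  rewrite -expRD ler_expR !lnM ?posrE//.
  have hs : ln (Num.min s t) <= ln s by rewrite ler_ln ?posrE ?lt_min ?s0// ge_min lexx.
  have ht : ln (Num.min s t) <= ln t.
    by rewrite ler_ln ?posrE ?lt_min ?s0// ge_min lexx orbT.
  nra.
- move=> A B F G A0 B0 F0 G0.
  have l01 : 0 <= l <= 1 by rewrite (ltW l0) (ltW l1).
  have := weighted_AM_GM (ln (F / A)) (ln (G / B)) l01.
  rewrite !lnK ?posrE ?divr_gt0//.
  rewrite -(ler_pM2l (expR_gt0 (l * ln A + (1 - l) * ln B))) -expRD.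
  by apply: le_trans; rewrite !ln_div ?posrE// /geometric_mean ler_expR; lra.
Qed.

(** The geometric mean with a penalty depending on the ratio of the two masses. *)
Definition tilted_mean (psi : R -> R) (a b : R) : R :=
  expR ((ln a + ln b) / 2 - psi (ln a - ln b)).

(** Let u be the logarithm of the ratio of the suprema and v that of the ratio of
    the integrals. The arithmetic mean exceeds the geometric one by a factor of
    at least exp (chi (v - u)), which pays for the excess of psi u over psi' v. *)
Lemma tilted_mean_step (psi psi' chi : R -> R) :
  (forall w, expR (chi w) <= (expR (w / 2) + expR (- (w / 2))) / 2) ->
  (forall u v, psi u <= psi v + `|u - v| / 2) ->
  (forall u v, psi u <= psi' v + chi (v - u)) ->
  mean_step 2^-1 (tilted_mean psi) (tilted_mean psi').
Proof.
move=> chi_cosh psi_lip psi_chi; split.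
- by move=> A B _ _; exact: expR_gt0.
- move=> A B s t A0 B0 s0 t0.
  rewrite -[Num.min s t]lnK; last by rewrite posrE lt_min s0.
  rewrite -expRD ler_expR !lnM ?posrE//.
  have -> : ln (Num.min s t) = (ln s + ln t) / 2 - `|ln s - ln t| / 2.
    have [st|ts] := ltP s t.
      by rewrite ltr0_norm ?subr_lt0 ?ltr_ln ?posrE//; lra.
    by rewrite ger0_norm ?subr_ge0 ?ler_ln ?posrE//; lra.
  have := psi_lip (ln A + ln s - (ln B + ln t)) (ln A - ln B).
  rewrite (_ : _ - _ - _ = ln s - ln t); last by ring.
  lra.
- move=> A B F G A0 B0 F0 G0.
  set p := ln (F / A); set q := ln (G / B).
  have pE : p = ln F - ln A by rewrite /p ln_div ?posrE.
  have qE : q = ln G - ln B by rewrite /q ln_div ?posrE.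
  rewrite -[F / A]lnK ?posrE ?divr_gt0// -[G / B]lnK ?posrE ?divr_gt0// -/p -/q.
  have -> : 2^-1 * expR p + (1 - 2^-1) * expR q =
      expR ((p + q) / 2) * ((expR ((p - q) / 2) + expR (- ((p - q) / 2))) / 2).
    rewrite mulrA mulrDr -!expRD (_ : (p + q) / 2 + (p - q) / 2 = p); last by lra.
    by rewrite (_ : (p + q) / 2 - (p - q) / 2 = q); lra.
  apply: (@le_trans _ _ (tilted_mean psi A B * (expR ((p + q) / 2) * expR (chi (p - q))))).
    rewrite -!expRD ler_expR.
    have := psi_chi (ln A - ln B) (ln F - ln G).
    rewrite (_ : ln F - ln G - _ = p - q); last by rewrite pE qE; ring.
    by rewrite pE qE; lra.
  by rewrite !ler_pM2l ?expR_gt0.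
Qed.

(** The penalty kappa * u^2 / (2 m) when m integrations remain. The cap C makes it
    1/2-Lipschitz, and for m = 0 the penalty |u| / 2 turns the tilted mean into
    the minimum. *)
Definition capped (kappa C : R) (m : nat) (u : R) : R :=
  if m is 0%N then `|u| / 2 else Num.min (kappa * u ^+ 2 / (2 * m%:R)) C.

(** The constant (1 - e) / 4 is just below that of w^2 / 8, the leading
    term of ln (cosh (w / 2)), which leaves room for the higher-order terms up
    to the cap. *)
Lemma capped_cosh (e w : R) : 0 < e < 1 ->
  expR (capped ((1 - e) / 4) (Num.min e 2^-1) 1 w) <= (expR (w / 2) + expR (- (w / 2))) / 2.
Proof.
move=> /andP[e0 e1]; have ch := cosh_ge (w / 2).
apply: (@le_trans _ _ (1 + w ^+ 2 / 8)); last first.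
  have -> : w ^+ 2 / 8 = (w / 2) ^+ 2 / 2 by field.
  lra.
set y := capped _ _ _ _.
have y1 : y <= (1 - e) * (w ^+ 2 / 8).
  by rewrite /y/= ge_min; apply/orP; left; rewrite mulr1; lra.
have y2 : y <= e by rewrite /y/= !ge_min lexx/= orbT.
have w0 : 0 <= w ^+ 2 / 8 by rewrite divr_ge0 ?sqr_ge0.
set z := w ^+ 2 / 8 in y1 w0 *.
have := expR_ge1Dx (- y); rewrite expRN => h.
have ey := expR_gt0 y.
have : (1 - y) * expR y <= 1 by rewrite -ler_pdivlMr// mul1r.
have : 1 <= (1 - y) * (1 + z) by nra.
move=> h1 h2.
rewrite -(ler_pM2l (_ : 0 < 1 - y)); last by lra.
exact: (le_trans h2).
Qed.

Lemma capped_lipschitz (k C : R) m (u v : R) : 0 <= k <= 1/4 -> 0 <= C <= 1/2 ->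
  capped k C m u <= capped k C m v + `|u - v| / 2.
Proof.
move=> /andP[k0 k1] /andP[C0 C1]; case: m => [|m] /=.
  have := ler_normD v (u - v); rewrite addrC subrK; lra.
have m0 : 0 < 2 * m.+1%:R :> R by rewrite mulr_gt0.
set a := k / (2 * m.+1%:R).
have aE x : k * x ^+ 2 / (2 * m.+1%:R) = a * x ^+ 2 by rewrite mulrAC.
have a0 : 0 <= a by rewrite divr_ge0// ltW.
have a1 : a <= 1/8.
  rewrite ler_pdivrMr//; have : 1 <= m.+1%:R :> R by rewrite ler1n.
  lra.
rewrite !aE.
have [v2|v2] := leP C (a * v ^+ 2).
  rewrite ge_min; apply/orP; right.
  by rewrite lerDl divr_ge0.

have [h|h] := leP (a * (u ^+ 2 - v ^+ 2)) (`|u - v| / 2).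
  by rewrite ge_min; apply/orP; left; lra.
rewrite ge_min; apply/orP; right.
have ab : `|u ^+ 2 - v ^+ 2| = `|u - v| * `|u + v| by rewrite -normrM; congr `|_|; ring.
have h1 : a * (u ^+ 2 - v ^+ 2) <= a * (`|u - v| * `|u + v|).
  by rewrite -ab ler_wpM2l// ler_norm.
have h2 : 1 / 2 < a * `|u + v|.
  rewrite ltNge; apply/negP => h3; have := normr_ge0 (u - v) => h4; nra.
have h3 : `|u + v| <= `|u - v| + 2 * `|v|.
  have -> : u + v = (u - v) + v + v by ring.
  apply: (le_trans (ler_normD _ _)); have := ler_normD (u - v) v; lra.
have v0 := normr_ge0 v.
have v2' : a * `|v| ^+ 2 < C by rewrite real_normK// num_real.
have d0 := normr_ge0 (u - v).
rewrite -[v ^+ 2]real_normK ?num_real//.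
move: (`|v|) (`|u - v|) (`|u + v|) v0 d0 h2 h3 v2' => x d s x0 d0 h2 h3 v2'.
have h4 : 1 / 2 < a * (d + 2 * x) by apply: (lt_le_trans h2); rewrite ler_wpM2l.
have ax : a * x <= 1 / 4.
  rewrite leNgt; apply/negP => ax.
  have : 1/16 < (a * x) ^+ 2 by nra.
  have -> : (a * x) ^+ 2 = a * (a * x ^+ 2) by ring.
  nra.
have ad : 1 / 2 - 2 * (a * x) < a * d by lra.
rewrite -subr_ge0.
have ap : 0 < a by nra.
rewrite -(pmulr_rge0 _ ap); nra.
Qed.

(** Without caps this is the Cauchy-Schwarz inequality
    u^2 / (m + 1) <= v^2 / m + (v - u)^2. *)
Lemma capped_chi (k C : R) m (u v : R) : 0 <= k <= 1/4 -> 0 <= C <= 1/2 ->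
  capped k C m.+1 u <= capped k C m v + capped k C 1 (v - u).
Proof.
move=> hk hC; have /andP[k0 k1] := hk; have /andP[C0 C1] := hC.
case: m => [|m].
  have := capped_lipschitz 1 u (u - v) hk hC.
  rewrite /capped (_ : u - (u - v) = v); last by ring.
  by rewrite (_ : (u - v) ^+ 2 = (v - u) ^+ 2); [lra|ring].
have sq (x : R) (i : nat) : 0 <= k * x ^+ 2 / (2 * i.+1%:R).
  by apply: divr_ge0; apply: mulr_ge0 => //; exact: sqr_ge0.
rewrite /capped.
have [h1|h1] := leP C (k * v ^+ 2 / (2 * m.+1%:R)).
  by rewrite ge_min; apply/orP; right; rewrite lerDl le_min sq.
have [h2|h2] := leP C (k * (v - u) ^+ 2 / (2 * 1%:R)).
  by rewrite ge_min; apply/orP; right; rewrite lerDr sq.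
rewrite ge_min; apply/orP; left.
have -> : k * v ^+ 2 / (2 * m.+1%:R) + k * (v - u) ^+ 2 / (2 * 1%:R) =
   k * u ^+ 2 / (2 * m.+2%:R) +
   k * ((v + m.+1%:R * (v - u)) ^+ 2 / (2 * m.+1%:R * m.+2%:R)).
  rewrite -[m.+2%:R]natr1; have : 0 <= m%:R :> R by [].
  rewrite -[m.+1%:R]natr1; move: m%:R => x x0; field; apply/andP; split; lra.
by rewrite lerDl mulr_ge0// divr_ge0 ?sqr_ge0// mulr_ge0// mulr_ge0.
Qed.

End means.

(** * The potential and its convexity *)

Section power_midpoint.
Context {R : realType}.

(** The hypothesis bounds z^(1/p) by the mean of x^(1/p) and y^(1/p). The
    second-order term of the concave function t^(1/p) keeps this mean below
    ((x + y) / 2)^(1/p). *)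
Lemma power_midpoint (p x y z : R) : 1 < p -> 0 <= x -> 0 <= y -> 0 <= z ->
  (p * z) `^ p^-1 <= ((p * x) `^ p^-1 + (p * y) `^ p^-1) / 2 ->
  z * (8 * ((x + y) / 2) ^+ 2 + (1 - p^-1) * (y - x) ^+ 2) <= 8 * ((x + y) / 2) ^+ 3.
Proof.
move=> p1.
wlog xy : x y / x <= y.
  move=> H x0 y0 z0 h; have [xy|/ltW yx] := leP x y; first exact: H.
  rewrite [x + y]addrC -(sqrrN (y - _)) opprB; apply: H => //.
  by rewrite [_ `^ _ + _]addrC.
move=> x0 y0 z0; set m := (x + y) / 2.
have p0 : 0 < p by exact: lt_trans p1.
pose s := p^-1; have s0 : 0 < s by rewrite invr_gt0.
have s1 : s < 1 by rewrite invf_lt1.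
have sp : s * p = 1 by rewrite mulVf// gt_eqF.
rewrite -/s => hz.
have zE : (p * z) = ((p * z) `^ s) `^ p.
  by rewrite -powRrM sp powRr1// mulr_ge0// ltW.
have mE : 2 * m = x + y by rewrite /m; field.
have [m0|m0] := leP m 0.
  have yE : y = 0 by clear -m0 mE x0 y0; lra.
  have xE : x = 0 by clear -m0 mE x0 y0; lra.
  have pz0 : (p * z) `^ s <= 0.
    by rewrite (le_trans hz)// xE yE mulr0 powR0 ?gt_eqF// addr0 mul0r.
  have pzE : (p * z) `^ s = 0 by apply/le_anti; rewrite pz0 powR_ge0.
  have /eqP : p * z = 0 by rewrite zE pzE powR0// gt_eqF.
  rewrite mulf_eq0 gt_eqF//= => /eqP ->.
  by rewrite mul0r /m xE yE addr0 mul0r expr0n/= mulr0.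
pose t := (y - x) / (2 * m).
have t0 : 0 <= t by rewrite divr_ge0 ?subr_ge0// mE addr_ge0.
have t1 : t <= 1.
  have m2 : 0 < 2 * m by exact: mulr_gt0.
  by rewrite /t ler_pdivrMr// mul1r mE; clear -x0; lra.
have tm : 2 * (t * m) = y - x by rewrite /t; clearbody m; field; exact: lt0r_neq0.
have yE : (p * y) `^ s = (p * m) `^ s * (1 + t) `^ s.
  rewrite -powRM; [|by apply: mulr_ge0; exact: ltW|by rewrite addr_ge0].
  by congr (_ `^ _); rewrite -mulrA; congr (_ * _); clear -mE tm; lra.
have xE : (p * x) `^ s = (p * m) `^ s * (1 - t) `^ s.
  rewrite -powRM; [|by apply: mulr_ge0; exact: ltW|by rewrite subr_ge0].
  by congr (_ `^ _); rewrite -mulrA; congr (_ * _); clear -mE tm; lra.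
pose xi := (1 - s) * t ^+ 2 / 2.
have xi0 : 0 <= xi by rewrite divr_ge0// mulr_ge0 ?sqr_ge0// subr_ge0 ltW.
have pm0 : 0 <= p * m by apply: mulr_ge0; exact: ltW.
have zle : z <= m * expR (- xi).
  rewrite -(ler_pM2l p0) zE.
  have -> : p * (m * expR (- xi)) = ((p * m) `^ s * expR (- (s * xi))) `^ p.
    rewrite powRM ?powR_ge0 ?expR_ge0// -powRrM sp powRr1//.
    rewrite -expRM (_ : - (s * xi) * p = - xi); last by rewrite mulNr mulrAC sp mul1r.
    by rewrite mulrA.
  apply: ge0_ler_powR; rewrite ?nnegrE ?powR_ge0 ?mulr_ge0 ?powR_ge0 ?expR_ge0//; first exact: ltW.
  apply: (le_trans hz).
  have st : 0 < s <= 1 by rewrite s0 ltW.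
  have tt : 0 <= t <= 1 by rewrite t0.
  have h := powR_second_difference st tt.
  have h2 : 1 - s * xi <= expR (- (s * xi)) by exact: expR_ge1Dx.
  rewrite xE yE -mulrDr -mulrA ler_wpM2l ?powR_ge0//.
  apply: le_trans h2; rewrite /xi; move: h; clear; lra.
have e1 : (1 + xi) * expR (- xi) <= 1.
  by rewrite expRN ler_pdivrMr ?expR_gt0// mul1r; exact: expR_ge1Dx.
have zm : z * (1 + xi) <= m.
  have xi1 : 0 <= 1 + xi by rewrite addr_ge0.
  apply: (le_trans (ler_wpM2r xi1 zle)).
  by have := ler_wpM2l (ltW m0) e1; clear; lra.
have -> : 8 * m ^+ 2 + (1 - p^-1) * (y - x) ^+ 2 = 8 * m ^+ 2 * (1 + xi).
  by rewrite -tm /xi /s; field; exact: lt0r_neq0.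
have m2 : 0 <= 8 * m ^+ 2 by rewrite mulr_ge0 ?sqr_ge0.
by have := ler_wpM2l m2 zm; clear; lra.
Qed.

End power_midpoint.

Section euclidean_norm.
Context {R : realType} {n : nat}.
Implicit Types x y : 'rV[R]_n.

Lemma sqr_enorm x : enorm x ^+ 2 = \sum_(i < n) x 0 i ^+ 2.
Proof. by rewrite sqr_sqrtr// sumr_ge0// => i _; exact: sqr_ge0. Qed.

Lemma enorm_ge0 x : 0 <= enorm x.
Proof. exact: sqrtr_ge0. Qed.

Lemma enormZ (t : R) x : 0 <= t -> enorm (t *: x) = t * enorm x.
Proof.
move=> t0; apply/eqP; rewrite -(eqrXn2 (ltn0Sn 1)) ?mulr_ge0 ?enorm_ge0//.
rewrite exprMn !sqr_enorm mulr_sumr; apply/eqP; apply: eq_bigr => i _.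
by rewrite mxE exprMn.
Qed.

Lemma ler_enorm x i : `|x 0 i| <= enorm x.
Proof.
rewrite -(ler_pXn2r (ltn0Sn 1)) ?nnegrE ?enorm_ge0// sqr_enorm.
rewrite real_normK ?num_real// (bigD1 i)//= lerDl sumr_ge0// => j _.
exact: sqr_ge0.
Qed.

Lemma enorm_eq0 x : enorm x = 0 -> x = 0.
Proof.
move=> x0; apply/rowP => i; rewrite mxE; apply/eqP.
by rewrite -normr_le0 -x0 ler_enorm.
Qed.

(** Cauchy-Schwarz in the form of the weighted inequality
    2 x_i y_i <= (b / a) x_i^2 + (a / b) y_i^2, where a and b are the two norms. *)
Lemma ler_enormD x y : enorm (x + y) <= enorm x + enorm y.
Proof.
have [/eqP/enorm_eq0->|x0] := boolP (enorm x == 0).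
  by rewrite add0r lerDr enorm_ge0.
have [/eqP/enorm_eq0->|y0] := boolP (enorm y == 0).
  by rewrite addr0 lerDl enorm_ge0.
have {}x0 : 0 < enorm x by rewrite lt0r x0 enorm_ge0.
have {}y0 : 0 < enorm y by rewrite lt0r y0 enorm_ge0.
rewrite -(ler_pXn2r (ltn0Sn 1)) ?nnegrE ?addr_ge0 ?enorm_ge0//.
set a := enorm x in x0 *; set b := enorm y in y0 *.
have ta : 0 < b / a by rewrite divr_gt0.
have tb : 0 < a / b by rewrite divr_gt0.
apply: (@le_trans _ _ (\sum_(i < n) ((1 + b / a) * x 0 i ^+ 2 + (1 + a / b) * y 0 i ^+ 2))).
  rewrite sqr_enorm; apply: ler_sum => i _; rewrite mxE.
  rewrite -subr_ge0.
  have -> : (1 + b / a) * x 0 i ^+ 2 + (1 + a / b) * y 0 i ^+ 2 - (x 0 i + y 0 i) ^+ 2 =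
      (b / a) * (x 0 i - a / b * y 0 i) ^+ 2.
    by field; rewrite !gt_eqF.
  by rewrite mulr_ge0 ?sqr_ge0// ltW.
rewrite big_split/= -!mulr_sumr -!sqr_enorm -/a -/b.
have -> : (1 + b / a) * a ^+ 2 + (1 + a / b) * b ^+ 2 = (a + b) ^+ 2.
  by field; rewrite !gt_eqF.
by [].
Qed.

Lemma enorm_continuous : continuous (@enorm R n).
Proof.
move=> x; apply: (@continuous_comp _ _ _ (fun x : 'rV[R]_n => \sum_(i < n) x 0 i ^+ 2) Num.sqrt).
  apply: cvg_big => [||i _]; [exact: add_continuous|exact: (nbhs_filter x)|].
  apply: (@continuous_comp _ _ _ (fun x : 'rV[R]_n => x 0 i) (fun t : R => t ^+ 2)).
    exact: coord_continuous.
  exact: exprn_continuous.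
exact: sqrt_continuous.
Qed.

Definition potential (p : R) (x : 'rV[R]_n) : R := enorm x `^ p / p.

Lemma measurable_enorm : measurable_fun setT (@enorm R n : borelRV R n -> measurableTypeR R).
Proof. by apply: continuous_borelRV; exact: enorm_continuous. Qed.

Lemma measurable_potential p :
  measurable_fun setT (potential p : borelRV R n -> measurableTypeR R).
Proof.
apply: measurable_funM => //.
apply: (measurableT_comp (measurable_powR p)).
exact: measurable_enorm.
Qed.

Lemma potential_ge0 p x : 1 <= p -> 0 <= potential p x.
Proof. by move=> p1; rewrite divr_ge0 ?powR_ge0// (le_trans _ p1). Qed.

Lemma potentialZ p (t : R) x : 0 <= t -> potential p (t *: x) = t `^ p * potential p x.
Proof. by move=> t0; rewrite /potential enormZ// powRM ?enorm_ge0// mulrA. Qed.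

Lemma potential_convex p (l : R) x y : 1 <= p -> 0 <= l <= 1 ->
  potential p (l *: x + (1 - l) *: y) <= l * potential p x + (1 - l) * potential p y.
Proof.
move=> p1 /andP[l0 l1]; have l1' : 0 <= 1 - l by lra.
rewrite /potential !mulrA -mulrDl ler_pM2r; last by rewrite invr_gt0; lra.
apply: (@le_trans _ _ ((l * enorm x + (1 - l) * enorm y) `^ p)).
  apply: ge0_ler_powR; rewrite ?nnegrE ?enorm_ge0 ?addr_ge0 ?mulr_ge0 ?enorm_ge0//.
    lra.
  by rewrite -!enormZ//; exact: ler_enormD.
have := @convex_powR R p p1 (Itv01 l0 l1) (enorm x) (enorm y).
by rewrite !inE/= !in_itv/= !andbT !enorm_ge0 !convRE/=; exact.
Qed.

Lemma enormE p x : 0 < p -> enorm x = (p * potential p x) `^ p^-1.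
Proof.
move=> p0; rewrite /potential mulrC divfK ?gt_eqF// -powRrM mulfV ?gt_eqF//.
by rewrite powRr1 ?enorm_ge0.
Qed.

(** The norm is a power of the potential, and the norm is convex. *)
Lemma potential_midpoint p x y : 1 < p ->
  potential p (2^-1 *: x + (1 - 2^-1) *: y) *
    (8 * ((potential p x + potential p y) / 2) ^+ 2 +
     (1 - p^-1) * (potential p y - potential p x) ^+ 2) <=
  8 * ((potential p x + potential p y) / 2) ^+ 3.
Proof.
move=> p1; have p0 : 0 < p by exact: lt_trans p1.
apply: (power_midpoint p1); try exact: (potential_ge0 _ (ltW p1)).
rewrite -(enormE x p0) -(enormE y p0) -(enormE _ p0); apply: (le_trans (ler_enormD _ _)).
have h0 : 0 <= 2^-1 :> R by rewrite invr_ge0.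
have h1 : 1 - 2^-1 = 2^-1 :> R by field.
by rewrite h1 !enormZ// -mulrDr mulrC.
Qed.

End euclidean_norm.

Section local_tilt.
Context {R : realType}.

(** a is the logarithm of the ratio of two masses, x and y are potentials at two
    points and z is the potential at their midpoint. A difference S = y - x costs
    at least about b * S^2 / (8 z) in potential, and the penalty of the mean costs
    (S + a)^2 / (8 n). The minimum over S of the sum of both is
    a^2 / (8 (n + z / b)). *)
Lemma tilt_lower_bound (n : nat) (b e a x y z : R) : (0 < n)%N -> 0 < e < 1 -> 0 < b ->
  `|a| <= e ^+ 2 -> 0 <= x -> 0 <= y -> 0 <= z ->
  z <= (x + y) / 2 ->
  z * (8 * ((x + y) / 2) ^+ 2 + b * (y - x) ^+ 2) <= 8 * ((x + y) / 2) ^+ 3 ->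
  (1 - e) ^+ 2 * (a ^+ 2 / (8 * (n%:R + z / b))) <=
  (x + y) / 2 - z + capped ((1 - e) / 4) (Num.min e 2^-1) n (y - x + a).
Proof.
move=> n0 /andP[e0 e1] b0 ae x0 y0 z0.
set m := (x + y) / 2; set S := y - x; set D := m - z => zm key.
have DE : D = m - z by [].
have Sm : `|S| <= 2 * m.
  by rewrite /S /m; have [h|h] := leP 0 (y - x); [rewrite ger0_norm//|rewrite ltr0_norm//];
   clear -x0 y0; lra.
clearbody D m S; clear x0 y0 x y.
set N : R := n%:R; have N1 : 1 <= N by rewrite ler1n.
have w0 : 0 <= z / b by rewrite divr_ge0// ltW.
have a2 : a ^+ 2 <= (e ^+ 2) ^+ 2.
  rewrite -[a ^+ 2]real_normK ?num_real// ler_pXn2r ?nnegrE ?sqr_ge0//.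
have ee : (e ^+ 2) ^+ 2 <= e.
  by rewrite -exprM -[leRHS]expr1 ler_wiXn2l// ltW.
set q := _ * (_ / _).
have q1 : q <= a ^+ 2 / (8 * N).
  apply: (@le_trans _ _ (a ^+ 2 / (8 * (N + z / b)))).
    by rewrite /q ler_piMl//; [rewrite divr_ge0 ?sqr_ge0//; lra|nra].
  rewrite ler_wpM2l ?sqr_ge0// lef_pV2 ?posrE; lra.
have q2 : q <= a ^+ 2 / 8.
  apply: (le_trans q1); rewrite ler_wpM2l ?sqr_ge0// lef_pV2 ?posrE; lra.
have D0 : 0 <= D by lra.
have qE : q = (1 - e) ^+ 2 * (a ^+ 2 / (8 * (N + z / b))) by [].
case: n @N n0 N1 q qE q1 q2 => // n N _ N1 q qE q1 q2.
rewrite /capped -/N; clearbody N.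
have N0 : N != 0 by apply: lt0r_neq0; exact: lt_le_trans N1.
have [h|h] := leP (Num.min e 2^-1) ((1 - e) / 4 * (S + a) ^+ 2 / (2 * N)).
  apply: (le_trans q2); have : a ^+ 2 / 8 <= Num.min e 2^-1.
    by rewrite le_min; apply/andP; split; lra.
  lra.
have [hD|hD] := leP (a ^+ 2 / (8 * N)) D.
  apply: (le_trans q1); apply: (le_trans hD).
  by rewrite lerDl; apply: divr_ge0; [apply: mulr_ge0; [lra|exact: sqr_ge0]|lra].
have -> : (1 - e) / 4 * (S + a) ^+ 2 / (2 * N) = (1 - e) * ((S + a) ^+ 2 / (8 * N)).
  by field.
have [hw|hw] := leP ((1 - e) * m) z; last first.
  have SD : e * `|S| <= 2 * D by nra.
  have aa : a ^+ 2 = `|a| * `|a| by rewrite -expr2 real_normK ?num_real.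
  have hD' : 8 * D <= a ^+ 2.
    have : a ^+ 2 / (8 * N) <= a ^+ 2 / 8.
      by rewrite ler_wpM2l ?sqr_ge0// lef_pV2 ?posrE; lra.
    lra.
  have Sa : `|S| <= (e / 2) * `|a|.
    have h1 : e * `|S| <= e * (e / 4 * `|a|).
      apply: (le_trans SD); have := normr_ge0 a; nra.
    have : `|S| <= e / 4 * `|a| by rewrite -(ler_pM2l e0).
    have := normr_ge0 a; nra.
  have Sa2 : (1 - e) * a ^+ 2 <= (S + a) ^+ 2.
    have h1 : (1 - e / 2) * `|a| <= `|S + a|.
      have := ler_normB (S + a) S; rewrite addrAC subrr add0r; lra.
    rewrite -[(S + a) ^+ 2]real_normK ?num_real// -[a ^+ 2]real_normK ?num_real//.
    have := normr_ge0 a; have h3 : 0 <= (1 - e / 2) * `|a| by rewrite mulr_ge0//; lra.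
    have : ((1 - e / 2) * `|a|) ^+ 2 <= `|S + a| ^+ 2 by rewrite ler_pXn2r ?nnegrE.
    nra.
  have h1 : q <= (1 - e) * ((1 - e) * a ^+ 2 / (8 * N)).
    have mono : a ^+ 2 / (8 * (N + z / b)) <= a ^+ 2 / (8 * N).
      by rewrite ler_wpM2l ?sqr_ge0// lef_pV2 ?posrE; lra.
    have := ler_wpM2l (sqr_ge0 (1 - e)) mono; rewrite -qE; lra.
  have : (1 - e) * ((1 - e) * a ^+ 2 / (8 * N)) <= (1 - e) * ((S + a) ^+ 2 / (8 * N)).
    rewrite ler_wpM2l//; first lra.
    rewrite ler_wpM2r// invr_ge0; lra.
  lra.
have [z1|z1] := leP z 0.
  have zE : z = 0 by lra.
  have mE : m = 0 by nra.
  have SE : S = 0 by apply/eqP; rewrite -normr_le0; lra.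
  rewrite SE add0r.
  rewrite qE zE mul0r addr0.
  have : 0 <= a ^+ 2 / (8 * N) by rewrite divr_ge0 ?sqr_ge0//; lra.
  by nra.
have DS : (1 - e) ^+ 2 * (b * S ^+ 2 / (8 * z)) <= D.
  rewrite mulrA ler_pdivrMr; last by lra.
  have m0 : 0 < m by lra.
  have h1 : z * (b * S ^+ 2) <= 8 * m ^+ 2 * D by nra.
  have h2 : (1 - e) ^+ 2 * m ^+ 2 <= z ^+ 2.
    by rewrite -exprMn ler_pXn2r ?nnegrE//; rewrite ?mulr_ge0//; lra.
  rewrite -(ler_pM2l (_ : 0 < m ^+ 2)); last by rewrite exprn_gt0.
  have h3 : 0 <= b * S ^+ 2 by rewrite mulr_ge0 ?sqr_ge0// ltW.
  have h4 : (1 - e) ^+ 2 * m ^+ 2 * (b * S ^+ 2) <= z ^+ 2 * (b * S ^+ 2) by rewrite ler_wpM2r.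
  have h5 : z * (z * (b * S ^+ 2)) <= z * (8 * m ^+ 2 * D) by rewrite ler_wpM2l.
  lra.
(* Cauchy-Schwarz for a = (S + a) - S. *)
have cs : a ^+ 2 / (8 * (N + z / b)) <= b * S ^+ 2 / (8 * z) + (S + a) ^+ 2 / (8 * N).
  rewrite -subr_ge0.
  have -> : b * S ^+ 2 / (8 * z) + (S + a) ^+ 2 / (8 * N) - a ^+ 2 / (8 * (N + z / b)) =
     (N * S + (S + a) * (z / b)) ^+ 2 / (8 * N * (z / b) * (N + z / b)).
    have bN : 0 < N * b by apply: mulr_gt0; lra.
    by field; rewrite !lt0r_neq0//; lra.
  have zb : 0 < z / b by rewrite divr_gt0.
  apply: divr_ge0; first exact: sqr_ge0.
  by apply: mulr_ge0; [apply: mulr_ge0|]; lra.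
have e2 : (1 - e) ^+ 2 <= 1 - e by nra.
have e3 : 0 <= (1 - e) ^+ 2 by exact: sqr_ge0.
have h1 := ler_wpM2l e3 cs.
have h2 : (1 - e) ^+ 2 * ((S + a) ^+ 2 / (8 * N)) <= (1 - e) * ((S + a) ^+ 2 / (8 * N)).
  by rewrite ler_wpM2r// divr_ge0 ?sqr_ge0//; lra.
rewrite qE; lra.
Qed.

End local_tilt.

(** * Masses of midpoints *)

Section means_of_exponentials.
Context {R : realType}.

Lemma geometric_mean_expR (l u v : R) :
  geometric_mean l (expR u) (expR v) = expR (l * u + (1 - l) * v).
Proof. by rewrite /geometric_mean (expRK u) (expRK v). Qed.

Lemma tilted_mean_expR psi (a b u v : R) : 0 < a -> 0 < b ->
  tilted_mean psi (a^-1 * expR u) (b^-1 * expR v) =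
  expR ((u - ln a + (v - ln b)) / 2 - psi (u - ln a - (v - ln b))).
Proof.
have lnE (m : R) (w : R) : 0 < m -> ln (m^-1 * expR w) = w - ln m.
  by move=> m0; rewrite lnM ?posrE ?invr_gt0 ?expR_gt0// expRK lnV ?posrE// addrC.
by move=> a0 b0; rewrite /tilted_mean (lnE a u a0) (lnE b v b0).
Qed.

End means_of_exponentials.

Section gauss_mass.
Context {R : realType} {n : nat}.
Variable p : R.
Local Open Scope ereal_scope.

Definition mass (A : set (borelRV R n)) : \bar R :=
  \int[lebesgue_rV n]_(x in A) (expR (- potential p (x : 'rV[R]_n)))%:E.

Definition in_cube (N : R) (A : set (borelRV R n)) :=
  forall x, A x -> forall j, (`|(x : 'rV[R]_n) 0 j| <= N)%R.

Lemma measurable_density :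
  measurable_fun setT (fun x : borelRV R n => expR (- potential p (x : 'rV[R]_n))%R).
Proof.
apply: measurableT_comp => //; apply: measurable_funN.
exact: measurable_potential.
Qed.

Lemma integral_restrict (A : set (borelRV R n)) (f : borelRV R n -> R) :
  \int[lebesgue_rV n]_(x in A) (f x)%:E = \int[lebesgue_rV n]_x ((f \_ A) x)%:E.
Proof.
by rewrite integral_mkcond; apply: eq_integral => x _; rewrite restrict_EFin.
Qed.

Lemma restrict_gt0 (A : set (borelRV R n)) (f : borelRV R n -> R) x :
  (0 < (f \_ A) x)%R -> A x /\ (f \_ A) x = f x.
Proof. by rewrite patchE; case: ifPn; rewrite ?ltxx// inE. Qed.

Lemma restrict_le (A : set (borelRV R n)) (f : borelRV R n -> R) (c : R) :
  (forall x, 0 <= f x <= c)%R -> forall x, (0 <= (f \_ A) x <= c)%R.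
Proof.
move=> fc x; rewrite patchE; case: ifPn => // _.
by have /andP[f0 /(le_trans f0)] := fc x; rewrite lexx.
Qed.

Lemma measurable_restrictR (A : set (borelRV R n)) (f : borelRV R n -> R) :
  measurable A -> measurable_fun setT f -> measurable_fun setT (f \_ A).
Proof.
by move=> mA mf; apply: (proj1 (measurable_restrictT _ _)) => //; exact: measurable_funTS.
Qed.

Lemma density_le1 x : (1 <= p)%R -> (expR (- potential p (x : 'rV[R]_n)) <= 1)%R.
Proof. by move=> p1; rewrite expR_le1 oppr_le0; exact: potential_ge0. Qed.

Lemma mass_ge0 A : 0 <= mass A.
Proof. by apply: integral_ge0 => x _; rewrite lee_fin expR_ge0. Qed.

Lemma mass_le_cube (N : R) A : (1 <= p)%R -> (0 <= N)%R -> measurable A -> in_cube N A ->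
  mass A <= ((2 * N) ^+ n)%:E.
Proof.
move=> p1 N0 mA AN; rewrite /mass integral_restrict -[((2 * N) ^+ n)%R]mul1r.
apply: integral_le_cube => //.
- by apply: measurable_restrictR => //; exact: measurable_density.
- by apply: restrict_le => x; rewrite expR_ge0 density_le1.
- by move=> x /restrict_gt0[/AN].
Qed.

(** The geometric mean is reproduced by every integration. *)
Lemma mass_log_concave (l N : R) (A B C : set (borelRV R n)) :
  (1 <= p)%R -> (0 < l < 1)%R -> (0 <= N)%R ->
  measurable A -> measurable B -> measurable C -> in_cube N A -> in_cube N B ->
  (forall x y : 'rV[R]_n, A x -> B y -> C (l *: x + (1 - l) *: y)%R) ->
  forall a b : R, (0 < a)%R -> (0 < b)%R -> mass A = a%:E -> mass B = b%:E ->
  (geometric_mean l a b)%:E <= mass C.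
Proof.
move=> p1 l01 N0 mA mB mC AN BN ABC a b a0 b0 Aa Bb.
have md := measurable_density.
have d01 (x : borelRV R n) : (0 <= expR (- potential p (x : 'rV[R]_n)) <= 1)%R.
  by rewrite expR_ge0 density_le1.
pose d (x : borelRV R n) := expR (- potential p (x : 'rV[R]_n)).
have MS (j : nat) : (j < n)%N -> mean_step l (geometric_mean l) (geometric_mean l).
  by move=> _; exact: geometric_mean_step.
have mdA : measurable_fun setT (d \_ A) by exact: measurable_restrictR.
have mdB : measurable_fun setT (d \_ B) by exact: measurable_restrictR.
have mdC : measurable_fun setT (fun x => ((d \_ C) x)%:E).
  by apply/measurable_EFinP; exact: measurable_restrictR.
have d0 x : 0 <= ((d \_ C) x)%:E.
  by rewrite lee_fin; have /andP[] := restrict_le C d01 x.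
have sA : supported_in_cube N (d \_ A) by move=> x /restrict_gt0[/AN].
have sB : supported_in_cube N (d \_ B) by move=> x /restrict_gt0[/BN].
have key (x y : 'rV[R]_n) : (0 < (d \_ A) x)%R -> (0 < (d \_ B) y)%R ->
    (geometric_mean l ((d \_ A) x) ((d \_ B) y))%:E <=
    ((d \_ C) (l *: x + (1 - l) *: y)%R)%:E.
  move=> /restrict_gt0[Ax ->] /restrict_gt0[By ->].
  rewrite patchE mem_set; last exact: ABC.
  rewrite lee_fin /d geometric_mean_expR ler_expR !mulrN -opprD lerN2.
  by apply: potential_convex => //; case/andP: l01 => /ltW -> /ltW.
rewrite /mass integral_restrict.
apply: (functional_inequality l01 N0 ler01 MS mdA mdB mdC
  (restrict_le A d01) (restrict_le B d01) d0 sA sB key a0 b0).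
- by rewrite -integral_restrict; exact: Aa.
- by rewrite -integral_restrict; exact: Bb.
Qed.

(** The coefficient of a^2 / 8 gained at the point z when the masses of two sets
    have ratio exp a: n comes from the integrations, the second term from the
    potential. *)
Definition curvature (z : 'rV[R]_n) : R := (n%:R + potential p z / (1 - p^-1))^-1.

Lemma curvature_den_ge0 (z : 'rV[R]_n) : (1 < p)%R ->
  (0 <= n%:R + potential p z / (1 - p^-1))%R.
Proof.
move=> p1; rewrite addr_ge0// divr_ge0 ?(potential_ge0 _ (ltW p1))//.
by rewrite subr_ge0 invf_le1 ?ltW// (lt_trans _ p1).
Qed.

Lemma measurable_curvature : (1 < p)%R ->
  measurable_fun setT (curvature : borelRV R n -> R).
Proof.
move=> p1; rewrite (_ : (curvature : borelRV R n -> R) =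
  (fun z : borelRV R n => (n%:R + potential p (z : 'rV[R]_n) / (1 - p^-1)) `^ (-1)))%R; last first.
  by apply/funext => z; rewrite powR_inv1// curvature_den_ge0.
apply: (measurableT_comp (measurable_powR _)).
apply: measurable_funD => //; apply: measurable_funM => //.
exact: measurable_potential.
Qed.

(** Normalizing both densities to total mass 1 moves the ratio of the masses into
    the integrand; the mean that is left after n integrations is the minimum,
    which equals 1 here. *)
Lemma mass_local (e N : R) (A B C : set (borelRV R n)) :
  (1 < p)%R -> (0 < n)%N -> (0 < e < 1)%R -> (0 <= N)%R ->
  measurable A -> measurable B -> measurable C -> in_cube N A -> in_cube N B ->
  (forall x y : 'rV[R]_n, A x -> B y -> C (2^-1 *: x + (1 - 2^-1) *: y)%R) ->
  forall a b : R, (0 < a)%R -> (0 < b)%R -> mass A = a%:E -> mass B = b%:E ->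
  (`|ln b - ln a| <= e ^+ 2)%R ->
  (expR ((ln a + ln b) / 2))%:E <=
  \int[lebesgue_rV n]_(z in C) (expR (- potential p (z : 'rV[R]_n) -
     (1 - e) ^+ 2 * ((ln b - ln a) ^+ 2 / 8) * curvature z))%:E.
Proof.
move=> p1 n0 e01 N0 mA mB mC AN BN ABC a b a0 b0 Aa Bb ab.
have md := measurable_density.
have p1' := ltW p1.
(* The coefficient and the cap of the penalty in tilt_lower_bound. *)
set k := ((1 - e) / 4)%R; set c := Num.min e 2^-1%R.
have hk : (0 <= k <= 1 / 4)%R by rewrite /k; case/andP: e01 => e0 e1; lra.
have hc : (0 <= c <= 1 / 2)%R.
  rewrite /c le_min ge_min; case/andP: e01 => e0 e1.
  by apply/andP; split; [apply/andP; split|apply/orP; right]; lra.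
pose M j := tilted_mean (capped k c (n - j)).
have MS j : (j < n)%N -> mean_step 2^-1 (M j) (M j.+1).
  move=> jn; rewrite /M -subnSK//; apply: (@tilted_mean_step _ _ _ (capped k c 1)).
  - by move=> w; exact: capped_cosh.
  - by move=> u v; exact: capped_lipschitz.
  - by move=> u v; exact: capped_chi.
pose q (z : borelRV R n) := expR (- potential p (z : 'rV[R]_n) -
     (1 - e) ^+ 2 * ((ln b - ln a) ^+ 2 / 8) * curvature z)%R.
have mq : measurable_fun setT q.
  apply: measurableT_comp => //; apply: measurable_funB.
    by apply: measurable_funN; exact: measurable_potential.
  by apply: measurable_funM => //; exact: measurable_curvature.
rewrite (integral_restrict C q).
pose s := expR ((ln a + ln b) / 2).
have s0 : (0 < s)%R by exact: expR_gt0.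
suff : 1 <= (s^-1)%:E * \int[lebesgue_rV n]_x ((q \_ C) x)%:E.
  by rewrite lee_pdivlMl// mule1.
rewrite -ge0_integralZl//; last 3 first.
- by apply/measurable_EFinP; exact: measurable_restrictR.
- by move=> x _; rewrite lee_fin patchE; case: ifP => // _; exact: expR_ge0.
- by rewrite lee_fin invr_ge0 ltW.
have M1 : M n 1%R 1%R = 1%R by rewrite /M subnn /tilted_mean ln1 subrr/= normr0 mul0r addr0 mul0r subr0 expR0.
rewrite -[1]/(1%R%:E) -M1.
pose C' := (a^-1 + b^-1)%R.
have norm (D : set (borelRV R n)) (m : R) : (0 < m)%R -> measurable D -> mass D = m%:E ->
    \int[lebesgue_rV n]_x (((fun x : borelRV R n => m^-1 * expR (- potential p (x : 'rV[R]_n))) \_ D) x)%:E = 1.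
  move=> m0 mD Dm; rewrite -integral_restrict.
  under eq_integral do rewrite EFinM.
  rewrite ge0_integralZl//.
  - by rewrite -/(mass D) Dm -EFinM mulVf ?gt_eqF.
  - by apply/measurable_EFinP; exact: measurable_funTS.
  - by rewrite lee_fin invr_ge0 ltW.
have bnd (m : R) : (0 < m)%R -> (m^-1 <= C')%R -> forall x : borelRV R n,
   (0 <= m^-1 * expR (- potential p (x : 'rV[R]_n)) <= C')%R.
  move=> m0 mC' x; have im0 : (0 <= m^-1)%R by rewrite invr_ge0 ltW.
  apply/andP; split; first by rewrite mulr_ge0// expR_ge0.
  by apply: le_trans mC'; rewrite ler_piMr ?density_le1.
have aC : (a^-1 <= C')%R by rewrite /C' lerDl invr_ge0 ltW.
have bC : (b^-1 <= C')%R by rewrite /C' lerDr invr_ge0 ltW.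
pose f (x : borelRV R n) := (a^-1 * expR (- potential p (x : 'rV[R]_n)))%R.
pose g (x : borelRV R n) := (b^-1 * expR (- potential p (x : 'rV[R]_n)))%R.
have mfA : measurable_fun setT (f \_ A).
  by apply: measurable_restrictR => //; exact: measurable_funM.
have mgB : measurable_fun setT (g \_ B).
  by apply: measurable_restrictR => //; exact: measurable_funM.
have mh : measurable_fun setT (fun x => (s^-1)%:E * ((q \_ C) x)%:E).
  apply/measurable_EFinP; apply: measurable_funM => //; exact: measurable_restrictR.
have h0 x : 0 <= (s^-1)%:E * ((q \_ C) x)%:E.
  rewrite -EFinM lee_fin; apply: mulr_ge0; first by rewrite invr_ge0 ltW.
  by rewrite patchE; case: ifP => // _; exact: expR_ge0.
have sA : supported_in_cube N (f \_ A) by move=> x /restrict_gt0[/AN].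
have sB : supported_in_cube N (g \_ B) by move=> x /restrict_gt0[/BN].
have h2 : (0 < (2^-1 : R) < 1)%R by rewrite invr_gt0 ltr0n invf_lt1// ltr1n.
have C'0 : (0 <= C')%R by rewrite /C' addr_ge0// invr_ge0 ltW.
have key (x y : 'rV[R]_n) : (0 < (f \_ A) x)%R -> (0 < (g \_ B) y)%R ->
    (M 0 ((f \_ A) x) ((g \_ B) y))%:E <=
    (s^-1)%:E * ((q \_ C) (2^-1 *: x + (1 - 2^-1) *: y)%R)%:E.
  move=> /restrict_gt0[Ax ->] /restrict_gt0[By ->].
  rewrite patchE mem_set; last exact: ABC.
  rewrite -EFinM lee_fin /M subn0 /f /g tilted_mean_expR// /q /s -expRN -expRD ler_expR.
  set z := (_ *: x + _)%R.
  have z0 := potential_ge0 z p1'.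
  have b0' : (0 < 1 - p^-1)%R by rewrite subr_gt0 invf_lt1// (lt_trans _ p1).
  have zle : (potential p z <= (potential p x + potential p y) / 2)%R.
    have h : (0 <= (2^-1 : R) <= 1)%R by case/andP: h2 => /ltW -> /ltW ->.
    by have := potential_convex x y p1' h; rewrite -/z; clear; lra.
  have := tilt_lower_bound n0 e01 b0' ab (potential_ge0 x p1') (potential_ge0 y p1') z0 zle
    (potential_midpoint x y p1).
  rewrite -/k -/c (_ : (- potential p x - ln a - (- potential p y - ln b))%R =
    (potential p y - potential p x + (ln b - ln a))%R); last by clear; ring.
  rewrite (_ : (1 - e) ^+ 2 * ((ln b - ln a) ^+ 2 / (8 * (n%:R + potential p z / (1 - p^-1)))) =
     (1 - e) ^+ 2 * ((ln b - ln a) ^+ 2 / 8) * curvature z)%R; last first.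
    by rewrite /curvature invfM; clear; ring.
  by clear; lra.
exact: (functional_inequality h2 N0 C'0 MS mfA mgB mh
  (restrict_le A (bnd a a0 aC)) (restrict_le B (bnd b b0 bC)) h0 sA sB key ltr01 ltr01
  (norm A a a0 mA Aa) (norm B b b0 mB Bb)).
Qed.

End gauss_mass.

(** * Integrals of powers *)

Section one_dimensional_integrals.
Context {R : realType}.
Local Notation mu := (@lebesgue_measure R).
Local Open Scope ereal_scope.

Lemma FTC_segment (f F : R -> R) (a b : R) : (a < b)%R ->
  (forall x, (a <= x <= b)%R -> is_derive x (1 : R)%R F (f x)) ->
  (forall x, (a <= x <= b)%R -> {for x, continuous f}) ->
  \int[mu]_(x in `[a, b]) (f x)%:E = (F b - F a)%:E.
Proof.
move=> ab dF cf.
have cF x : (a <= x <= b)%R -> {for x, continuous F}.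
  by move=> h; apply: differentiable_continuous; apply/derivable1_diffP; have [] := dF x h.
rewrite (@continuous_FTC2 _ f F a b ab) ?EFinB//.
- apply: continuous_in_subspaceT => x; rewrite inE/= in_itv/=; exact: cf.
- split.
  + by move=> x; rewrite in_itv/= => /andP[/ltW ax /ltW xb]; have [] := dF x; rewrite ?ax.
  + by apply/cvg_at_right_filter; apply: cF; rewrite lexx ltW.
  + by apply/cvg_at_left_filter; apply: cF; rewrite lexx ltW.
- move=> x; rewrite in_itv/= => /andP[/ltW ax /ltW xb].
  have h : (a <= x <= b)%R by rewrite ax.
  by rewrite derive1E (@derive_val _ _ _ _ _ _ _ (dF x h)).
Qed.

Lemma continuous_powR_gt0 (r x : R) : (0 < x)%R -> {for x, continuous (fun y : R => (y `^ r)%R)}.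
Proof.
move=> x0; apply: differentiable_continuous; apply/derivable1_diffP.
by have [] := is_derive1_powR r x0.
Qed.

Lemma integral_powR_segment (r a b : R) : (0 < a)%R -> (a < b)%R -> r != 0%R ->
  \int[mu]_(x in `[a, b]) (x `^ (r - 1))%:E = ((b `^ r - a `^ r) / r)%:E.
Proof.
move=> a0 ab r0.
have d (x : R) : (a <= x <= b)%R ->
    is_derive x (1 : R)%R (fun x : R => r^-1 * x `^ r)%R (x `^ (r - 1))%R.
  move=> /andP[ax _]; have x0 : (0 < x)%R by exact: lt_le_trans ax.
  apply: (is_derive_eq (is_deriveZ (r^-1)%R (is_derive1_powR r x0))).
  by rewrite /GRing.scale/= mulrA mulVf// mul1r.
have c (x : R) : (a <= x <= b)%R -> {for x, continuous (fun x : R => x `^ (r - 1))%R}.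
  by move=> /andP[ax _]; apply: continuous_powR_gt0; exact: lt_le_trans ax.
by have := FTC_segment ab d c => ->; congr EFin; rewrite -mulrBr mulrC.
Qed.

Lemma cvg_powR_invn (r : R) : (0 < r)%R -> (k.+2%:R^-1 `^ r)%R @[k --> \oo] --> (0 : R)%R.
Proof.
move=> r0.
have h : (fun k => (k.+2%:R^-1 : R)%R) @ \oo --> (0 : R)%R^'+.
  move=> A [e /= e0 eA].
  change (\forall k \near \oo, A (k.+2%:R^-1 : R)%R).
  near=> k; have kpos : (0 < (k.+2%:R^-1 : R))%R by rewrite invr_gt0.
  apply: (eA _ _ kpos).
  change (`|0 - (k.+2%:R^-1 : R)| < e)%R; rewrite sub0r normrN gtr0_norm ?invr_gt0//.
  have : (k.+1%:R^-1 < e)%R by near: k; exact: near_infty_natSinv_lt (PosNum e0).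
  by apply: le_lt_trans; rewrite lef_pV2 ?posrE// ler_nat.
exact: (cvg_comp _ _ h (powR_cvg0 r0)).
Unshelve. all: by end_near. Qed.

Lemma measurable_powR_fun (r : R) D : measurable_fun D (fun x : measurableTypeR R => (x `^ r)%R).
Proof. by apply: measurable_funTS; exact: measurable_powR. Qed.

(** Monotone convergence along an exhausting sequence of sets. *)
Lemma integral_exhaustion (F : (set (measurableTypeR R))^nat) (f : measurableTypeR R -> R)
    (u : nat -> R) (l : R) : nondecreasing_seq F -> (forall k, measurable (F k)) ->
  measurable_fun setT f -> (forall x, 0 <= f x)%R ->
  (forall k, \int[mu]_(x in F k) (f x)%:E = (u k)%:E) -> u @ \oo --> l ->
  \int[mu]_(x in \bigcup_k F k) (f x)%:E = l%:E.
Proof.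
move=> ndF mF mf f0 fu ul.
have cv := @ge0_nondecreasing_set_cvg_integral _ _ R F (EFin \o f) mu ndF mF.
rewrite -(cvg_lim _ (cv _ _))//; last 2 first.
- by move=> k; apply/measurable_EFinP; exact: measurable_funTS.
- by move=> k x _; rewrite lee_fin.
apply/cvg_lim => //; rewrite (_ : (fun i => _) = EFin \o u); last exact/funext.
by apply: cvg_EFin; [exact: nearW|].
Qed.

(** The intervals [1/k, 1] avoid the singularity at 0. *)
Lemma integral_powR_01 (r : R) : (0 < r)%R ->
  \int[mu]_(x in `]0%R, 1%R]) (x `^ (r - 1))%:E = (r^-1)%:E.
Proof.
move=> r0.
pose F (k : nat) : set R := `[(k.+2%:R^-1)%R, 1%R]%classic.
have FE : `]0%R, 1%R]%classic = \bigcup_k F k.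
  apply/seteqP; split => [x /=|x [k _]]; rewrite /F/= !in_itv/=; last first.
    by move=> /andP[kx ->]; rewrite andbT (lt_le_trans _ kx)// invr_gt0.
  move=> /andP[x0 x1]; near \oo => k; exists k => //=; rewrite in_itv/= x1 andbT.
  have : (k.+1%:R^-1 < x)%R by near: k; exact: near_infty_natSinv_lt (PosNum x0).
  by move=> /ltW; apply: le_trans; rewrite lef_pV2 ?posrE// ler_nat.
rewrite FE; apply: (@integral_exhaustion F _ (fun k => (1 - k.+2%:R^-1 `^ r) / r)%R).
- apply/nondecreasing_seqP => k; rewrite subsetEset => x; rewrite /F/= !in_itv/=.
  by move=> /andP[kx ->]; rewrite andbT (le_trans _ kx)// lef_pV2 ?posrE// ler_nat.
- by move=> k; exact: measurable_itv.
- exact: measurable_powR_fun.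
- by move=> x; exact: powR_ge0.
- move=> k; rewrite integral_powR_segment ?gt_eqF ?invr_gt0 ?powR1//.
  by rewrite invf_lt1// ltr1n.
rewrite -[X in _ --> X]mul1r -[X in (X * _)%R](subr0 1%R).
by apply: cvgMr_tmp; apply: cvgB; [exact: cvg_cst|exact: cvg_powR_invn].
Unshelve. all: by end_near. Qed.

Lemma integral_powR_1y (r : R) : (1 < r)%R ->
  \int[mu]_(x in `[1%R, +oo[) (x `^ (- r))%:E = ((r - 1)^-1)%:E.
Proof.
move=> r1; have r0 : (0 < r - 1)%R by rewrite subr_gt0.
pose F (k : nat) : set R := `[1%R, k.+2%:R]%classic.
have FE : `[1%R, +oo[%classic = \bigcup_k F k.
  apply/seteqP; split => [x /=|x [k _]]; rewrite /F/= !in_itv/= ?andbT; last by case/andP.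
  move=> x1; exists (Num.truncn x) => //=; rewrite in_itv/= x1/=.
  by rewrite (le_trans (ltW (truncnS_gt x)))// ler_nat.
rewrite FE.
apply: (@integral_exhaustion F _ (fun k => (1 - k.+2%:R^-1 `^ (r - 1)) / (r - 1))%R).
- apply/nondecreasing_seqP => k; rewrite subsetEset => x; rewrite /F/= !in_itv/=.
  by move=> /andP[-> kx]; rewrite (le_trans kx)// ler_nat.
- by move=> k; exact: measurable_itv.
- exact: measurable_powR_fun.
- by move=> x; exact: powR_ge0.
- move=> k; have -> : (- r = (1 - r) - 1)%R by ring.
  rewrite integral_powR_segment ?ltr1n//; last by rewrite -oppr_eq0 opprB gt_eqF.
  have -> : (k.+2%:R^-1 `^ (r - 1) = (k.+2%:R : R) `^ (1 - r))%R.
    by rewrite -(powR_inv1 (ler0n R k.+2)) -powRrM mulN1r opprB.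
  congr EFin; rewrite powR1; move: (_ `^ _)%R => y; field.
  by apply/andP; split; clear -r1; lra.
rewrite -[X in _ --> X]mul1r -[X in (X * _)%R](subr0 1%R).
by apply: cvgMr_tmp; apply: cvgB; [exact: cvg_cst|exact: cvg_powR_invn].
Qed.

Lemma integral_expR_tail (a : R) :
  \int[mu]_(x in `[a, +oo[) (expR (- x))%:E = (expR (- a))%:E.
Proof.
have cN : continuous (fun x : R => expR (- x)).
  by move=> x; apply: continuous_comp; [exact: opp_continuous|exact: continuous_expR].
rewrite (@ge0_continuous_FTC2y _ (fun x => expR (- x)) (fun x => - expR (- x))%R a 0%R).
- by rewrite sub0e EFinN oppeK.
- by move=> x _; exact: expR_ge0.
- by apply: continuous_subspaceT.
- by rewrite -oppr0; apply: cvgN; exact: cvgr_expR.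
- by move=> x _; exact: ex_derive.
- by apply: cvgN; apply/cvg_at_right_filter; exact: cN.
- move=> x _; rewrite derive1E derive_val; rewrite /GRing.scale/=; ring.
Qed.

End one_dimensional_integrals.

(** * The Gamma function *)

Section gamma_integrals.
Context {R : realType}.
Local Notation mu := (@lebesgue_measure R).
Local Notation RR := (measurableTypeR R).

Lemma integralZl_real d (T : measurableType d) (m : {measure set T -> \bar R}) (c : R)
    (f : T -> RR) : 0 <= c -> measurable_fun setT f -> (forall x, 0 <= f x) ->
  (\int[m]_x (c * f x)%:E = c%:E * \int[m]_x (f x)%:E)%E.
Proof.
move=> c0 mf f0; under eq_integral do rewrite EFinM.
have mE : measurable_fun setT (EFin \o f) by exact/measurable_EFinP.
have E0 x : setT x -> (0 <= (EFin \o f) x)%E by rewrite /= lee_fin.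
have cE : (0 <= c%:E)%E by rewrite lee_fin.
exact: (ge0_integralZl m measurableT mE E0 cE).
Qed.

Lemma measurable_natr d (T : measurableType d) (f : T -> bool) :
  measurable_fun setT f -> measurable_fun setT (fun x => (f x)%:R : RR).
Proof.
move=> mf; rewrite (_ : (fun x => _) = fun x => if f x then 1 else 0 : RR).
  exact: measurable_fun_ifT.
by apply/funext => x; case: (f x).
Qed.

Lemma integral_natr_itv (i : interval R) (b : R -> bool) (f : R -> R) :
  (forall x, b x = (x \in i)) ->
  (\int[mu]_x ((b x)%:R * f x)%:E = \int[mu]_(x in [set` i]) (f x)%:E)%E.
Proof.
move=> bi; rewrite [RHS]integral_mkcond; apply: eq_integral => x _.
by rewrite patchE mem_setE bi; case: (x \in i); rewrite ?mul1r ?mul0r.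
Qed.

Lemma powRD_gt0 (u r t : R) : 0 < u -> u `^ (r + t) = u `^ r * u `^ t.
Proof. by move=> u0; apply: powRD; rewrite (gt_eqF u0) implybT. Qed.

Lemma powR_cancel (u q : R) : 0 < u -> u `^ (1 - q) * u `^ (q - 1) = 1.
Proof. by move=> u0; rewrite -powRD_gt0// addrC addrA subrK subrr powRr0. Qed.

(** The integrand of the Gamma function with rate w, extended by 0 so that all
    integrals run over the whole line. *)
Definition gamma_kernel (q w s : R) : R := (0 < s)%R%:R * (s `^ (q - 1) * expR (- (w * s))).

Lemma gamma_kernel_ge0 q w s : 0 <= gamma_kernel q w s.
Proof. by rewrite mulr_ge0// mulr_ge0 ?powR_ge0 ?expR_ge0. Qed.

Lemma measurable_gamma_kernel d (T : measurableType d) (q : R) (w s : T -> RR) :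
  measurable_fun setT w -> measurable_fun setT s ->
  measurable_fun setT (fun x => gamma_kernel q (w x) (s x) : RR).
Proof.
move=> mw ms; apply: measurable_funM.
  by apply: measurable_natr; exact: measurable_fun_ltr.
apply: measurable_funM; first exact: (measurableT_comp (measurable_powR _)).
by apply: measurableT_comp => //; apply: measurable_funN; exact: measurable_funM.
Qed.

Definition gamma_integral (q w : R) : \bar R := (\int[mu]_s (gamma_kernel q w s)%:E)%E.

Lemma gamma_integral_ge0 q w : (0 <= gamma_integral q w)%E.
Proof. by apply: integral_ge0 => s _; rewrite lee_fin gamma_kernel_ge0. Qed.

Lemma gamma_integralE q w : gamma_integral q w =
  (\int[mu]_(s in `]0%R, +oo[) (s `^ (q - 1) * expR (- (w * s)))%:E)%E.
Proof.
rewrite -(@integral_natr_itv _ (fun s => 0 < s))// => x.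
by rewrite in_itv/= andbT.
Qed.

Lemma GammaE q : Gamma q = fine (gamma_integral q 1).
Proof.
rewrite /Gamma /Rintegral gamma_integralE; congr fine.
by apply: eq_integral => t _; rewrite mul1r.
Qed.

Lemma gamma_integral_scale q w : 0 < w ->
  gamma_integral q w = ((w `^ (- q))%:E * gamma_integral q 1)%E.
Proof.
move=> w0; have w0' : w != 0 by rewrite gt_eqF.
transitivity (\int[mu]_s ((w `^ (1 - q))%:E * (gamma_kernel q 1 (w * s))%:E))%E.
  apply: eq_integral => s _; rewrite -EFinM; congr EFin; rewrite /gamma_kernel.
  rewrite pmulr_rgt0//; have [s0|s0] := ltP 0 s; last by rewrite !mul0r mulr0.
  by rewrite !mul1r powRM ?ltW// !mulrA (powR_cancel q w0) mul1r.
rewrite (@ge0_integral_linear R w _ (fun s => (gamma_kernel q 1 s)%:E))//.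
- congr (_%:E * _)%E; rewrite -powR_inv1 ?ltW// -powRD_gt0//.
  by congr (_ `^ _); ring.
- exact: powR_ge0.
- by apply/measurable_EFinP; exact: measurable_gamma_kernel.
- by move=> s; rewrite lee_fin gamma_kernel_ge0.
Qed.

Lemma integral_powR_0u (q u : R) : 0 < q -> 0 < u ->
  (\int[mu]_s (((0 < s) && (s <= u))%R%:R * s `^ (q - 1))%:E = (u `^ q / q)%:E)%E.
Proof.
move=> q0 u0; have u0' : u != 0 by rewrite gt_eqF.
pose f (s : R) := ((((0 < s) && (s <= u))%R%:R * s `^ (q - 1)) : R)%:E.
have := @ge0_integral_linear R u (u `^ (1 - q)) f u0 (powR_ge0 _ _).
have -> : (\int[mu]_x ((u `^ (1 - q))%:E * f (u * x)%R) = (q^-1)%:E)%E.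
  rewrite -(integral_powR_01 q0) -(@integral_natr_itv _ (fun s => (0 < s) && (s <= 1))).
    apply: eq_integral => s _; rewrite /f -EFinM; congr EFin.
    rewrite pmulr_rgt0// -[X in _ * s <= X]mulr1 ler_pM2l//.
    have [s0|s0] := ltP 0 s; last by rewrite !mul0r mulr0.
    rewrite powRM; [|exact: ltW|exact: ltW].
    rewrite mulrCA; congr (_ * _).
    by rewrite mulrA (powR_cancel q u0) mul1r.
  by move=> x; rewrite in_itv.
have mf : measurable_fun [set: RR] f.
  apply/measurable_EFinP; apply: measurable_funM; last exact: measurable_powR.
  apply: measurable_natr; apply: measurable_and; first exact: measurable_fun_ltr.
  exact: measurable_fun_ler.
have f0 x : (0 <= f x)%E by rewrite lee_fin mulr_ge0// powR_ge0.
move=> /(_ mf f0).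
have -> : (u `^ q / q)%:E = ((u / u `^ (1 - q))%:E * (q^-1)%:E)%E.
  rewrite -EFinM; congr (_ * _)%:E; rewrite -powRN opprB.
  by rewrite -{2}[u]powRr1 ?ltW// -powRD_gt0//; congr (_ `^ _); ring.
move=> ->; rewrite muleA -EFinM /f.
rewrite (_ : u / u `^ (1 - q) * (u^-1 * u `^ (1 - q)) = 1) ?mul1e//.
have u1 : u `^ (1 - q) != 0 by rewrite gt_eqF// powR_gt0.
by field; rewrite u0' u1.
Qed.

Lemma integral_natr_tail (a : R) :
  (\int[mu]_u ((a <= u)%R%:R * expR (- u))%:E = (expR (- a))%:E)%E.
Proof.
rewrite -integral_expR_tail -(@integral_natr_itv _ (fun u => a <= u))// => x.
by rewrite in_itv/= andbT.
Qed.

(** Tonelli for the function s^(q-1) e^(-u) on the region s <= u. *)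
Lemma gamma_integral_rec (q : R) : 0 < q ->
  gamma_integral (q + 1) 1 = (q%:E * gamma_integral q 1)%E.
Proof.
move=> q0.
pose H (z : RR * RR) : \bar R :=
  (((0 < z.1) && (z.1 <= z.2))%R%:R * z.1 `^ (q - 1) * expR (- z.2))%:E.
have mH : measurable_fun setT H.
  apply/measurable_EFinP; apply: measurable_funM.
    apply: measurable_funM; last by apply: (measurableT_comp (measurable_powR _)).
    by apply: measurable_natr; apply: measurable_and;
      [exact: measurable_fun_ltr|exact: measurable_fun_ler].
  by apply: measurableT_comp => //; exact: measurable_funN.
have H0 z : (0 <= H z)%E by rewrite lee_fin mulr_ge0 ?expR_ge0// mulr_ge0// powR_ge0.
have FT := fubini_tonelli H mH H0.
have L : (\int[mu]_x \int[mu]_y H (x, y) = gamma_integral q 1)%E.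
  apply: eq_integral => s _.
  under eq_integral => u _.
    rewrite /H/= (_ : _ * _ = (0 < s)%R%:R * s `^ (q - 1) * ((s <= u)%R%:R * expR (- u))); last first.
      by case: (0 < s); case: (s <= u); rewrite ?mul1r ?mul0r ?mulr0.
    over.
  rewrite integralZl_real.
  - by rewrite integral_natr_tail -EFinM /gamma_kernel mul1r mulrA.
  - by rewrite mulr_ge0// powR_ge0.
  - apply: measurable_funM.
      by apply: measurable_natr; exact: measurable_fun_ler.
    by apply: measurableT_comp => //; exact: measurable_funN.
  - by move=> u; rewrite mulr_ge0// expR_ge0.
have RE : (\int[mu]_y \int[mu]_x H (x, y) = (q^-1)%:E * gamma_integral (q + 1) 1)%E.
  have mg : measurable_fun [set: RR] (gamma_kernel (q + 1) 1 : RR -> RR).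
    exact: measurable_gamma_kernel.
  have iq0 : 0 <= q^-1 by rewrite invr_ge0 ltW.
  rewrite /gamma_integral -(integralZl_real mu iq0 mg (gamma_kernel_ge0 _ _)).
  apply: eq_integral => u _.
  have [u0|u0] := ltP 0 u; last first.
    rewrite integral0_eq ?/gamma_kernel => [|s _]; first by rewrite ltNge u0 mul0r mulr0.
    rewrite /H/=; case: ltP => s0; rewrite ?mul0r//=.
    by rewrite leNgt (le_lt_trans u0 s0) !mul0r.
  have mI : measurable_fun [set: RR] (fun s : RR => ((0 < s) && (s <= u))%R%:R * s `^ (q - 1)).
    apply: measurable_funM; last exact: measurable_powR.
    by apply: measurable_natr; apply: measurable_and;
      [exact: measurable_fun_ltr|exact: measurable_fun_ler].
  under eq_integral do rewrite /H/= mulrC.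
  rewrite (integralZl_real mu (expR_ge0 _) mI); last first.
    by move=> s; rewrite mulr_ge0// powR_ge0.
  rewrite integral_powR_0u// /gamma_kernel u0 -!EFinM !mul1r addrK.
  by congr EFin; ring.
have : gamma_integral q 1 = ((q^-1)%:E * gamma_integral (q + 1) 1)%E.
  by rewrite -L -RE; exact: FT.
move=> ->; rewrite muleA -EFinM mulfV ?gt_eqF// mul1e//.
Qed.

Lemma gamma_integral_1 : gamma_integral 1 1 = 1%E.
Proof.
rewrite gamma_integralE subrr.
under eq_integral do rewrite powRr0 !mul1r.
rewrite integral_itv_obnd_cbnd ?integral_expR_tail ?oppr0 ?expR0//.
apply/measurable_EFinP; apply: measurable_funTS.
by apply: measurableT_comp => //; exact: measurable_funN.
Qed.

(** Compare s^(q-1) with a multiple of e^(s/2). *)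
Lemma gamma_integral_lty_ge1 (q : R) : 1 < q -> (gamma_integral q 1 < +oo)%E.
Proof.
move=> q1; have r0 : 0 < q - 1 by rewrite subr_gt0.
set r := q - 1 in r0.
pose C := (2 * r) `^ r.
apply: (@le_lt_trans _ _ (C%:E * gamma_integral 1 2^-1)%E); last first.
  by rewrite gamma_integral_scale// gamma_integral_1 mule1 -EFinM ltry.
have mg (a w : R) : measurable_fun [set: RR] (gamma_kernel a w : RR -> RR).
  exact: measurable_gamma_kernel.
rewrite /gamma_integral -(integralZl_real mu (powR_ge0 _ _) (mg 1 2^-1) (gamma_kernel_ge0 _ _)).
apply: ge0_le_integral => //.
- by move=> u _; rewrite lee_fin gamma_kernel_ge0.
- by apply/measurable_EFinP; exact: mg.
- by apply/measurable_EFinP; apply: measurable_funM => //; exact: mg.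
move=> s _; rewrite lee_fin /gamma_kernel -/r.
have [s0|s0] := ltP 0 s; last by rewrite !mul0r mulr0.
rewrite !mul1r subrr powRr0 mul1r.
have R2 : 0 < 2 * r by exact: mulr_gt0.
have -> : s = (2 * r) * (s / (2 * r)) by field; rewrite gt_eqF.
set y := s / (2 * r).
have y0 : 0 < y by exact: divr_gt0.
rewrite powRM; [|exact: ltW|exact: ltW].
rewrite -mulrA ler_wpM2l ?powR_ge0//.
have -> : y `^ r = expR (r * ln y) by rewrite /powR gt_eqF.
rewrite -expRD ler_expR.
have := ln_sublinear y0 => hy.
have := ler_wpM2l (ltW r0) (ltW hy); clear; lra.
Qed.

(** The recurrence reduces an exponent q > 0 to q + 1 > 1. *)
Lemma gamma_integral_lty (q : R) : 0 < q -> (gamma_integral q 1 < +oo)%E.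
Proof.
move=> q0; have : (gamma_integral (q + 1) 1 < +oo)%E.
  by apply: gamma_integral_lty_ge1; rewrite ltrDr.
rewrite gamma_integral_rec//; have := gamma_integral_ge0 q 1.
by case: (gamma_integral q 1) => [r||] //= _; rewrite ?ltry// gt0_muley ?lte_fin.
Qed.

Lemma gamma_integral_Gamma (q : R) : 0 < q -> gamma_integral q 1 = (Gamma q)%:E.
Proof.
move=> q0; rewrite GammaE fineK// ge0_fin_numE ?gamma_integral_ge0//.
exact: gamma_integral_lty.
Qed.

Lemma Gamma_rec (q : R) : 0 < q -> Gamma (q + 1) = q * Gamma q.
Proof.
move=> q0; apply/EFin_inj; rewrite EFinM -!gamma_integral_Gamma ?addr_gt0//.
exact: gamma_integral_rec.
Qed.

Lemma Gamma_1 : Gamma 1 = 1 :> R.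
Proof. by apply/EFin_inj; rewrite -gamma_integral_Gamma// gamma_integral_1. Qed.

Lemma Gamma_gt0 (q : R) : 0 < q -> 0 < Gamma q.
Proof.
move=> q0; rewrite -lte_fin -gamma_integral_Gamma//.
apply: (@lt_le_trans _ _ ((expR (-1))%:E * (q^-1)%:E)%E).
  by rewrite -EFinM lte_fin mulr_gt0 ?expR_gt0 ?invr_gt0.
rewrite -(integral_powR_01 q0) -(@integral_natr_itv _ (fun s => (0 < s) && (s <= 1))); last first.
  by move=> x; rewrite in_itv.
have m1 : measurable_fun [set: RR] (fun s : RR => ((0 < s) && (s <= 1))%R%:R * s `^ (q - 1)).
  apply: measurable_funM; last exact: measurable_powR.
  by apply: measurable_natr; apply: measurable_and;
      [exact: measurable_fun_ltr|exact: measurable_fun_ler].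
have p1 s : 0 <= ((0 < s) && (s <= 1))%R%:R * s `^ (q - 1) by rewrite mulr_ge0// powR_ge0.
rewrite /gamma_integral -(integralZl_real mu (expR_ge0 _) m1 p1).
apply: ge0_le_integral => //.
- by move=> u _; rewrite lee_fin mulr_ge0 ?expR_ge0.
- by apply/measurable_EFinP; exact: measurable_funM.
- by apply/measurable_EFinP; exact: measurable_gamma_kernel.
move=> s _; rewrite lee_fin /gamma_kernel.
case: (ltP 0 s) => s0; rewrite ?mul0r ?mulr0//=.
have [s1|s1] := leP s 1; last first.
  rewrite mul0r mulr0; apply: mulr_ge0 => //.
  by apply: mulr_ge0; [exact: powR_ge0|exact: expR_ge0].
by rewrite !mul1r mulrC ler_wpM2l ?powR_ge0// ler_expR lerN2.
Qed.

End gamma_integrals.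

(** * The Stieltjes transform of the Gamma law *)

Section stieltjes_gamma.
Context {R : realType}.
Local Notation mu := (@lebesgue_measure R).
Local Notation RR := (measurableTypeR R).

(** The average of x / (x + s) under the Gamma law of parameter q, in closed form
    (see integral_stieltjes). *)
Definition stieltjes (q x : R) : R := expR x * x `^ q * upper_Gamma (1 - q) x.

Definition stieltjes_kernel (q x v : R) : R :=
  (0 < v)%R%:R * (x * expR (- (v * x)) * (1 + v) `^ (- q)).

Lemma measurable_stieltjes_kernel q x :
  measurable_fun setT (stieltjes_kernel q x : RR -> RR).
Proof.
apply: measurable_funM; first by apply: measurable_natr; exact: measurable_fun_ltr.
apply: measurable_funM.
  apply: measurable_funM => //; apply: measurableT_comp => //.
  by apply: measurable_funN; exact: measurable_funM.
by apply: (measurableT_comp (measurable_powR _)); exact: measurable_funD.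
Qed.

Lemma stieltjes_kernel_ge0 q x v : 0 < x -> 0 <= stieltjes_kernel q x v.
Proof.
move=> x0; apply: mulr_ge0 => //; apply: mulr_ge0; last exact: powR_ge0.
by apply: mulr_ge0; [exact: ltW|exact: expR_ge0].
Qed.

(** Substitute t = x (1 + v) in the incomplete Gamma function. *)
Lemma integral_stieltjes_kernel (q x : R) : 0 < q -> 0 < x ->
  (\int[mu]_v (stieltjes_kernel q x v)%:E = (stieltjes q x)%:E)%E.
Proof.
move=> q0 x0.
pose f (t : RR) : RR := (x < t)%R%:R * (t `^ (- q) * expR (- t)).
have mg : measurable_fun [set: RR] (fun t : RR => t `^ (- q) * expR (- t) : RR).
  apply: measurable_funM; first exact: measurable_powR.
  by apply: measurableT_comp => //; exact: measurable_funN.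
have mf : measurable_fun setT f.
  by apply: measurable_funM => //; apply: measurable_natr; exact: measurable_fun_ltr.
have f0 t : 0 <= f t.
  by apply: mulr_ge0 => //; apply: mulr_ge0; [exact: powR_ge0|exact: expR_ge0].
have UE : (\int[mu]_t (f t)%:E = (upper_Gamma (1 - q) x)%:E)%E.
  have -> : upper_Gamma (1 - q) x = fine (\int[mu]_t (f t)%:E)%E.
    rewrite /upper_Gamma /Rintegral; congr fine.
    rewrite /f (@integral_natr_itv _ `]x, +oo[ (fun t => x < t)); last first.
      by move=> t; rewrite in_itv/= andbT.
    rewrite integral_itv_obnd_cbnd; last by apply/measurable_EFinP; exact: measurable_funTS.
    by apply: eq_integral => t _; congr ((_ `^ _ * _)%:E); ring.
  rewrite fineK//.
  rewrite ge0_fin_numE; last by apply: integral_ge0 => t _; rewrite lee_fin.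
  apply: (@le_lt_trans _ _ ((x `^ (- q))%:E * (expR (- x))%:E)%E); last by rewrite -EFinM ltry.
  have p0 (t : RR) : 0 <= (x <= t)%R%:R * expR (- t) by apply: mulr_ge0 => //; exact: expR_ge0.
  have mp : measurable_fun [set: RR] (fun t : RR => (x <= t)%R%:R * expR (- t) : RR).
    apply: measurable_funM; first by apply: measurable_natr; exact: measurable_fun_ler.
    by apply: measurableT_comp => //; exact: measurable_funN.
  rewrite -integral_natr_tail -(integralZl_real mu (powR_ge0 _ _) mp p0).
  apply: ge0_le_integral => //.
  - by move=> t _; rewrite lee_fin.
  - exact/measurable_EFinP.
  - by apply/measurable_EFinP; exact: measurable_funM.
  move=> t _; rewrite lee_fin /f; have [xt|xt] := ltP x t; last first.
    by rewrite mul0r; apply: mulr_ge0; [exact: powR_ge0|exact: p0].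
  rewrite (ltW xt) !mul1r ler_wpM2r ?expR_ge0// !powRN lef_pV2 ?posrE ?powR_gt0//; last first.
    exact: lt_trans xt.
  by apply: ge0_ler_powR; rewrite ?nnegrE ?(ltW q0) ?(ltW x0) ?(le_trans (ltW x0) (ltW xt))//; exact: ltW.
have Ae := @ge0_integral_affine R x x (fun t => (f t)%:E) x0
   (proj2 (measurable_EFinP _ _) mf) (fun t => ltac:(by rewrite lee_fin)).
rewrite UE in Ae.
have C0 : 0 <= x * (expR x * x `^ q).
  by apply: mulr_ge0; [exact: ltW|apply: mulr_ge0; [exact: expR_ge0|exact: powR_ge0]].
have mfa : measurable_fun setT (fun v : RR => f (x * v + x) : RR).
  by apply: (measurableT_comp mf); apply: measurable_funD => //; exact: measurable_funM.
have := integralZl_real mu C0 mfa (fun v => f0 _); rewrite Ae -!EFinM.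
have -> : x * (expR x * x `^ q) * (x^-1 * upper_Gamma (1 - q) x) = stieltjes q x.
  by rewrite /stieltjes; field; rewrite gt_eqF.
move=> <-; apply: eq_integral => v _; congr EFin.
rewrite /f /stieltjes_kernel ltrDr pmulr_rgt0//.
have [v0|v0] := ltP 0 v; last by rewrite !mul0r mulr0.
have -> : x * v + x = x * (1 + v) by ring.
rewrite !mul1r powRM; [|exact: ltW|by rewrite addr_ge0// ltW].
rewrite (_ : - (x * (1 + v)) = - x - v * x); last by ring.
rewrite expRD (powRN x) (expRN x); field.
by rewrite !gt_eqF ?expR_gt0 ?powR_gt0.
Qed.

(** Write x / (x + w s) as the integral of x e^(-v (x + w s)) over v and integrate
    over s first. *)
Lemma integral_stieltjes (q x w : R) : 0 < q -> 0 < x -> 0 < w ->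
  (\int[mu]_s (x / (x + w * s) * gamma_kernel q w s)%:E =
   (stieltjes q x)%:E * gamma_integral q w)%E.
Proof.
move=> q0 x0 w0.
pose H (z : RR * RR) : \bar R :=
  ((0 < z.2)%R%:R * (x * expR (- (z.2 * (x + w * z.1)))) * gamma_kernel q w z.1)%:E.
have mH : measurable_fun setT H.
  apply/measurable_EFinP; apply: measurable_funM; last exact: measurable_gamma_kernel.
  apply: measurable_funM; first by apply: measurable_natr; exact: measurable_fun_ltr.
  apply: measurable_funM => //; apply: measurableT_comp => //; apply: measurable_funN.
  by apply: measurable_funM => //; apply: measurable_funD => //; exact: measurable_funM.
have H0 z : (0 <= H z)%E.
  rewrite lee_fin mulr_ge0 ?gamma_kernel_ge0//; apply: mulr_ge0 => //.
  by apply: mulr_ge0; [exact: ltW|exact: expR_ge0].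
have mg (a b : R) : measurable_fun [set: RR] (gamma_kernel a b : RR -> RR).
  exact: measurable_gamma_kernel.
have FT := fubini_tonelli H mH H0.
transitivity (\int[mu]_s \int[mu]_v H (s, v))%E.
  apply: eq_integral => s _.
  have [s0|s0] := ltP 0 s; last first.
    have g0 : gamma_kernel q w s = 0 by rewrite /gamma_kernel ltNge s0 mul0r.
    by rewrite integral0_eq ?g0 ?mulr0// => v _; rewrite /H/= g0 mulr0.
  have xs0 : 0 < x + w * s by rewrite addr_gt0// mulr_gt0.
  under eq_integral => v _.
    rewrite /H/= (_ : _ * _ * _ = x * gamma_kernel q w s * gamma_kernel 1 (x + w * s) v); last first.
      rewrite {3}/gamma_kernel subrr powRr0 mul1r [v * _]mulrC; ring.
    over.
  rewrite (integralZl_real mu _ (mg _ _) (gamma_kernel_ge0 _ _)); last first.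
    by rewrite mulr_ge0 ?gamma_kernel_ge0// ltW.
  rewrite -/(gamma_integral 1 (x + w * s)) gamma_integral_scale// gamma_integral_1 mule1 -EFinM.
  by congr EFin; rewrite powR_inv1 ?ltW//; ring.
transitivity (\int[mu]_v \int[mu]_s H (s, v))%E; first exact: FT.
have gf : gamma_integral q w = (fine (gamma_integral q w))%:E.
  rewrite fineK// ge0_fin_numE ?gamma_integral_ge0// gamma_integral_scale//.
  by rewrite gamma_integral_Gamma// -EFinM ltry.
rewrite muleC gf -integral_stieltjes_kernel//.
rewrite -(integralZl_real mu _ (measurable_stieltjes_kernel q x)); last 2 first.
- by apply: fine_ge0; exact: gamma_integral_ge0.
- by move=> v; exact: stieltjes_kernel_ge0.
apply: eq_integral => v _; rewrite EFinM -gf.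
have [v0|v0] := ltP 0 v; last first.
  rewrite /stieltjes_kernel ltNge v0 mul0r mule0 integral0_eq// => s _.
  by rewrite /H/= ltNge v0 !mul0r.
have v1 : 0 < 1 + v by rewrite addr_gt0.
under eq_integral => s _.
  rewrite /H/= v0 mul1r (_ : _ * _ = x * expR (- (v * x)) * gamma_kernel q (w * (1 + v)) s); last first.
    rewrite /gamma_kernel (_ : - (v * (x + w * s)) = - (v * x) - v * w * s); last by ring.
    rewrite expRD (_ : - (w * (1 + v) * s) = - (w * s) - v * w * s); last by ring.
    by rewrite expRD; ring.
  over.
rewrite (integralZl_real mu _ (mg _ _) (gamma_kernel_ge0 _ _)); last first.
  by rewrite mulr_ge0 ?expR_ge0// ltW.
rewrite -/(gamma_integral q (w * (1 + v))) gamma_integral_scale ?mulr_gt0//.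
rewrite [in RHS]gamma_integral_scale// gamma_integral_Gamma// -!EFinM; congr EFin.
by rewrite powRM ?ltW// /stieltjes_kernel v0 mul1r; ring.
Qed.

(** Bound e^(-v x) by 1; the remaining integral of (1 + v)^(-q) converges because
    q > 1. This is the regime of exponents near 1 in dimension at least 2. *)
Lemma stieltjes_le (q x : R) : 1 < q -> 0 < x -> stieltjes q x <= x / (q - 1).
Proof.
move=> q1 x0; have q0 : 0 < q by exact: lt_trans q1.
rewrite -lee_fin -integral_stieltjes_kernel//.
pose f (t : RR) : RR := (1 <= t)%R%:R * t `^ (- q).
have mf : measurable_fun setT f.
  by apply: measurable_funM; [apply: measurable_natr; exact: measurable_fun_ler|exact: measurable_powR].
have f0 t : 0 <= f t by apply: mulr_ge0 => //; exact: powR_ge0.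
have fE : (\int[mu]_t (f t)%:E = ((q - 1)^-1)%:E)%E.
  rewrite -integral_powR_1y// /f (@integral_natr_itv _ `[1, +oo[ (fun t => 1 <= t))//.
  by move=> t; rewrite in_itv/= andbT.
have Ae := @ge0_integral_affine R 1 1 (fun t => (f t)%:E) ltr01
   (proj2 (measurable_EFinP _ _) mf) (fun t => ltac:(by rewrite lee_fin)).
rewrite fE invr1 mul1e in Ae.
have mfa : measurable_fun setT (fun v : RR => f (1 * v + 1) : RR).
  by apply: (measurableT_comp mf); apply: measurable_funD => //; exact: measurable_funM.
have -> : ((x / (q - 1))%:E = \int[mu]_v (x * f (1 * v + 1))%:E)%E.
  by rewrite (integralZl_real mu (ltW x0) mfa (fun v => f0 _)) Ae EFinM.
apply: ge0_le_integral => //.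
- by move=> v _; rewrite lee_fin; exact: stieltjes_kernel_ge0.
- by apply/measurable_EFinP; exact: measurable_stieltjes_kernel.
- by apply/measurable_EFinP; exact: measurable_funM.
move=> v _; rewrite lee_fin /stieltjes_kernel /f mul1r.
have [v0|v0] := ltP 0 v; last first.
  by rewrite mul0r; apply: mulr_ge0; [exact: ltW|exact: f0].
have h1 : 1 <= v + 1 by rewrite lerDr ltW.
have h2 : expR (- (v * x)) <= 1 by rewrite expR_le1 oppr_le0 mulr_ge0 ?ltW.
by rewrite h1 !mul1r (addrC v 1) ler_wpM2r ?powR_ge0// ler_piMr// ltW.
Qed.

Lemma stieltjes_gt0 (q x : R) : 0 < q -> 0 < x -> 0 < stieltjes q x.
Proof.
move=> q0 x0; rewrite -lte_fin -integral_stieltjes_kernel//.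
pose c := x * expR (- x) * 2 `^ (- q).
have c0 : 0 < c by rewrite !mulr_gt0 ?expR_gt0 ?powR_gt0.
apply: (@lt_le_trans _ _ c%:E); first by rewrite lte_fin.
have -> : c%:E = (\int[mu]_v (c * ((0 < v) && (v <= 1))%R%:R)%:E)%E.
  rewrite integralZl_real ?ltW//; last first.
    by apply: measurable_natr; apply: measurable_and;
      [exact: measurable_fun_ltr|exact: measurable_fun_ler].
  have := @integral_powR_01 R 1 ltr01; rewrite invr1 => h1.
  rewrite (_ : (\int[mu]_v _ = 1)%E) ?mule1// -h1.
  rewrite -(@integral_natr_itv _ `]0, 1] (fun s => (0 < s) && (s <= 1))); last first.
    by move=> s; rewrite in_itv.
  by apply: eq_integral => v _; rewrite subrr powRr0 mulr1.
apply: ge0_le_integral => //.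
- by move=> v _; rewrite lee_fin; apply: mulr_ge0 => //; exact: ltW.
- apply/measurable_EFinP; apply: measurable_funM => //.
  by apply: measurable_natr; apply: measurable_and;
      [exact: measurable_fun_ltr|exact: measurable_fun_ler].
- by apply/measurable_EFinP; exact: measurable_stieltjes_kernel.
move=> v _; rewrite lee_fin /stieltjes_kernel.
have [v0|v0] := ltP 0 v; last by rewrite mulr0 mul0r.
have [v1|v1] := leP v 1; rewrite /= ?mulr0 ?mulr1 mul1r; last first.
  by rewrite mulr_ge0 ?powR_ge0// mulr_ge0 ?expR_ge0// ltW.
have v2 : 0 < 1 + v by rewrite addr_gt0.
apply: ler_pM; rewrite ?powR_ge0//; first by rewrite mulr_ge0 ?expR_ge0// ltW.
  by rewrite ler_wpM2l ?(ltW x0)// ler_expR lerN2 ler_piMl// ltW.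
rewrite !powRN lef_pV2 ?posrE ?powR_gt0//.
apply: ge0_ler_powR; rewrite ?nnegrE ?(ltW q0) ?(ltW v2)//.
by rewrite -lerBrDl (_ : 2 - 1 = 1)//; clear; lra.
Qed.

Lemma bm_lower_exprE n p :
  bm_lower_expr n p = n%:R^-1 * stieltjes (n%:R / p : R) ((p - 1) * n%:R / p).
Proof. by rewrite /bm_lower_expr /stieltjes !mulrA. Qed.

(** Here q = n / p stays away from 1 while x = n (p - 1) / p tends to 0, so the
    linear bound stieltjes_le applies. *)
Lemma bm_lower_expr_cvg0 n : (2 <= n)%N -> bm_lower_expr n q @[q --> (1 : R)^'+] --> (0 : R).
Proof.
move=> n2; have n0 : 0 < n%:R :> R by rewrite ltr0n (leq_trans _ n2).
have n2R : 2 <= n%:R :> R by rewrite ler_nat.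
apply: (@squeeze_cvgr _ _ _ _ (fun=> 0) (fun q => 3 * (q - 1))).
- near=> q.
  have q1 : 1 < q by near: q; exact: nbhs_right_gt.
  have q2 : q < 3 / 2 by near: q; apply: nbhs_right_lt; rewrite ltr_pdivlMr//; clear; lra.
  have q0 : 0 < q by exact: lt_trans q1.
  rewrite bm_lower_exprE.
  have x0 : 0 < (q - 1) * n%:R / q by rewrite divr_gt0// mulr_gt0// subr_gt0.
  have s1 : 1 < n%:R / q by rewrite ltr_pdivlMr// mul1r; clear -q2 n2R; lra.
  have s0 : 0 < n%:R / q by exact: lt_trans s1.
  apply/andP; split; first by rewrite mulr_ge0 ?invr_ge0 ?ltW// stieltjes_gt0.
  rewrite mulrC ler_pdivrMr//; apply: (le_trans (stieltjes_le s1 x0)).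
  rewrite ler_pdivrMr ?subr_gt0// ler_pdivrMr//.
  have -> : 3 * (q - 1) * n%:R * (n%:R / q - 1) * q = 3 * (q - 1) * n%:R * (n%:R - q).
    by field; rewrite gt_eqF.
  have h : 0 <= (q - 1) * n%:R by rewrite mulr_ge0 ?ltW// subr_gt0.
  have h2 : 0 <= (q - 1) * n%:R * (3 * (n%:R - q) - 1).
    by rewrite mulr_ge0//; clear -q2 n2R; lra.
  by move: h2; clear; lra.
- exact: cvg_cst.
- have <- : 3 * (1 - 1) = 0 :> R by rewrite subrr mulr0.
  apply: cvgMl_tmp; apply: cvgB; last exact: cvg_cst.
  by apply: cvg_at_right_filter; exact: cvg_id.
Unshelve. all: by end_near. Qed.

End stieltjes_gamma.

(** * Polar coordinates *)

Section polar.
Context {R : realType}.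
Local Notation mu := (@lebesgue_measure R).
Local Notation RR := (measurableTypeR R).

Lemma lebesgue_rV_set0 n : (lebesgue_rV n.+1 [set (0 : 'rV[R]_n.+1)%R] = 0)%E.
Proof.
apply/eqP; rewrite eq_le measure_ge0 andbT.
have <- : (lebesgue_rV n.+1 (@rV_head R n @^-1` [set (0:R)%R] `&` @rV_tail R n @^-1` setT) = 0)%E.
  by rewrite lebesgue_rVS// lebesgue_measure_set1 mul0e.
apply: le_measure; rewrite ?inE.
- by apply: closed_borelRV; exact: (@accessible_closed_set1 'rV[R]_n.+1 (hausdorff_accessible (@norm_hausdorff _ _))).
- apply: measurableI; rewrite -[X in measurable X]setTI.
    by apply: measurable_rV_head => //; exact: measurable_set1.
  exact: measurable_rV_tail.
- by move=> x ->; split => //=; rewrite /rV_head mxE.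
Qed.

(** The variable s plays the role of |x|^p for x = s^(1/p) y; the weight
    1_(|y| >= 1) |y|^(-p) averages over the radius of y, which spares the surface
    measure of the sphere. *)
Definition polar_integrand n (p : R) (f : borelRV R n -> RR) (z : RR * borelRV R n) : RR :=
  (1 <= enorm (z.2 : 'rV[R]_n) `^ p)%R%:R * (enorm (z.2 : 'rV[R]_n) `^ p)^-1 *
  ((0 < z.1)%R%:R * z.1 `^ (n%:R / p - 1) * f (z.1 `^ p^-1 *: (z.2 : 'rV[R]_n))).

Lemma measurable_enorm_powR n (p : R) :
  measurable_fun setT (fun x : borelRV R n => enorm (x : 'rV[R]_n) `^ p : RR).
Proof.
by apply: (measurableT_comp (measurable_powR p)); exact: measurable_enorm.
Qed.

Lemma measurable_enorm_powRV n (p : R) :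
  measurable_fun setT (fun x : borelRV R n => (enorm (x : 'rV[R]_n) `^ p)^-1 : RR).
Proof.
rewrite (_ : (fun x => _) = fun x => (enorm (x : 'rV[R]_n) `^ p) `^ (-1)); last first.
  by apply/funext => x; rewrite powR_inv1// powR_ge0.
by apply: (measurableT_comp (measurable_powR _)); exact: measurable_enorm_powR.
Qed.

Lemma measurable_polar_scale n (p : R) : measurable_fun setT
  (fun z : RR * borelRV R n => z.1 `^ p^-1 *: (z.2 : 'rV[R]_n) : borelRV R n).
Proof.
have msc : measurable_fun setT (fun z : RR * borelRV R n => (z.1 `^ p^-1 : RR, z.2)).
  apply: measurable_fun_pair; last exact: measurable_snd.
  exact: (measurableT_comp (measurable_powR _)).
exact: (measurableT_comp (@measurable_rV_scale R n) msc).
Qed.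

Lemma measurable_polar_integrand n (p : R) (f : borelRV R n -> RR) :
  measurable_fun setT f -> measurable_fun setT (polar_integrand p f).
Proof.
move=> mf; apply: measurable_funM.
  apply: measurable_funM.
    apply: measurable_natr; apply: measurable_fun_ler => //.
    exact: (measurableT_comp (@measurable_enorm_powR n p)).
  exact: (measurableT_comp (@measurable_enorm_powRV n p)).
apply: measurable_funM.
  apply: measurable_funM; first by apply: measurable_natr; exact: measurable_fun_ltr.
  exact: (measurableT_comp (measurable_powR _)).
exact: (measurableT_comp mf (@measurable_polar_scale n p)).
Qed.

Lemma polar_integrand_ge0 n (p : R) (f : borelRV R n -> RR) z :
  (forall x, 0 <= f x) -> 0 <= polar_integrand p f z.
Proof. by move=> f0; rewrite /polar_integrand !mulr_ge0 ?invr_ge0 ?powR_ge0. Qed.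

(** For x <> 0 the value f x is |x|^(-p) times the integral of f x over
    0 < s <= |x|^p. Exchange the integrals and substitute x = s^(1/p) y. *)
Lemma polar_integral n (p : R) (f : borelRV R n.+1 -> RR) : 0 < p ->
  measurable_fun setT f -> (forall x, 0 <= f x) ->
  (\int[lebesgue_rV n.+1]_x (f x)%:E =
   \int[lebesgue_rV n.+1]_y \int[mu]_s (polar_integrand p f (s, y))%:E)%E.
Proof.
move=> p0 mf f0.
pose a (x : borelRV R n.+1) : RR := enorm (x : 'rV[R]_n.+1) `^ p.
have ma : measurable_fun setT a by exact: measurable_enorm_powR.
have a0 x : 0 <= a x by exact: powR_ge0.
have mia : measurable_fun setT (fun x => (a x)^-1 : RR) by exact: measurable_enorm_powRV.
pose H (z : RR * borelRV R n.+1) : RR :=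
  ((0 < z.1) && (z.1 <= a z.2))%R%:R * (a z.2)^-1 * f z.2.
have mH : measurable_fun setT H.
  apply: measurable_funM; last exact: (measurableT_comp mf).
  apply: measurable_funM; last exact: (measurableT_comp mia).
  apply: measurable_natr; apply: measurable_and; first exact: measurable_fun_ltr.
  by apply: measurable_fun_ler => //; exact: (measurableT_comp ma).
have H0 z : 0 <= H z by rewrite !mulr_ge0// invr_ge0.
pose G := polar_integrand (n := n.+1) p f.
have mG : measurable_fun setT G by exact: measurable_polar_integrand.
have G0 z : 0 <= G z by exact: polar_integrand_ge0.
have mHE : measurable_fun setT (EFin \o H) by exact/measurable_EFinP.
have mGE : measurable_fun setT (EFin \o G) by exact/measurable_EFinP.
have HE0 z : (0 <= (EFin \o H) z)%E by rewrite lee_fin.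
have GE0 z : (0 <= (EFin \o G) z)%E by rewrite lee_fin.
transitivity (\int[lebesgue_rV n.+1]_x \int[mu]_s (EFin \o H) (s, x))%E.
  apply: ge0_ae_eq_integral => //.
  - exact/measurable_EFinP.
  - exact: (@measurable_fun_fubini_tonelli_G _ _ _ _ R mu (EFin \o H)).
  - by move=> x _; rewrite lee_fin.
  - by move=> x _; apply: integral_ge0.
  exists [set (0 : 'rV[R]_n.+1)]; split.
  - by apply: closed_borelRV; exact: (@accessible_closed_set1 'rV[R]_n.+1 (hausdorff_accessible (@norm_hausdorff _ _))).
  - exact: lebesgue_rV_set0.
  move=> x /= hx; apply: contrapT => x0; apply: hx => _.
  have ax : 0 < a x.
    rewrite powR_gt0// lt0r enorm_ge0 andbT; apply/eqP => ex.
    by apply: x0; exact: enorm_eq0.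
  have := integral_powR_0u ltr01 ax; rewrite subrr powRr1 ?divr1 ?ltW// => h.
  have c0 : 0 <= (a x)^-1 * f x by rewrite mulr_ge0// invr_ge0.
  have mb : measurable_fun setT (fun s : RR => ((0 < s) && (s <= a x))%R%:R * s `^ 0 : RR).
    apply: measurable_funM; last exact: measurable_powR.
    by apply: measurable_natr; apply: measurable_and;
      [exact: measurable_fun_ltr|exact: measurable_fun_ler].
  have b0 (s : RR) : 0 <= ((0 < s) && (s <= a x))%R%:R * s `^ 0 by rewrite mulr_ge0 ?powR_ge0.
  have := integralZl_real mu c0 mb b0; rewrite h -EFinM mulrAC mulVf ?gt_eqF// mul1r => <-.
  by apply: eq_integral => s _; congr EFin; rewrite /H/= powRr0 mulr1 mulrC mulrA.
rewrite -(fubini_tonelli (m1 := mu) (EFin \o H) mHE HE0).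
transitivity (\int[mu]_s \int[lebesgue_rV n.+1]_x (EFin \o G) (s, x))%E.
  apply: eq_integral => s _; have [s0|s0] := ltP 0 s; last first.
    rewrite !integral0_eq// => x _ /=; rewrite ?/G/polar_integrand ?/H/= ltNge s0/= ?mul0r ?mulr0//.
  pose t := s `^ p^-1; have t0 : 0 < t by exact: powR_gt0.
  have tp : t `^ p = s by rewrite -powRrM mulVf ?gt_eqF// powRr1// ltW.
  have tn : t ^+ n.+1 = s `^ (n.+1%:R / p).
    by rewrite -powR_mulrn ?ltW// -powRrM mulrC.
  have mHs : measurable_fun setT (fun x => (EFin \o H) (s, x)).
    exact: (measurableT_comp mHE (@measurable_pair1 _ _ _ _ s)).
  have := ge0_integral_rV_scale t0 mHs (fun x => HE0 (s, x)).
  have tn0 : t ^+ n.+1 != 0 by rewrite gt_eqF// exprn_gt0.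
  move=> /(congr1 (fun e => (t ^+ n.+1)%:E * e)%E).
  rewrite muleA -EFinM mulfV// mul1e => <-.
  have mHt : measurable_fun setT (fun x : borelRV R n.+1 => H (s, t *: (x : 'rV[R]_n.+1))).
    have msc := measurableT_comp (@measurable_rV_scale R n.+1) (@measurable_pair1 _ _ _ _ t).
    exact: (measurableT_comp (measurableT_comp mH (@measurable_pair1 _ _ _ _ s)) msc).
  rewrite -(integralZl_real (lebesgue_rV n.+1) (ltW (exprn_gt0 _ t0)) mHt (fun x => H0 _)).
  apply: eq_integral => x _; congr EFin.
  have at_ : a (t *: (x : 'rV[R]_n.+1)) = s * a x.
    by rewrite /a enormZ ?(ltW t0)// powRM ?(ltW t0) ?enorm_ge0// tp.
  rewrite /G /polar_integrand /H/= -!/(a _) at_ s0/= -/t invfM.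
  rewrite -[X in (X <= _)%R%:R]mulr1 ler_pM2l//.
  have -> : t ^+ n.+1 = s * s `^ (n.+1%:R / p - 1).
    by rewrite tn -{2}[s]powRr1 ?(ltW s0)// -powRD_gt0// addrC subrK.
  have sn0 : s != 0 by rewrite gt_eqF.
  have alg (u v y b : R) : s * u * (b * (s^-1 * v) * y) = b * v * (1 * u * y) by field.
  by rewrite alg mul1r.
by rewrite (fubini_tonelli (m1 := mu) (EFin \o G) mGE GE0).
Qed.

(** Chebyshev's inequality for two decreasing functions: compare iota with its
    value at the point where x / (x + w s) crosses its average. *)
Lemma decreasing_weight (q x w : R) (iota : RR -> RR) : 0 < q -> 0 < x -> 0 < w ->
  measurable_fun setT iota -> (forall s, 0 <= iota s <= 1) ->
  (forall s t, 0 < s -> s <= t -> iota t <= iota s) ->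
  (\int[mu]_s (stieltjes q x * (iota s * gamma_kernel q w s))%:E <=
   \int[mu]_s (x / (x + w * s) * (iota s * gamma_kernel q w s))%:E)%E.
Proof.
move=> q0 x0 w0 mi i01 idec.
set K := stieltjes q x; have K0 : 0 < K by exact: stieltjes_gt0.
(* The point where x / (x + w s) equals K. *)
pose s0 := (x / K - x) / w.
pose i0 := if 0 < s0 then iota s0 else 1.
have i0_ge0 : 0 <= i0 by rewrite /i0; case: ifP => // _; case/andP: (i01 s0).
have mg : measurable_fun setT (gamma_kernel q w : RR -> RR) by exact: measurable_gamma_kernel.
have g0 s : 0 <= gamma_kernel q w s by exact: gamma_kernel_ge0.
have i_ge0 s : 0 <= iota s by case/andP: (i01 s).
have mig : measurable_fun setT (fun s : RR => iota s * gamma_kernel q w s : RR) by exact: measurable_funM.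
have ig0 s : 0 <= iota s * gamma_kernel q w s by exact: mulr_ge0.
pose k (s : RR) : RR := `|x / (x + w * s)|.
have mk : measurable_fun setT k.
  rewrite (_ : k = fun s => x * (`|x + w * s| `^ (-1))); last first.
    by apply/funext => s; rewrite powR_inv1// /k normrM normfV gtr0_norm.
  apply: measurable_funM => //; apply: (measurableT_comp (measurable_powR _)).
  apply: measurableT_comp => //; apply: measurable_funD => //; exact: measurable_funM.
have k_ge0 s : 0 <= k s by exact: normr_ge0.
have kE (f : RR -> RR) s : (s <= 0 -> f s = 0) -> x / (x + w * s) * f s = k s * f s.
  move=> h; have [s1|/h->] := ltP 0 s; last by rewrite !mulr0.
  by rewrite /k ger0_norm// divr_ge0 ?ltW// addr_gt0// mulr_gt0.
have gneg s : s <= 0 -> gamma_kernel q w s = 0 by move=> h; rewrite /gamma_kernel ltNge h mul0r.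
have -> : (\int[mu]_s (x / (x + w * s) * (iota s * gamma_kernel q w s))%:E =
           \int[mu]_s (k s * (iota s * gamma_kernel q w s))%:E)%E.
  apply: eq_integral => s _; congr EFin.
  by rewrite (kE (fun s => iota s * gamma_kernel q w s))// => /gneg ->; rewrite mulr0.
have IK : (\int[mu]_s (k s * gamma_kernel q w s)%:E = K%:E * gamma_integral q w)%E.
  rewrite -(integral_stieltjes q0 x0 w0); apply: eq_integral => s _; congr EFin.
  by rewrite -(kE (gamma_kernel q w))//; exact: gneg.
have gf : gamma_integral q w = (fine (gamma_integral q w))%:E.
  rewrite fineK// ge0_fin_numE ?gamma_integral_ge0// gamma_integral_scale//.
  by rewrite gamma_integral_Gamma// -EFinM ltry.
have mkg : measurable_fun setT (fun s : RR => k s * gamma_kernel q w s : RR) by exact: measurable_funM.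
have m1 : measurable_fun setT (fun s : RR => k s * (iota s * gamma_kernel q w s) : RR) by exact: measurable_funM.
have m2 : measurable_fun setT (fun s : RR => K * (iota s * gamma_kernel q w s) : RR) by exact: measurable_funM.
have m3 : measurable_fun setT (fun s : RR => i0 * (k s * gamma_kernel q w s) : RR) by exact: measurable_funM.
have m4 : measurable_fun setT (fun s : RR => i0 * (K * gamma_kernel q w s) : RR).
  by apply: measurable_funM => //; exact: measurable_funM.
have E1 : (\int[mu]_s (i0 * (k s * gamma_kernel q w s))%:E = (i0 * (K * fine (gamma_integral q w)))%:E)%E.
  rewrite (integralZl_real mu i0_ge0 mkg (fun s => mulr_ge0 (k_ge0 s) (g0 s))).
  by rewrite IK gf -!EFinM.
have E2 : (\int[mu]_s (i0 * (K * gamma_kernel q w s))%:E = (i0 * (K * fine (gamma_integral q w)))%:E)%E.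
  have mKg : measurable_fun setT (fun s : RR => K * gamma_kernel q w s : RR) by exact: measurable_funM.
  rewrite (integralZl_real mu i0_ge0 mKg (fun s => mulr_ge0 (ltW K0) (g0 s))).
  by rewrite (integralZl_real mu (ltW K0) mg g0) -/(gamma_integral q w) gf -!EFinM.
rewrite -(@leeD2rE _ (i0 * (K * fine (gamma_integral q w)))%:E)//.
rewrite -{1}E1 -E2 -!ge0_integralD//.
- apply: ge0_le_integral => //.
  + move=> s _; rewrite -EFinD lee_fin; apply: addr_ge0; last by apply: mulr_ge0 => //; exact: mulr_ge0.
    by apply: mulr_ge0 => //; exact: ltW.
  + by apply/measurable_EFinP; exact: (measurable_funD m2 m3).
  + by apply/measurable_EFinP; exact: (measurable_funD m1 m4).
  move=> s _; rewrite -!EFinD lee_fin.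
  have [s1|s1] := leP s 0; first by rewrite gneg// !mulr0.
  have xs : 0 < x + w * s by rewrite addr_gt0// mulr_gt0.
  have kx : k s = x / (x + w * s) by rewrite /k ger0_norm// divr_ge0// ltW.
  rewrite -subr_ge0.
  have -> : k s * (iota s * gamma_kernel q w s) + i0 * (K * gamma_kernel q w s) -
     (K * (iota s * gamma_kernel q w s) + i0 * (k s * gamma_kernel q w s)) =
     gamma_kernel q w s * ((iota s - i0) * (k s - K)) by ring.
  apply: mulr_ge0 => //.
  have [ss|ss] := leP s s0.
    apply: mulr_ge0; rewrite subr_ge0.
      by rewrite /i0 (lt_le_trans s1 ss) idec.
    by rewrite kx ler_pdivlMr// -(ler_pdivlMl _ _ K0) addrC -lerBrDr mulrC -ler_pdivlMr// [K^-1 * x]mulrC.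
  apply: mulr_le0; rewrite subr_le0.
    rewrite /i0; case: ifP => s00; last by case/andP: (i01 s).
    by apply: idec => //; exact: ltW.
  rewrite kx ler_pdivrMr// -(ler_pdivrMl _ _ K0) addrC -lerBlDr [w * s]mulrC -ler_pdivrMr//.
  by rewrite [K^-1 * x]mulrC ltW.
- by move=> s _; rewrite lee_fin; apply: mulr_ge0.
- exact/measurable_EFinP.
- by move=> s _; rewrite lee_fin; apply: mulr_ge0 => //; apply: mulr_ge0 => //; exact: ltW.
- exact/measurable_EFinP.
- by move=> s _; rewrite lee_fin; apply: mulr_ge0 => //; exact: ltW.
- exact/measurable_EFinP.
- by move=> s _; rewrite lee_fin; apply: mulr_ge0 => //; exact: mulr_ge0.
- exact/measurable_EFinP.
Qed.

End polar.

(** * The average curvature of star-shaped sets *)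

Section star_average.
Context {R : realType}.
Local Notation mu := (@lebesgue_measure R).
Local Notation RR := (measurableTypeR R).

(** With N = n + 1 the potential on the ray through y is w * s, so the curvature
    is N^-1 * x / (x + w s) for x = N (1 - 1/p), and the star-shaped set cuts out a
    decreasing indicator. *)
Lemma star_averageS n (p : R) (M : set (borelRV R n.+1)) : 1 < p -> measurable M ->
  (forall (x : 'rV[R]_n.+1) (t : R), M x -> 0 <= t <= 1 -> M (t *: x)) ->
  (\int[lebesgue_rV n.+1]_(z in M)
     (bm_lower_expr n.+1 p * expR (- potential p (z : 'rV[R]_n.+1)))%:E <=
   \int[lebesgue_rV n.+1]_(z in M)
     (curvature p (z : 'rV[R]_n.+1) * expR (- potential p (z : 'rV[R]_n.+1)))%:E)%E.
Proof.
move=> p1 mM starM.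
have p0 : 0 < p by exact: lt_trans p1.
have n0 : 0 < n.+1%:R :> R by rewrite ltr0n.
have ip1 : 0 < 1 - p^-1 by rewrite subr_gt0 invf_lt1.
pose q := n.+1%:R / p; have q0 : 0 < q by exact: divr_gt0.
pose x := (p - 1) * n.+1%:R / p.
have xE : x = n.+1%:R * (1 - p^-1) by rewrite /x; field; rewrite gt_eqF.
have x0 : 0 < x by rewrite xE mulr_gt0.
have K0 := stieltjes_gt0 q0 x0.
rewrite bm_lower_exprE -/q -/x.
pose d (z : borelRV R n.+1) : RR := expR (- potential p (z : 'rV[R]_n.+1)).
have md : measurable_fun setT d by exact: measurable_density.
have mdM : measurable_fun setT (d \_ M) by exact: measurable_restrictR.
have dM0 z : 0 <= (d \_ M) z by rewrite patchE; case: ifP => // _; exact: expR_ge0.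
pose f1 z := n.+1%:R^-1 * stieltjes q x * (d \_ M) z.
pose f2 z := curvature p (z : 'rV[R]_n.+1) * (d \_ M) z.
have c0 (z : 'rV[R]_n.+1) : 0 <= curvature p z.
  by rewrite invr_ge0; exact: curvature_den_ge0.
have mf1 : measurable_fun setT (f1 : borelRV R n.+1 -> RR) by exact: measurable_funM.
have mf2 : measurable_fun setT (f2 : borelRV R n.+1 -> RR).
  by apply: measurable_funM => //; exact: measurable_curvature.
have f10 z : 0 <= f1 z.
  by apply: mulr_ge0 => //; apply: mulr_ge0; [rewrite invr_ge0; exact: ltW|exact: ltW].
have f20 z : 0 <= f2 z by exact: mulr_ge0.
have toM (h : borelRV R n.+1 -> R) : (\int[lebesgue_rV n.+1]_(z in M) (h z * d z)%:E =
   \int[lebesgue_rV n.+1]_z (h z * (d \_ M) z)%:E)%E.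
  rewrite (integral_restrict M (fun z => h z * d z)); apply: eq_integral => z _.
  by rewrite !patchE; case: ifP => //; rewrite mulr0.
rewrite (toM (fun=> _)) (toM (curvature p)) -/f1 -/f2.
rewrite (polar_integral p0 mf1 f10) (polar_integral p0 mf2 f20).
have mP f : measurable_fun setT f -> measurable_fun setT
    (EFin \o polar_integrand (n := n.+1) p f).
  by move=> mf; apply/measurable_EFinP; exact: measurable_polar_integrand.
have P0 f : (forall z, 0 <= f z) -> forall z,
    (0 <= (EFin \o polar_integrand (n := n.+1) p f) z)%E.
  by move=> f0 z; rewrite lee_fin; exact: polar_integrand_ge0.
apply: ge0_le_integral => //.
- by move=> y _; apply: integral_ge0 => s _; exact: (P0 f1 f10 (s, y)).
- exact: (@measurable_fun_fubini_tonelli_G _ _ _ _ R mu _ (mP f1 mf1) (P0 f1 f10)).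
- exact: (@measurable_fun_fubini_tonelli_G _ _ _ _ R mu _ (mP f2 mf2) (P0 f2 f20)).
move=> y _.
pose r := enorm (y : 'rV[R]_n.+1) `^ p.
have [r1|r1] := leP 1 r; last first.
  rewrite integral0_eq; first by apply: integral_ge0 => s _; exact: (P0 f2 f20 (s, y)).
  by move=> s _; rewrite /polar_integrand/= -/r leNgt r1 !mul0r.
have r0 : 0 < r by exact: lt_le_trans r1.
pose w := r / p; have w0 : 0 < w by exact: divr_gt0.
pose iota (s : RR) : RR := \1_M (s `^ p^-1 *: (y : 'rV[R]_n.+1)).
have mi : measurable_fun setT iota.
  apply: (measurableT_comp (measurable_indic mM)).
  exact: (measurableT_comp (@measurable_polar_scale R n.+1 p) (@measurable_pair2 _ _ _ _ y)).
have i01 s : 0 <= iota s <= 1.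
  by rewrite /iota indicE; case: (_ \in _); rewrite /= ?lexx ?ler01.
have idec s t : 0 < s -> s <= t -> iota t <= iota s.
  move=> s0 st; rewrite /iota !indicE.
  case: (boolP (t `^ p^-1 *: y \in M)) => [|_]; last by rewrite ler0n.
  rewrite inE => Mt; have t0 : 0 < t by exact: lt_le_trans st.
  have tp : 0 < t `^ p^-1 by exact: powR_gt0.
  rewrite mem_set// (_ : s `^ p^-1 *: y = (s `^ p^-1 / t `^ p^-1) *: (t `^ p^-1 *: y)); last first.
    by rewrite scalerA divfK// gt_eqF.
  apply: starM => //; rewrite divr_ge0 ?powR_ge0//= ler_pdivrMr// mul1r.
  by apply: ge0_ler_powR; rewrite ?nnegrE ?invr_ge0 ?(ltW p0) ?(ltW s0) ?(ltW t0).
have dE s : (0 < s)%R%:R * s `^ (q - 1) * (d \_ M) (s `^ p^-1 *: (y : 'rV[R]_n.+1)) =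
    iota s * gamma_kernel q w s.
  rewrite /gamma_kernel; have [s0|_] := ltP 0 s; last by rewrite !mul0r mulr0.
  have sp : (s `^ p^-1) `^ p = s by rewrite -powRrM mulVf ?gt_eqF// powRr1// ltW.
  rewrite patchE /iota indicE /d potentialZ ?powR_ge0// sp.
  have -> : s * potential p y = w * s by rewrite /w /potential mulrC.
  by case: ifP => _; rewrite ?mulr0 ?mul0r// !mul1r.
have C0 : 0 <= r^-1 * n.+1%:R^-1.
  by rewrite -invfM invr_ge0; apply: mulr_ge0; exact: ltW.
have E1 s : polar_integrand p f1 (s, y) =
    r^-1 * n.+1%:R^-1 * (stieltjes q x * (iota s * gamma_kernel q w s)).
  rewrite -dE /polar_integrand /f1/= -/r r1 -/q mul1r.
  have alg (a b c u v e : R) : a * (u * v * (b * c * e)) = a * b * (c * (u * v * e)) by ring.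
  exact: alg.
have E2 s : polar_integrand p f2 (s, y) =
    r^-1 * n.+1%:R^-1 * (`|x / (x + w * s)| * (iota s * gamma_kernel q w s)).
  rewrite -dE /polar_integrand /f2/= -/r r1 -/q mul1r.
  have [s0|_] := ltP 0 s; last by rewrite !mul0r !mulr0.
  have sp : (s `^ p^-1) `^ p = s by rewrite -powRrM mulVf ?gt_eqF// powRr1// ltW.
  have -> : curvature p (s `^ p^-1 *: (y : 'rV[R]_n.+1)) = n.+1%:R^-1 * `|x / (x + w * s)|.
    have ws : 0 < w * s by exact: mulr_gt0.
    have xs : 0 < x + w * s by exact: addr_gt0.
    rewrite (ger0_norm (divr_ge0 (ltW x0) (ltW xs))).
    rewrite /curvature potentialZ ?powR_ge0// sp.
    have -> : s * potential p y = w * s by rewrite /w /potential mulrC.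
    move: xs; rewrite xE => xs.
    have h : 0 < n.+1%:R + w * s / (1 - p^-1) by rewrite addr_gt0 ?divr_gt0.
    have -> : n.+1%:R * (1 - p^-1) + w * s = (1 - p^-1) * (n.+1%:R + w * s / (1 - p^-1)).
      by move: ip1; move: (1 - _) (n.+1%:R) => b N b0; field; rewrite gt_eqF.
    have alg (u b N : R) : 0 < u -> 0 < b -> 0 < N -> u^-1 = N^-1 * (N * b / (b * u)).
      by move=> u0 b0 N0; field; rewrite !gt_eqF.
    exact: alg.
  have alg (a b c v e : R) : a * (1 * v * (b * c * e)) = a * b * (c * (1 * v * e)) by ring.
  exact: alg.
have mg : measurable_fun setT (gamma_kernel q w : RR -> RR) by exact: measurable_gamma_kernel.
have mig : measurable_fun setT (fun s : RR => iota s * gamma_kernel q w s : RR) by exact: measurable_funM.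
have ig0 s : 0 <= iota s * gamma_kernel q w s.
  by case/andP: (i01 s) => i0 _; apply: mulr_ge0 => //; exact: gamma_kernel_ge0.
have mx : measurable_fun setT (fun s : RR => `|x / (x + w * s)| : RR).
  rewrite (_ : (fun s => _) = fun s => x * (`|x + w * s| `^ (-1))); last first.
    by apply/funext => s; rewrite powR_inv1// normrM normfV gtr0_norm.
  apply: measurable_funM => //; apply: (measurableT_comp (measurable_powR _)).
  by apply: measurableT_comp => //; apply: measurable_funD => //; exact: measurable_funM.
rewrite (eq_integral _ _ (fun s _ => congr1 EFin (E1 s))).
rewrite (eq_integral _ _ (fun s _ => congr1 EFin (E2 s))).
rewrite (integralZl_real mu C0 (measurable_funM (@measurable_cst _ _ RR RR setT (stieltjes q x)) mig)
  (fun s => mulr_ge0 (ltW K0) (ig0 s))).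
rewrite (integralZl_real mu C0 (measurable_funM mx mig) (fun s => mulr_ge0 (normr_ge0 _) (ig0 s))).
rewrite lee_wpmul2l ?lee_fin//.
have := decreasing_weight q0 x0 w0 mi i01 idec.
congr (_ <= _)%E; apply: eq_integral => s _; congr EFin.
rewrite /=/gamma_kernel; have [s0|_] := ltP 0 s; last by rewrite !mul0r !mulr0.
rewrite (ger0_norm (divr_ge0 (ltW x0) (ltW _)))//; apply: addr_gt0 => //; exact: mulr_gt0.
Qed.

Lemma star_average n (p : R) (M : set (borelRV R n)) : (0 < n)%N -> 1 < p -> measurable M ->
  (forall (x : 'rV[R]_n) (t : R), M x -> 0 <= t <= 1 -> M (t *: x)) ->
  (\int[lebesgue_rV n]_(z in M)
     (bm_lower_expr n p * expR (- potential p (z : 'rV[R]_n)))%:E <=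
   \int[lebesgue_rV n]_(z in M)
     (curvature p (z : 'rV[R]_n) * expR (- potential p (z : 'rV[R]_n)))%:E)%E.
Proof. by case: n M => // n M _; exact: star_averageS. Qed.

End star_average.

(** * From local to global concavity *)

Section local_to_global.
Context {R : realType}.
Implicit Types (g l : R -> R) (a b c x y h t u v : R).

(** (e^t + e^(-t)) e^(- t^2 / 2) decreases on the positive axis. *)
Lemma cosh_le_gauss x : expR x + expR (- x) <= 2 * expR (x ^+ 2 / 2).
Proof.
wlog x0 : x / 0 <= x.
  move=> H; have [/H//|/ltW x0] := leP 0 x.
  by have := H (- x); rewrite oppr_ge0 => /(_ x0); rewrite sqrrN opprK [leLHS]addrC.
pose k (t : R) := t * (expR t + expR (- t)) - (expR t - expR (- t)).
pose k' (t : R) := t * (expR t - expR (- t)).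
have k0 t : 0 <= t -> 0 <= k t.
  move=> t0; have -> : 0 = k 0 by rewrite /k oppr0 expR0; ring.
  apply: (@derive_ge0_le R k k' t t0).
  - by move=> s _; apply: is_derive_eq; rewrite /k' /GRing.scale/=; ring.
  - move=> s /andP[s0 _]; apply: mulr_ge0 => //.
    by rewrite subr_ge0 ler_expR; clear -s0; lra.
pose f (t : R) := - ((expR t + expR (- t)) * expR (- (t ^+ 2 / 2))).
pose f' (t : R) := k t * expR (- (t ^+ 2 / 2)).
have fx : f 0 <= f x.
  apply: (@derive_ge0_le R f f' x x0).
  - move=> s _.
    have d2 : is_derive s 1 (fun t : R => - (t ^+ 2 / 2)) (- s).
      by apply: is_derive_eq; rewrite /GRing.scale/=; field.
    have d3 := @is_derive1_comp R expR (fun t => - (t ^+ 2 / 2)) s _ _ (is_derive_expR _) d2.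
    have d1 : is_derive s 1 (fun t : R => expR t + expR (- t)) (expR s - expR (- s)).
      by apply: is_derive_eq; rewrite /GRing.scale/=; ring.
    apply: (is_derive_eq (is_deriveN (is_deriveM d1 d3))).
    by rewrite /f' /k /GRing.scale/=; ring.
  - by move=> s /andP[s0 _]; apply: mulr_ge0; [exact: k0|exact: expR_ge0].
move: fx; rewrite /f oppr0 expR0 expr0n/= mul0r oppr0 expR0 mulr1 (expRN (x ^+ 2 / 2)) lerN2.
by rewrite ler_pdivrMr ?expR_gt0.
Qed.

(** Subtract the chord and add a small strictly concave term. At an interior
    minimum the midpoint inequality would be violated, so the minimum sits at an
    endpoint, where the function is 0. *)
Lemma locally_midpoint_concave g (a b d : R) : a <= b -> continuous g -> 0 < d ->
  (forall x h, 0 < h <= d -> a <= x - h -> x + h <= b ->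
     (g (x + h) + g (x - h)) / 2 <= g x) ->
  forall t, 0 <= t <= 1 -> t * g b + (1 - t) * g a <= g (t * b + (1 - t) * a).
Proof.
move=> ab cg d0 mid t t01; set x := t * b + _.
have [aeb|anb] := eqVneq a b.
  have e (r : R) : t * r + (1 - t) * r = r by ring.
  by rewrite /x aeb (e b) (e (g b)).
have {}ab : a < b by rewrite lt_neqAle anb.
pose k := (g b - g a) / (b - a).
have ba0 : 0 < b - a by rewrite subr_gt0.
have xab : a <= x <= b.
  have := mulr_ge0 (proj1 (andP t01)) (ltW ba0).
  have t1 : 0 <= 1 - t by rewrite subr_ge0; case/andP: t01.
  have := mulr_ge0 t1 (ltW ba0); rewrite /x; clear; lra.
have key (e : R) : 0 < e -> g a + k * (x - a) <= g x + e * ((x - a) * (b - x)).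
  move=> e0.
  pose G y := g y - (g a + k * (y - a)) + e * ((y - a) * (b - y)).
  have cG : {within `[a, b], continuous G}.
    apply: continuous_subspaceT => y.
    have ci : z @[z --> y] --> y by exact: cvg_id.
    have cc (r : R) : r @[_ --> y] --> r by exact: cvg_cst.
    have c1 (r : R) : (z - r) @[z --> y] --> (y - r) by exact: (cvgB ci (cc r)).
    have c2 (r : R) : (r - z) @[z --> y] --> (r - y) by exact: (cvgB (cc r) ci).
    have c3 : (g a + k * (z - a)) @[z --> y] --> (g a + k * (y - a)).
      by apply: cvgD; [exact: cc|apply: cvgM; [exact: cc|exact: c1]].
    have c4 : (e * ((z - a) * (b - z))) @[z --> y] --> (e * ((y - a) * (b - y))).
      by apply: cvgM; [exact: cc|apply: cvgM; [exact: c1|exact: c2]].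
    by apply: cvgD; [apply: cvgB; [exact: cg|exact: c3]|exact: c4].
  have [m mab minG] := EVT_min (ltW ab) cG.
  suff Gm : 0 <= G m.
    have := minG x; rewrite in_itv/= => /(_ xab) /(le_trans Gm).
    by rewrite /G; clear; lra.
  move: mab; rewrite in_itv/= => /andP[]; rewrite le_eqVlt => /predU1P[<- _|am].
    by rewrite /G; clear; lra.
  rewrite le_eqVlt => /predU1P[->|mb].
    rewrite /G (_ : k * (b - a) = g b - g a); last by rewrite /k divfK// gt_eqF.
    by clear; lra.
  exfalso.
  pose h := Num.min d (Num.min (m - a) (b - m)).
  have h0 : 0 < h by rewrite !lt_min d0 !subr_gt0 am mb.
  have hd : h <= d by rewrite /h ge_min lexx.
  have h1 : a <= m - h.
    have : h <= m - a by rewrite /h !ge_min lexx orbT.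
    by clear; lra.
  have h2 : m + h <= b.
    have : h <= b - m by rewrite /h !ge_min lexx !orbT.
    by clear; lra.
  have := mid m h; rewrite h0 hd => /(_ isT h1 h2).
  have := minG (m + h); rewrite in_itv/= h2 andbT => /(_ ltac:(clear -am h0; lra)).
  have := minG (m - h); rewrite in_itv/= h1/= => /(_ ltac:(clear -mb h0; lra)).
  have : 0 < e * h ^+ 2 by rewrite mulr_gt0// exprn_gt0.
  by rewrite /G; clear; lra.
have -> : t * g b + (1 - t) * g a = g a + k * (x - a).
  have -> : x - a = t * (b - a) by rewrite /x; ring.
  by rewrite /k; field; rewrite gt_eqF.
apply/ler_addgt0Pr => e e0.
have P0 : 0 <= (x - a) * (b - x) by case/andP: xab => xa xb; apply: mulr_ge0; rewrite subr_ge0.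
have P1 : 0 < (x - a) * (b - x) + 1 by rewrite ltr_wpDl.
apply: (le_trans (key (e / ((x - a) * (b - x) + 1)) (divr_gt0 e0 P1))).
rewrite lerD2l mulrAC ler_pdivrMr// ler_wpM2l ?(ltW e0)//.
by rewrite lerDl.
Qed.

(** The slopes of a concave function inside an interval are bounded by the slopes
    towards the endpoints 0 and 1. *)
Lemma concave_lipschitz l (B u0 v0 : R) : 0 < u0 -> u0 <= v0 -> v0 < 1 ->
  (forall u v t, 0 <= u <= 1 -> 0 <= v <= 1 -> 0 <= t <= 1 ->
     t * l u + (1 - t) * l v <= l (t * u + (1 - t) * v)) ->
  (forall u, 0 <= u <= 1 -> l u <= B) ->
  exists2 C, 0 <= C & forall u v, u0 <= u <= v0 -> u0 <= v <= v0 ->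
    `|l v - l u| <= C * `|v - u|.
Proof.
move=> u00 uv0 v01 conc lB.
have l0B : 0 <= B - l 0 by rewrite subr_ge0 lB// lexx ler01.
have l1B : 0 <= B - l 1 by rewrite subr_ge0 lB// ler01 lexx.
have v1 : 0 < 1 - v0 by rewrite subr_gt0.
have c1 : 0 <= (B - l 0) / u0 by apply: divr_ge0 => //; exact: ltW.
have c2 : 0 <= (B - l 1) / (1 - v0) by apply: divr_ge0 => //; exact: ltW.
exists ((B - l 0) / u0 + (B - l 1) / (1 - v0)); first exact: addr_ge0.
move=> u v; wlog uv : u v / u < v.
  move=> H hu hv; have [uv|vu|->] := ltgtP u v; first exact: H.
    by rewrite distrC (distrC v u); apply: H.
  by rewrite !subrr normr0 mulr0.
move=> /andP[u0u uv0'] /andP[u0v vv0].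
have u0' : 0 < u by exact: lt_le_trans u0u.
have v0' : 0 < v by exact: lt_trans uv.
have v1' : v < 1 by exact: le_lt_trans v01.
have u1' : u < 1 by exact: lt_trans v1'.
have d0 : 0 < v - u by rewrite subr_gt0.
rewrite (gtr0_norm d0).
have lu : l u <= B by apply: lB; rewrite !ltW.
have t01 : 0 <= u / v <= 1.
  by rewrite (divr_ge0 (ltW u0') (ltW v0'))/= ler_pdivrMr// mul1r ltW.
have s01 : 0 <= (v - u) / (1 - u) <= 1.
  rewrite divr_ge0 ?(ltW d0) ?subr_ge0 ?(ltW u1')//= ler_pdivrMr ?subr_gt0// mul1r.
  by clear -v1'; lra.
have := conc v 0 (u / v); rewrite (ltW v0') (ltW v1') lexx ler01 t01 => /(_ isT isT isT).
have -> : u / v * v + (1 - u / v) * 0 = u by rewrite mulr0 addr0 divfK// gt_eqF.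
move=> h1.
have := conc 1 u ((v - u) / (1 - u)); rewrite (ltW u0') (ltW u1') lexx ler01 s01 => /(_ isT isT isT).
have -> : (v - u) / (1 - u) * 1 + (1 - (v - u) / (1 - u)) * u = v.
  by field; rewrite subr_eq0 gt_eqF.
move=> h2.
have {}h1 : u * l v + (v - u) * l 0 <= v * l u.
  have := ler_wpM2l (ltW v0') h1.
  by congr (_ <= _); field; rewrite gt_eqF.
have {}h2 : (v - u) * l 1 + (1 - v) * l u <= (1 - u) * l v.
  have u1 : 0 <= 1 - u by rewrite subr_ge0 ltW.
  have := ler_wpM2l u1 h2.
  by congr (_ <= _); field; rewrite subr_eq0 gt_eqF.
have g1 : l v - l u <= (B - l 0) / u0 * (v - u).
  have e1 : u * (l v - l u) <= (v - u) * (B - l 0).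
    have := ler_wpM2l (ltW d0) lu; move: h1; clear; lra.
  have [neg|pos] := leP (l v - l u) 0.
    by apply: (le_trans neg); apply: mulr_ge0 => //; exact: ltW.
  have e2 : u0 * (l v - l u) <= (v - u) * (B - l 0).
    by apply: le_trans e1; apply: ler_wpM2r => //; exact: ltW.
  by rewrite mulrAC ler_pdivlMr// mulrC [leRHS]mulrC.
have g2 : l u - l v <= (B - l 1) / (1 - v0) * (v - u).
  have e1 : (1 - u) * (l u - l v) <= (v - u) * (B - l 1).
    have := ler_wpM2l (ltW d0) lu; move: h2; clear; lra.
  have [neg|pos] := leP (l u - l v) 0.
    by apply: (le_trans neg); apply: mulr_ge0 => //; exact: ltW.
  have e2 : (1 - v0) * (l u - l v) <= (v - u) * (B - l 1).
    apply: le_trans e1; apply: ler_wpM2r; first exact: ltW.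
    by rewrite lerD2l lerN2.
  by rewrite mulrAC ler_pdivlMr// mulrC [leRHS]mulrC.
have n1 : 0 <= (B - l 0) / u0 * (v - u) by apply: mulr_ge0 => //; exact: ltW.
have n2 : 0 <= (B - l 1) / (1 - v0) * (v - u) by apply: mulr_ge0 => //; exact: ltW.
by rewrite ler_norml; apply/andP; split; move: g1 g2 n1 n2; clear; lra.
Qed.

(** Clamping the argument trades continuity on a segment for continuity on the
    line. *)
Lemma lipschitz_clamp_continuous l (C u0 v0 : R) : u0 <= v0 -> 0 <= C ->
  (forall u v, u0 <= u <= v0 -> u0 <= v <= v0 -> `|l v - l u| <= C * `|v - u|) ->
  continuous (fun x : R => l (Num.max u0 (Num.min v0 x))).
Proof.
move=> uv C0 lip x.
pose cl (y : R) := Num.max u0 (Num.min v0 y).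
have clI y : u0 <= cl y <= v0 by rewrite /cl le_max lexx/= ge_max uv/= ge_min lexx.
have clL y z : `|cl y - cl z| <= `|y - z|.
  rewrite /cl; have [h1|h1] := leP v0 y; have [h2|h2] := leP v0 z;
  rewrite ?(max_idPr uv) ?subrr ?normr0 ?normr_ge0//;
  (have [h3|h3] := leP u0 y); (have [h4|h4] := leP u0 z); rewrite ?subrr ?normr0 ?normr_ge0//;
  rewrite ler_norml; have := ler_norm (y - z); have := ler_norm (z - y); rewrite (distrC z y);
  move: uv h1 h2 h3 h4; clear; lra.
apply/cvgrPdist_le => /= e e0; near=> y.
apply: (le_trans (lip _ _ (clI _) (clI _))).
have h : `|x - y| <= e / (C + 1).
  near: y; apply: (cvgrPdist_le _ _).1; first exact: cvg_id.
  by rewrite divr_gt0// ltr_wpDl.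
apply: (@le_trans _ _ (C * `|x - y|)); first by rewrite ler_wpM2l.
apply: (@le_trans _ _ (C * (e / (C + 1)))); first by rewrite ler_wpM2l.
by rewrite mulrA ler_pdivrMr ?ltr_wpDl// mulrC ler_wpM2l ?(ltW e0)// lerDl.
Unshelve. all: by end_near. Qed.

(** On [u0, v0] the function l is Lipschitz, so nearby points fall under the local
    hypothesis. With k = (1 - e) c the gain k * d^2 / 8 in l multiplies exp (k l) by
    exp (k^2 d^2 / 8), which dominates the factor cosh (k d / 2) separating the
    arithmetic from the geometric mean. *)
Lemma tilted_log_concave_inner l (c B e : R) (u0 v0 : R) : 0 < c -> 0 < e < 1 ->
  0 < u0 -> u0 <= v0 -> v0 < 1 ->
  (forall u v t, 0 <= u <= 1 -> 0 <= v <= 1 -> 0 <= t <= 1 ->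
     t * l u + (1 - t) * l v <= l (t * u + (1 - t) * v)) ->
  (forall u, 0 <= u <= 1 -> l u <= B) ->
  (exists2 a0, 0 < a0 & forall u v, 0 <= u <= 1 -> 0 <= v <= 1 ->
     `|l v - l u| <= a0 ->
     (l u + l v) / 2 + (1 - e) * (c * ((l v - l u) ^+ 2 / 8)) <= l ((u + v) / 2)) ->
  forall t, 0 <= t <= 1 ->
    t * expR ((1 - e) * c * l v0) + (1 - t) * expR ((1 - e) * c * l u0) <=
    expR ((1 - e) * c * l (t * v0 + (1 - t) * u0)).
Proof.
move=> c0 /andP[e0 e1] u00 uv v01 conc lB [a0 a00 loc] t t01.
have [C C0 lip] := concave_lipschitz u00 uv v01 conc lB.
pose k := (1 - e) * c; have k0 : 0 < k by rewrite mulr_gt0// subr_gt0.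
have ccl := lipschitz_clamp_continuous uv C0 lip.
pose cl (y : R) := Num.max u0 (Num.min v0 y).
have clE y : u0 <= y <= v0 -> cl y = y.
  by case/andP => h1 h2; rewrite /cl (min_idPr h2) (max_idPr h1).
pose g (y : R) := expR (k * l (cl y)).
have cg : continuous g.
  move=> y; apply: (@continuous_comp _ _ _ (fun y => k * l (cl y)) expR); last exact: continuous_expR.
  by apply: cvgM; [exact: cvg_cst|exact: ccl].
have gE y : u0 <= y <= v0 -> g y = expR (k * l y) by move=> h; rewrite /g clE.
have u01 y : u0 <= y <= v0 -> 0 <= y <= 1.
  by move=> /andP[h1 h2]; rewrite (le_trans (ltW u00) h1) (le_trans h2 (ltW v01)).
pose d := a0 / (2 * (C + 1)).
have C1 : 0 < 2 * (C + 1) by rewrite mulr_gt0// ltr_wpDl.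
have d0 : 0 < d by exact: divr_gt0.
have mid y h : 0 < h <= d -> u0 <= y - h -> y + h <= v0 ->
    (g (y + h) + g (y - h)) / 2 <= g y.
  move=> /andP[h0 hd] h1 h2.
  have i1 : u0 <= y - h <= v0 by rewrite h1; move: h0 h2; clear; lra.
  have i2 : u0 <= y + h <= v0 by rewrite h2 andbT; move: h0 h1; clear; lra.
  have i3 : u0 <= y <= v0 by move: h0 h1 h2; clear; lra.
  rewrite !gE//.
  have := lip _ _ i1 i2; have -> : y + h - (y - h) = 2 * h by ring.
  rewrite (gtr0_norm (mulr_gt0 (ltr0Sn R 1) h0)) => L1.
  have small : `|l (y + h) - l (y - h)| <= a0.
    apply: (le_trans L1); move: hd; rewrite /d ler_pdivlMr// => hd.
    apply: le_trans hd; move: h0; clear; lra.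
  have := loc _ _ (u01 _ i1) (u01 _ i2) small.
  have -> : (y - h + (y + h)) / 2 = y by field.
  set p1 := l (y + h); set p0 := l (y - h); set p := l y => Hp.
  have H1 : k * ((p0 + p1) / 2) + k * (k * ((p1 - p0) ^+ 2 / 8)) <= k * p.
    rewrite -mulrDr ler_wpM2l ?(ltW k0)//; move: Hp; rewrite /k; clear; lra.
  apply: le_trans (_ : expR (k * ((p0 + p1) / 2) + k * (k * ((p1 - p0) ^+ 2 / 8))) <= _); last by rewrite ler_expR.
  rewrite expRD ler_pdivrMr//.
  have -> : k * p1 = k * ((p0 + p1) / 2) + k * (p1 - p0) / 2 by field.
  have -> : k * p0 = k * ((p0 + p1) / 2) + - (k * (p1 - p0) / 2) by field.
  rewrite (expRD (k * ((p0 + p1) / 2)) (k * (p1 - p0) / 2)) (expRD (k * ((p0 + p1) / 2)) (- _)).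
  rewrite -mulrDr -[leRHS]mulrA ler_wpM2l ?expR_ge0//.
  apply: (le_trans (cosh_le_gauss _)); rewrite mulrC.
  have -> : (k * (p1 - p0) / 2) ^+ 2 / 2 = k * (k * ((p1 - p0) ^+ 2 / 8)) by field.
  by [].
have := locally_midpoint_concave uv cg d0 mid t01.
rewrite !gE ?lexx ?uv//.
have t1 : 0 <= 1 - t by rewrite subr_ge0; case/andP: t01.
have uv0 : 0 <= v0 - u0 by rewrite subr_ge0.
have := mulr_ge0 (proj1 (andP t01)) uv0; have := mulr_ge0 t1 uv0; clear; lra.
Qed.

(** Apply the inner estimate on [s t, 1 - s (1 - t)] with tolerance s: this
    interval divides at t in the same ratio as [0, 1] does. Let s tend to 0. *)
Lemma tilted_log_concave l (c B : R) : 0 < c ->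
  (forall u v t, 0 <= u <= 1 -> 0 <= v <= 1 -> 0 <= t <= 1 ->
     t * l u + (1 - t) * l v <= l (t * u + (1 - t) * v)) ->
  (forall u, 0 <= u <= 1 -> l u <= B) ->
  (forall e : R, 0 < e < 1 -> exists2 a0, 0 < a0 &
     forall u v, 0 <= u <= 1 -> 0 <= v <= 1 -> `|l v - l u| <= a0 ->
     (l u + l v) / 2 + (1 - e) * (c * ((l v - l u) ^+ 2 / 8)) <= l ((u + v) / 2)) ->
  forall t, 0 <= t <= 1 ->
    t * expR (c * l 1) + (1 - t) * expR (c * l 0) <= expR (c * l t).
Proof.
move=> c0 conc lB loc t /andP[]; rewrite le_eqVlt => /predU1P[<- _|t0].
  by rewrite mul0r add0r subr0 mul1r.
rewrite le_eqVlt => /predU1P[->|t1]; first by rewrite subrr mul0r addr0 mul1r.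
have t01 : 0 <= t <= 1 by rewrite !ltW.
(* The values of l at the ends of [s t, 1 - s (1 - t)], bounded below by concavity. *)
pose F (s : R) := t * expR ((1 - s) * c * ((1 - s * (1 - t)) * l 1 + s * (1 - t) * l 0)) +
  (1 - t) * expR ((1 - s) * c * (s * t * l 1 + (1 - s * t) * l 0)).
pose G (s : R) := expR ((1 - s) * c * l t).
have FE : F 0 = t * expR (c * l 1) + (1 - t) * expR (c * l 0).
  by rewrite /F !mul0r !subr0 !mul1r addr0 add0r.
have GE : G 0 = expR (c * l t) by rewrite /G subr0 mul1r.
have ci : s @[s --> (0:R)] --> (0:R) by exact: cvg_id.
have cc (r : R) : r @[_ --> (0:R)] --> r by exact: cvg_cst.
have cexp (h : R -> R) : h s @[s --> (0:R)] --> h 0 ->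
    expR (h s) @[s --> (0:R)] --> expR (h 0).
  by move=> ch; apply: (continuous_cvg _ _ ch); exact: continuous_expR.
have c1 : ((1 - s) * c) @[s --> (0:R)] --> ((1 - 0) * c).
  by apply: cvgM; [apply: cvgB; [exact: cc|exact: ci]|exact: cc].
have c2 (r : R) : (s * r) @[s --> (0:R)] --> (0 * r).
  by apply: cvgM; [exact: ci|exact: cc].
have c3 (r : R) : (1 - s * r) @[s --> (0:R)] --> (1 - 0 * r).
  by apply: cvgB; [exact: cc|exact: c2].
have cG : G s @[s --> (0:R)^'+] --> G 0.
  apply: cvg_at_right_filter; apply: (cexp (fun s => (1 - s) * c * l t)).
  by apply: cvgM; [exact: c1|exact: cc].
have cF : F s @[s --> (0:R)^'+] --> F 0.
  apply: cvg_at_right_filter; apply: cvgD.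
    apply: cvgM; first exact: cc.
    apply: (cexp (fun s => (1 - s) * c * ((1 - s * (1 - t)) * l 1 + s * (1 - t) * l 0))).
    apply: cvgM; first exact: c1.
    by apply: cvgD; (apply: cvgM; [|exact: cc]); [exact: c3|exact: c2].
  apply: cvgM; first exact: cc.
  apply: (cexp (fun s => (1 - s) * c * (s * t * l 1 + (1 - s * t) * l 0))).
  apply: cvgM; first exact: c1.
  by apply: cvgD; (apply: cvgM; [|exact: cc]); [exact: c2|exact: c3].
rewrite -FE -GE; apply: (ler_cvg_to cF cG); near=> s.
have s0 : 0 < s by near: s; exact: nbhs_right_gt.
have s1 : s < 1 by near: s; exact: nbhs_right_lt.
have s01 : 0 < s < 1 by rewrite s0.
pose u0 := s * t; pose v0 := 1 - s * (1 - t).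
have u00 : 0 < u0 by exact: mulr_gt0.
have st : 0 < s * (1 - t) by rewrite mulr_gt0// subr_gt0.
have v01 : v0 < 1 by rewrite /v0; move: st; clear; lra.
have uv : u0 <= v0 by rewrite /u0 /v0; move: s1; clear; lra.
have := tilted_log_concave_inner c0 s01 u00 uv v01 conc lB (loc s s01) t01.
have -> : t * v0 + (1 - t) * u0 = t by rewrite /v0 /u0; ring.
rewrite -/(G s) => /(le_trans _); apply.
have i0 : 0 <= (0 : R) <= 1 by rewrite lexx ler01.
have i1 : 0 <= (1 : R) <= 1 by rewrite lexx ler01.
have iu : 0 <= u0 <= 1 by rewrite (ltW u00) (le_trans uv (ltW v01)).
have iv : 0 <= v0 <= 1 by rewrite (le_trans (ltW u00) uv) ltW.
have k0 : 0 <= (1 - s) * c by apply: mulr_ge0; [rewrite subr_ge0|]; exact: ltW.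
have hv := conc 1 0 v0 i1 i0 iv; have hu := conc 1 0 u0 i1 i0 iu.
rewrite mulr1 mulr0 addr0 in hv; rewrite mulr1 mulr0 addr0 in hu.
rewrite /F; apply: lerD; (apply: ler_wpM2l; [|rewrite ler_expR; apply: ler_wpM2l => //]).
- exact: ltW.
- by apply: le_trans hv; rewrite /v0; have -> : 1 - (1 - s * (1 - t)) = s * (1 - t) by ring.
- by rewrite subr_ge0 ltW.
Unshelve. all: by end_near. Qed.

End local_to_global.

(** * Minkowski combinations of convex bodies *)

Section convex_bodies.
Context {R : realType} {n : nat}.
Implicit Types (K L : set 'rV[R]_n) (x y : 'rV[R]_n).

Lemma convex_setP K : convex_set K <->
  forall x y (t : R), K x -> K y -> 0 <= t <= 1 -> K (t *: x + (1 - t) *: y).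
Proof.
split=> [cK x y t Kx Ky /andP[t0 t1]|cK x y t].
  by have := cK x y (Itv01 t0 t1); rewrite !inE; exact.
rewrite !inE => Kx Ky; apply: (cK x y t%:num) => //.
by apply/andP; split.
Qed.

Lemma convex_combine K x y (a b : R) : convex_set K -> K x -> K y -> 0 <= a -> 0 <= b ->
  exists2 z, K z & a *: x + b *: y = (a + b) *: z.
Proof.
move=> /convex_setP cK Kx Ky a0 b0.
have [ab|ab] := eqVneq (a + b) 0.
  exists x => //; move: ab => /eqP; rewrite paddr_eq0// => /andP[/eqP -> /eqP ->].
  by rewrite !scale0r !addr0 scale0r.
have ab0 : 0 < a + b by rewrite lt_neqAle eq_sym ab addr_ge0.
exists ((a / (a + b)) *: x + (1 - a / (a + b)) *: y).
  apply: cK => //; rewrite divr_ge0 ?(ltW ab0)//= ler_pdivrMr// mul1r lerDl//.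
rewrite scalerDr !scalerA; congr (_ *: _ + _ *: _).
- by rewrite mulrCA divff// mulr1.
- by field.
Qed.

Lemma compact_borelRV K : compact K -> measurable (K : set (borelRV R n)).
Proof. by move=> cK; apply: closed_borelRV; apply: compact_closed => //; exact: norm_hausdorff. Qed.

Lemma compact_in_cube K : compact K -> exists2 N, 0 <= N & in_cube (N : R) K.
Proof.
move=> /compact_bounded [N [_ NK]]; exists (`|N| + 1); first by rewrite addr_ge0.
move=> x Kx j; have := NK (`|N| + 1); rewrite ltr_pwDr ?ler_norm// => /(_ isT x Kx).
apply: le_trans; rewrite /Num.norm/= mx_normrE.
by apply: (le_trans _ (le_bigmax _ _ (ord0, j))).
Qed.

Lemma minkowski_comb_compact (l : R) K L : compact K -> compact L ->
  compact (minkowski_comb l K L).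
Proof.
move=> cK cL; apply: continuous_compact; last exact: compact_setX.
apply: continuous_subspaceT => z.
apply: cvgD; (apply: cvgZr_tmp || apply: cvgZr); [exact: cvg_fst|exact: cvg_snd].
Qed.

Lemma minkowski_comb_convex (l u v t : R) K L x y : convex_set K -> convex_set L ->
  0 <= u <= 1 -> 0 <= v <= 1 -> 0 <= t <= 1 ->
  minkowski_comb u K L x -> minkowski_comb v K L y ->
  minkowski_comb (t * u + (1 - t) * v) K L (t *: x + (1 - t) *: y).
Proof.
move=> cK cL /andP[u0 u1] /andP[v0 v1] /andP[t0 t1] [[k1 l1] [/= Kk1 Ll1] <-] [[k2 l2] [/= Kk2 Ll2] <-].
have t1' : 0 <= 1 - t by rewrite subr_ge0.
have u1' : 0 <= 1 - u by rewrite subr_ge0.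
have v1' : 0 <= 1 - v by rewrite subr_ge0.
have [k Kk kE] := convex_combine cK Kk1 Kk2 (mulr_ge0 t0 u0) (mulr_ge0 t1' v0).
have [m Lm mE] := convex_combine cL Ll1 Ll2 (mulr_ge0 t0 u1') (mulr_ge0 t1' v1').
exists (k, m) => //=; rewrite -kE.
have -> : 1 - (t * u + (1 - t) * v) = t * (1 - u) + (1 - t) * (1 - v) by ring.
by rewrite -mE !scalerDr !scalerA addrACA.
Qed.

Lemma minkowski_comb0 K L : K !=set0 -> minkowski_comb 0 K L = L.
Proof.
move=> [k Kk]; apply/seteqP; split=> [_ [[a b] [/= _ Lb] <-]|x Lx].
  by rewrite subr0 scale0r scale1r add0r.
by exists (k, x) => //=; rewrite subr0 scale0r scale1r add0r.
Qed.

Lemma minkowski_comb1 K L : L !=set0 -> minkowski_comb 1 K L = K.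
Proof.
move=> [k Kk]; apply/seteqP; split=> [_ [[a b] [/= La _] <-]|x Lx].
  by rewrite subrr scale0r scale1r addr0.
by exists (x, k) => //=; rewrite subrr scale0r scale1r addr0.
Qed.

Lemma minkowski_comb_body (l : R) K L : 0 <= l <= 1 ->
  convex_body K -> convex_body L -> convex_body (minkowski_comb l K L).
Proof.
move=> l01 [kK cK [c iK]] [kL cL [d iL]].
split; first exact: minkowski_comb_compact.
  apply/convex_setP => x y t Mx My t01.
  have := minkowski_comb_convex l cK cL l01 l01 t01 Mx My.
  by rewrite (_ : t * l + (1 - t) * l = l)//; ring.
have Kc : K c by exact: interior_subset iK.
have Ld : L d by exact: interior_subset iL.
have [l0|l0] := eqVneq l 0.
  by exists d; rewrite l0 minkowski_comb0//; exists c.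
have {}l0 : 0 < l by rewrite lt_neqAle eq_sym l0; case/andP: l01.
exists (l *: c + (1 - l) *: d).
move: iK => /nbhs_ballP[e /= e0 eK]; apply/nbhs_ballP; exists (l * e) => /=.
  exact: mulr_gt0.
move=> y By; exists (l^-1 *: (y - (1 - l) *: d), d) => /=; last first.
  by rewrite scalerA mulfV ?gt_eqF// scale1r subrK.
split=> //; apply: eK; move: By; rewrite -!ball_normE /= => By.
rewrite -(ltr_pM2l l0); apply: le_lt_trans By.
rewrite -[X in X * _](gtr0_norm l0) -normrZ scalerBr scalerA mulfV ?gt_eqF// scale1r.
by rewrite opprB addrA.
Qed.

Lemma minkowski_comb_in_cube (N l : R) K L : 0 <= l <= 1 ->
  in_cube N K -> in_cube N L -> in_cube N (minkowski_comb l K L).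
Proof.
move=> /andP[l0 l1] KN LN _ [[a b] [/= Ka Lb] <-] j; rewrite !mxE.
have l1' : 0 <= 1 - l by rewrite subr_ge0.
apply: (le_trans (ler_normD _ _)); rewrite !normrM (ger0_norm l0) (ger0_norm l1').
have := ler_wpM2l l0 (KN a Ka j); have := ler_wpM2l l1' (LN b Lb j); clear; lra.
Qed.

End convex_bodies.

Section mass_of_bodies.
Context {R : realType}.
Local Notation mu := (@lebesgue_measure R).

Lemma lebesgue_rV_cube_gt0 n (c : 'rV[R]_n) (r : R) : 0 < r ->
  measurable ([set x : 'rV[R]_n | forall j, `|x 0 j - c 0 j| < r] : set (borelRV R n)) /\
  (0 < lebesgue_rV n [set x : 'rV[R]_n | (forall j, `|x 0 j - c 0 j| < r)%R])%E.
Proof.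
move=> r0; elim: n c => [|n IH] c.
  rewrite (_ : [set x | _] = setT); last by apply/seteqP; split => // x _ [].
  by split; [exact: measurableT|rewrite /= diracT lte01].
have [mC C0] := IH (rsubmx (c : 'rV[R]_(1 + n))).
set A := [set x : R | `|x - (c : 'rV[R]_n.+1) 0 0| < r].
have AE : A = `](c 0 0 - r), (c 0 0 + r)[%classic.
  by apply/seteqP; split => x; rewrite /A/= in_itv/= ltr_distl.
have mA : measurable (A : set (measurableTypeR R)) by rewrite AE; exact: measurable_itv.
set B := [set x : 'rV[R]_n | _] in mC C0.
have -> : [set x : 'rV[R]_n.+1 | forall j, `|x 0 j - c 0 j| < r] =
    @rV_head R n @^-1` A `&` @rV_tail R n @^-1` B.
  apply/seteqP; split => [x /= h|x [/= h0 h1] j].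
    split; first exact: h.
    by move=> j; rewrite /rV_tail !mxE; exact: h.
  case: (split_ordP (j : 'I_(1 + n))) => k ->.
    by have -> : lshift n k = 0 by rewrite (ord1 k); exact/val_inj.
  by have := h1 k; rewrite /rV_tail !mxE.
split.
  apply: measurableI; rewrite -[X in measurable X]setTI.
    exact: measurable_rV_head.
  exact: measurable_rV_tail.
rewrite lebesgue_rVS// mule_gt0// AE lebesgue_measure_itv/= lte_fin.
by rewrite ifT ?lte_fin ?subr_gt0; move: r0; clear; lra.
Qed.

(** A body contains a cube, on which the density is bounded below. *)
Lemma mass_body n (p : R) (K : set 'rV[R]_n) : 1 <= p -> convex_body K ->
  exists2 a : R, 0 < a & mass p K = a%:E.
Proof.
move=> p1 [kK _ [c /nbhs_ballP[r /= r0 rK]]].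
have [N N0 KN] := compact_in_cube kK.
have mK := compact_borelRV kK.
have mass_lt : (mass p K < +oo)%E by apply: (le_lt_trans (mass_le_cube p1 N0 mK KN)); rewrite ltry.
have mass0 : (0 < mass p K)%E.
  have [mB B0] := lebesgue_rV_cube_gt0 c r0.
  set B := [set x : 'rV[R]_n | _] in mB B0.
  have BK : B `<=` K.
    move=> x Bx; apply: rK; split => // i j; rewrite (ord1 i) /ball/= distrC; exact: Bx.
  pose M := \sum_(i < n) N ^+ 2.
  have M0 : 0 <= M by apply: sumr_ge0 => i _; exact: sqr_ge0.
  pose e := expR (- ((Num.sqrt M) `^ p / p)).
  have p0 : 0 < p by exact: lt_le_trans ltr01 p1.
  have md := @measurable_density R n p.
  apply: (@lt_le_trans _ _ (e%:E * lebesgue_rV n B)%E).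
    by rewrite mule_gt0// lte_fin expR_gt0.
  apply: (@le_trans _ _ (mass p B)); last first.
    apply: ge0_subset_integral => //.
    by apply/measurable_EFinP; exact: measurable_funTS.
  have le x : B x -> e <= expR (- potential p x).
    move=> Bx; rewrite ler_expR lerN2 ler_wpM2r ?invr_ge0 ?(ltW p0)//.
    apply: ge0_ler_powR; rewrite ?nnegrE ?(ltW p0) ?enorm_ge0 ?sqrtr_ge0//.
    rewrite ler_wsqrtr// ler_sum// => i _.
    rewrite -(real_normK (num_real _)) ler_sqr ?nnegrE//.
    exact: KN (BK _ Bx) i.
  have e0 : 0 <= e by exact: expR_ge0.
  clearbody e; have <- := @integral_cst _ _ _ (lebesgue_rV n) B mB e%:E.
  apply: ge0_le_integral => //.
  - by apply/measurable_EFinP; exact: measurable_funTS.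
exists (fine (mass p K)); first by rewrite fine_gt0// mass0.
by rewrite fineK// ge0_fin_numE// mass_ge0.
Qed.

End mass_of_bodies.

(** * The lower bound for masses *)

Lemma mass_local_expR (R : realType) (n : nat) (p e N : R) (A B C : set (borelRV R n)) :
  1 < p -> (0 < n)%N -> 0 < e < 1 -> 0 <= N ->
  measurable A -> measurable B -> measurable C -> in_cube N A -> in_cube N B ->
  (forall x y : 'rV[R]_n, A x -> B y -> C (2^-1 *: x + (1 - 2^-1) *: y)) ->
  forall a b : R, mass p A = (expR a)%:E -> mass p B = (expR b)%:E ->
  `|b - a| <= e ^+ 2 ->
  ((expR ((a + b) / 2))%:E <=
  \int[lebesgue_rV n]_(z in C) (expR (- potential p (z : 'rV[R]_n) -
     (1 - e) ^+ 2 * ((b - a) ^+ 2 / 8) * curvature p (z : 'rV[R]_n)))%:E)%E.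
Proof.
move=> p1 n0 e01 N0 mA mB mC AN BN ABC a b Aa Bb ab.
have := mass_local p1 n0 e01 N0 mA mB mC AN BN ABC (expR_gt0 a) (expR_gt0 b) Aa Bb.
by rewrite (expRK a) (expRK b); apply.
Qed.

Section lower_bound.
Context {R : realType} {n : nat}.
Variables (p : R) (K L : set 'rV[R]_n).
Hypotheses (p1 : 1 <= p) (bK : convex_body K) (bL : convex_body L).

Definition log_mass (u : R) : R := ln (fine (mass p (minkowski_comb u K L))).

Lemma mass_comb u : 0 <= u <= 1 -> mass p (minkowski_comb u K L) = (expR (log_mass u))%:E.
Proof.
move=> u01; have [a a0 aE] := mass_body p1 (minkowski_comb_body u01 bK bL).
by rewrite /log_mass aE/= lnK// posrE.
Qed.

Lemma comb_common_cube : exists2 N : R, 0 <= N &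
  forall u, 0 <= u <= 1 -> in_cube N (minkowski_comb u K L).
Proof.
case: (bK) => kK _ _; case: (bL) => kL _ _.
have [N1 N10 KN] := compact_in_cube kK; have [N2 N20 LN] := compact_in_cube kL.
exists (Num.max N1 N2); first by rewrite le_max N10.
move=> u u01; apply: minkowski_comb_in_cube => // x.
- by move=> /KN h j; rewrite le_max h.
- by move=> /LN h j; rewrite le_max h orbT.
Qed.

Lemma comb_measurable u : measurable (minkowski_comb u K L : set (borelRV R n)).
Proof.
case: (bK) => kK _ _; case: (bL) => kL _ _.
by apply: compact_borelRV; exact: minkowski_comb_compact.
Qed.

Lemma log_mass_le : exists B : R, forall u, 0 <= u <= 1 -> log_mass u <= B.
Proof.
have [N N0 cubeN] := comb_common_cube.
exists (ln ((2 * N) ^+ n)) => u u01.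
have := mass_le_cube p1 N0 (comb_measurable u) (cubeN u u01).
rewrite mass_comb// lee_fin => h.
by rewrite -[leLHS]expRK ler_ln ?posrE ?expR_gt0// (lt_le_trans _ h)// expR_gt0.
Qed.

Lemma comb_inclusion (t u v : R) (x y : 'rV[R]_n) : 0 <= u <= 1 -> 0 <= v <= 1 -> 0 <= t <= 1 ->
  minkowski_comb u K L x -> minkowski_comb v K L y ->
  minkowski_comb (t * u + (1 - t) * v) K L (t *: x + (1 - t) *: y).
Proof.
by case: (bK) => _ cK _; case: (bL) => _ cL _; exact: minkowski_comb_convex.
Qed.

Lemma log_mass_concave (u v t : R) : 0 <= u <= 1 -> 0 <= v <= 1 -> 0 <= t <= 1 ->
  t * log_mass u + (1 - t) * log_mass v <= log_mass (t * u + (1 - t) * v).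
Proof.
move=> u01 v01 /andP[]; rewrite le_eqVlt => /predU1P[<- _|t0].
  by rewrite !mul0r !add0r !subr0 !mul1r.
rewrite le_eqVlt => /predU1P[->|t1]; first by rewrite subrr !mul0r !addr0 !mul1r.
have t01 : 0 < t < 1 by rewrite t0.
have t01' : 0 <= t <= 1 by rewrite !ltW.
have [N N0 cubeN] := comb_common_cube.
have := mass_log_concave p1 t01 N0 (comb_measurable u) (comb_measurable v)
  (comb_measurable (t * u + (1 - t) * v)) (cubeN u u01) (cubeN v v01)
  (fun x y hx hy => comb_inclusion u01 v01 t01' hx hy)
  (expR_gt0 _) (expR_gt0 _) (mass_comb u01) (mass_comb v01).
rewrite geometric_mean_expR mass_comb ?lee_fin ?ler_expR//.
case/andP: u01 => u0 u1; case/andP: v01 => v0 v1.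
have t1' : 0 <= 1 - t by rewrite subr_ge0 ltW.
apply/andP; split; first by apply: addr_ge0; apply: mulr_ge0 => //; exact: ltW.
have := ler_wpM2l (ltW t0) u1; have := ler_wpM2l t1' v1; lra.
Qed.

(** Since e^(-z) <= 1 / (1 + z), replacing the exponential by its tangent costs a
    factor 1 - k for z at most k. *)
Lemma expR_tilt (k d y : R) : 0 < k < 1 -> 0 <= d <= k -> 0 <= y <= 1 ->
  expR (- (d * y)) + (1 - k) * d * y <= 1.
Proof.
move=> /andP[k0 k1] /andP[d0 dk] /andP[y0 y1].
have z0 : 0 <= d * y by exact: mulr_ge0.
have zk : d * y <= k by apply: le_trans dk; rewrite ler_piMr.
set z := d * y in z0 zk *.
have -> : (1 - k) * d * y = (1 - k) * z by rewrite /z; ring.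
have h : expR (- z) <= (1 + z)^-1.
  rewrite expRN lef_pV2 ?posrE ?expR_gt0 ?ltr_wpDr//; exact: expR_ge1Dx.
have z1 : 0 < 1 + z by rewrite ltr_wpDr.
suff : (1 + z)^-1 <= 1 - (1 - k) * z by move: h; lra.
rewrite -[leLHS]mul1r ler_pdivrMr//.
have : 0 <= z * (k - z) + k * z ^+ 2.
  by apply: addr_ge0; apply: mulr_ge0; rewrite ?subr_ge0 ?sqr_ge0 ?(ltW k0).
lra.
Qed.

Hypotheses (n0 : (0 < n)%N) (K0 : K 0) (L0 : L 0).

(** Linearize the exponential in mass_local; star_average bounds the resulting
    average of the curvature by the constant. *)
Lemma log_mass_local (e : R) : 1 < p -> 0 < bm_lower_expr n p -> 0 < e < 1 ->
  exists2 a0, 0 < a0 & forall u v, 0 <= u <= 1 -> 0 <= v <= 1 ->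
     `|log_mass v - log_mass u| <= a0 ->
     (log_mass u + log_mass v) / 2 +
       (1 - e) * (bm_lower_expr n p * ((log_mass v - log_mass u) ^+ 2 / 8)) <=
     log_mass ((u + v) / 2).
Proof.
move=> p1' c0 /andP[e0 e1].
(* Three factors 1 - k are lost, and (1 - e / 3)^3 >= 1 - e. *)
pose k := e / 3; have k0 : 0 < k by rewrite divr_gt0.
have k1 : k < 1 by rewrite /k; lra.
have k01 : 0 < k < 1 by rewrite k0.
exists (k ^+ 2); first by rewrite exprn_gt0.
move=> u v u01 v01 dk.
have [N N0 cubeN] := comb_common_cube.
have h01 : 0 <= (2^-1 : R) <= 1 by rewrite invr_ge0 ler0n invf_le1// ler1n.
have w01 : 0 <= (u + v) / 2 <= 1 by move: u01 v01; lra.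
have wE : 2^-1 * u + (1 - 2^-1) * v = (u + v) / 2 by field.
set w := (u + v) / 2 in w01 wE *.
have incl (x y : 'rV[R]_n) : minkowski_comb u K L x -> minkowski_comb v K L y ->
    minkowski_comb w K L (2^-1 *: x + (1 - 2^-1) *: y).
  by rewrite -wE; exact: comb_inclusion.
have mC := comb_measurable w.
set C := minkowski_comb w K L in incl mC *.
have := mass_local_expR p1' n0 k01 N0 (comb_measurable u) (comb_measurable v) mC
  (cubeN u u01) (cubeN v v01) incl (mass_comb u01) (mass_comb v01) dk.
set lu := log_mass u in dk *; set lv := log_mass v in dk *.
set dd := (lv - lu) ^+ 2 / 8.
set D := (1 - k) ^+ 2 * dd.
have dd0 : 0 <= dd by rewrite divr_ge0 ?sqr_ge0.
have D0 : 0 <= D by rewrite mulr_ge0 ?sqr_ge0.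
have ddk : dd <= k.
  have : (lv - lu) ^+ 2 <= k.
    rewrite -real_normK ?num_real//; apply: (@le_trans _ _ (k ^+ 2 * 1)).
      rewrite expr2; apply: ler_pM => //; apply: (le_trans dk).
      by rewrite expr_le1 ?(ltW k0) ?(ltW k1).
    by rewrite mulr1 expr2 ler_piMl ?(ltW k0) ?(ltW k1).
  by rewrite /dd; move: k0; lra.
have Dk : D <= k.
  apply: le_trans ddk; rewrite /D ler_piMl//.
  by rewrite expr_le1 ?subr_ge0 ?(ltW k1)//; move: k0; lra.
move=> H.
have star : forall (x : 'rV[R]_n) (t : R), C x -> 0 <= t <= 1 -> C (t *: x).
  move=> x t Cx t01.
  have [_ /convex_setP cC _] := minkowski_comb_body w01 bK bL.
  have C0 : C 0 by exists (0, 0) => //=; rewrite !scaler0 addr0.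
  by have := cC x 0 t Cx C0 t01; rewrite scaler0 addr0.
pose d (z : borelRV R n) : R := expR (- potential p (z : 'rV[R]_n)).
pose cv (z : borelRV R n) : R := curvature p (z : 'rV[R]_n).
have md : measurable_fun setT d by exact: measurable_density.
have mcv : measurable_fun setT (cv : borelRV R n -> R) by exact: measurable_curvature.
have cv01 z : 0 <= cv z <= 1.
  have den : 1 <= n%:R + potential p (z : 'rV[R]_n) / (1 - p^-1).
    rewrite -[leLHS]addr0; apply: lerD; first by rewrite ler1n.
    rewrite divr_ge0 ?potential_ge0// subr_ge0 invf_le1//.
    exact: lt_trans p1'.
  rewrite /cv /curvature invr_ge0 (le_trans ler01 den)/= invf_le1//.
  exact: lt_le_trans den.
have d0 z : 0 <= d z by exact: expR_ge0.
pose m := fine (mass p C).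
have mE : mass p C = m%:E by rewrite /m mass_comb.
have m0 : 0 < m by rewrite /m mass_comb//= expR_gt0.
have avg : ((bm_lower_expr n p * m)%:E <= \int[lebesgue_rV n]_(z in C) (cv z * d z)%:E)%E.
  apply: le_trans (star_average n0 p1' mC star).
  rewrite EFinM -mE /mass -ge0_integralZl ?lee_fin ?(ltW c0)//.
  by apply/measurable_EFinP; exact: measurable_funTS.
have kD0 : 0 <= (1 - k) * D by apply: mulr_ge0 => //; rewrite subr_ge0 ltW.
have sum : ((expR ((lu + lv) / 2))%:E + ((1 - k) * D)%:E * (bm_lower_expr n p * m)%:E <= m%:E)%E.
  apply: (le_trans (leeD H (lee_wpmul2l _ avg))); first by rewrite lee_fin.
  have mdE : measurable_fun (C : set (borelRV R n)) (fun z => (cv z * d z)%:E).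
    by apply/measurable_EFinP; apply: measurable_funTS; exact: measurable_funM.
  rewrite -ge0_integralZl//; last by move=> z _; rewrite lee_fin; apply: mulr_ge0 => //; case/andP: (cv01 z).
  pose q (z : borelRV R n) : \bar R := (expR (- potential p (z : 'rV[R]_n) - D * cv z))%:E.
  have q0 z : C z -> (0 <= q z)%E by move=> _; rewrite lee_fin expR_ge0.
  have mq : measurable_fun (C : set (borelRV R n)) q.
    apply/measurable_EFinP; apply: measurable_funTS; apply: measurableT_comp => //.
    apply: measurable_funB; first by apply: measurable_funN; exact: measurable_potential.
    exact: measurable_funM.
  pose r (z : borelRV R n) : \bar R := (((1 - k) * D)%:E * (cv z * d z)%:E)%E.
  have r0 z : C z -> (0 <= r z)%E.
    move=> _; rewrite /r -EFinM lee_fin; apply: mulr_ge0 => //; apply: mulr_ge0 => //.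
    by case/andP: (cv01 z).
  have mr : measurable_fun (C : set (borelRV R n)) r by exact: measurable_funeM.
  rewrite -(ge0_integralD _ mC q0 mq r0 mr) -mE /mass.
  apply: ge0_le_integral; first exact: mC.
  - by move=> z Cz; apply: adde_ge0; [exact: q0|exact: r0].
  - exact: emeasurable_funD.
  - by apply/measurable_EFinP; exact: measurable_funTS.
  move=> z _; rewrite /q /r -EFinM -EFinD lee_fin -/(d z).
  have -> : expR (- potential p (z : 'rV[R]_n) - D * cv z) = expR (- (D * cv z)) * d z.
    by rewrite addrC expRD.
  have Dk2 : 0 <= D <= k by rewrite D0.
  have := expR_tilt k01 Dk2 (cv01 z).
  move=> /(ler_wpM2r (d0 z)).
  by rewrite mul1r; congr (_ <= _); ring.
move: sum; rewrite -EFinM -EFinD lee_fin => sum.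
have lwE : log_mass w = ln m by [].
have c1 : (1 - e) * (bm_lower_expr n p * dd) <= (1 - k) * D * bm_lower_expr n p.
  have -> : (1 - k) * D * bm_lower_expr n p = (1 - k) ^+ 3 * (bm_lower_expr n p * dd).
    by rewrite /D; ring.
  apply: ler_wpM2r; first by apply: mulr_ge0 => //; exact: ltW.
  have : 0 <= k ^+ 2 * (3 - k).
    by apply: mulr_ge0; [exact: sqr_ge0|rewrite subr_ge0; lra].
  have -> : e = 3 * k by rewrite /k; field.
  by lra.
apply: (le_trans (lerD (lexx _) c1)); rewrite lwE -ler_expR lnK ?posrE//.
rewrite expRD; set X := (1 - k) * D * bm_lower_expr n p in sum *.
have sum' : expR ((lu + lv) / 2) <= m * (1 - X).
  move: sum; rewrite /X => sum; move: sum; set E := expR _; lra.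
apply: (@le_trans _ _ (m * (1 - X) * expR X)); first by rewrite ler_wpM2r ?expR_ge0.
rewrite -mulrA ler_piMr ?(ltW m0)//.
have := expR_ge1Dx (- X); rewrite expRN => h.
rewrite -ler_pdivlMr ?expR_gt0// mul1r; apply: le_trans h; by [].
Qed.

Lemma mass_brunn_minkowski (t : R) : 1 < p -> 0 < bm_lower_expr n p -> 0 <= t <= 1 ->
  t * expR (bm_lower_expr n p * log_mass 1) + (1 - t) * expR (bm_lower_expr n p * log_mass 0) <=
  expR (bm_lower_expr n p * log_mass t).
Proof.
move=> p1' c0 t01; have [B HB] := log_mass_le.
apply: (tilted_log_concave c0 _ HB _ t01) => [u v s|e].
- exact: log_mass_concave.
- exact: log_mass_local.
Qed.

End lower_bound.

(** * The set of admissible exponents *)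

Section gaussian_exponents.
Context {R : realType} {n : nat}.
Variable p : R.
Hypotheses (n0 : (0 < n)%N) (p1 : 1 <= p).

Lemma gen_gauss_cst_gt0 : 0 < gen_gauss_cst n p.
Proof.
have N0 : 0 < n%:R :> R by rewrite ltr0n.
have p0 : 0 < p by exact: lt_le_trans p1.
rewrite /gen_gauss_cst divr_gt0 ?Gamma_gt0 ?divr_gt0//.
by rewrite !mulr_gt0 ?powR_gt0 ?pi_gt0 ?Gamma_gt0 ?divr_gt0.
Qed.

Lemma gen_gaussE (A : set (borelRV R n)) : measurable A ->
  (gen_gauss p A = (gen_gauss_cst n p)%:E * mass p A)%E.
Proof.
move=> mA; rewrite /gen_gauss /mass -ge0_integralZl//.
- by apply/measurable_EFinP; apply: measurable_funTS; exact: measurable_density.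
- by rewrite lee_fin ltW // gen_gauss_cst_gt0.
Qed.

Lemma gen_gauss_comb (K L : set 'rV[R]_n) (u : R) :
  convex_body K -> convex_body L -> 0 <= u <= 1 ->
  gen_gauss p (minkowski_comb u K L) =
  (expR (ln (gen_gauss_cst n p) + log_mass p K L u))%:E.
Proof.
move=> bK bL u01; rewrite gen_gaussE; last exact: comb_measurable.
by rewrite mass_comb// expRD lnK// posrE gen_gauss_cst_gt0.
Qed.

(** The normalizing constant to the power a is a common factor of both sides. *)
Lemma brunn_minkowski_log_mass (K L : set 'rV[R]_n) (a t : R) :
  convex_body K -> convex_body L -> 0 <= t <= 1 ->
  brunn_minkowski (gen_gauss p) a t K L <->
  if a == 0 then t * log_mass p K L 1 + (1 - t) * log_mass p K L 0 <= log_mass p K L t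
  else t * expR (a * log_mass p K L 1) + (1 - t) * expR (a * log_mass p K L 0) <=
       expR (a * log_mass p K L t).
Proof.
move=> bK bL t01; set l := log_mass p K L.
have K0 : K !=set0 by case: bK => _ _ [x /interior_subset]; exists x.
have L0 : L !=set0 by case: bL => _ _ [x /interior_subset]; exists x.
have i0 : 0 <= (0 : R) <= 1 by rewrite lexx ler01.
have i1 : 0 <= (1 : R) <= 1 by rewrite lexx ler01.
pose g := ln (gen_gauss_cst n p).
have gK : gen_gauss p K = (expR (g + l 1))%:E.
  by rewrite -(gen_gauss_comb bK bL i1) minkowski_comb1.
have gL : gen_gauss p L = (expR (g + l 0))%:E.
  by rewrite -(gen_gauss_comb bK bL i0) minkowski_comb0.
have gM := gen_gauss_comb bK bL t01.
rewrite -/g -/(l t) in gM.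
have powE (x r : R) : ((expR x)%:E `^ r)%E = (expR (r * x))%:E.
  by rewrite poweR_EFin -expRM mulrC.
rewrite /brunn_minkowski; clearbody g.
move: (l 1) (l 0) (l t) gK gL gM => x y z -> -> ->; case: ifP => a0.
  rewrite (powE (g + x) t) (powE (g + y) (1 - t)).
  rewrite -EFinM lee_fin -expRD ler_expR.
  by rewrite (_ : t * (g + x) + _ = g + (t * x + (1 - t) * y)) ?lerD2l//; ring.
rewrite (powE (g + x) a) (powE (g + y) a) (powE (g + z) a) -!EFinM -EFinD lee_fin.
rewrite !(mulrDr a) (expRD _ (a * x)) (expRD _ (a * y)) (expRD _ (a * z)).
have e0 : 0 < expR (a * g) by exact: expR_gt0.
rewrite -[X in _ <-> is_true X](ler_pM2l e0).
by have -> : expR (a * g) * (t * expR (a * x) + (1 - t) * expR (a * y)) =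
  t * (expR (a * g) * expR (a * x)) + (1 - t) * (expR (a * g) * expR (a * y)) by ring.
Qed.

Lemma bm_exponents_lower_expr : 1 < p -> bm_exponents n p (bm_lower_expr n p) /\ 0 < bm_lower_expr n p.
Proof.
move=> p1'; have p0 : 0 < p by exact: lt_trans p1'.
have N0 : 0 < n%:R :> R by rewrite ltr0n.
have c0 : 0 < bm_lower_expr n p.
  rewrite bm_lower_exprE mulr_gt0 ?invr_gt0// stieltjes_gt0 ?divr_gt0//.
  by rewrite mulr_gt0// subr_gt0.
split=> // K L t bK bL K0 L0 t01.
apply/brunn_minkowski_log_mass => //; rewrite gt_eqF//.
exact: mass_brunn_minkowski.
Qed.

Lemma bm_exponents0 : bm_exponents n p 0.
Proof.
move=> K L t bK bL K0 L0 t01.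
apply/brunn_minkowski_log_mass => //; rewrite eqxx.
have i0 : 0 <= (0 : R) <= 1 by rewrite lexx ler01.
have i1 : 0 <= (1 : R) <= 1 by rewrite lexx ler01.
have := log_mass_concave p1 bK bL i1 i0 t01.
by rewrite mulr1 mulr0 addr0.
Qed.

(** For fixed bodies both sides depend continuously on the exponent; the case of
    the exponent 0, where the inequality changes its form, stays away. *)
Lemma bm_exponents_limit (a : R) : 0 < a ->
  (forall d, 0 < d -> exists2 b, a - d < b <= a & bm_exponents n p b) -> bm_exponents n p a.
Proof.
move=> a0 lim_a K L t bK bL K0 L0 t01.
apply/brunn_minkowski_log_mass => //; rewrite gt_eqF//.
have := fun b => @brunn_minkowski_log_mass K L b t bK bL t01.
set x := log_mass p K L 1; set y := log_mass p K L 0; set z := log_mass p K L t => bmE.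
pose F (s : R) := expR (s * z) - (t * expR (s * x) + (1 - t) * expR (s * y)).
have cE (w : R) : continuous (fun s : R => expR (s * w)).
  move=> s; apply: (@continuous_comp _ _ _ (fun s : R => s * w) expR); last exact: continuous_expR.
  by apply: cvgM; [exact: cvg_id|exact: cvg_cst].
have cF : F s @[s --> a] --> F a.
  apply: cvgB; first exact: cE.
  by apply: cvgD; apply: cvgM; [exact: cvg_cst|exact: cE|exact: cvg_cst|exact: cE].
suff : 0 <= F a by rewrite subr_ge0.
rewrite leNgt; apply/negP => Fa.
have /nbhs_ballP[d /= d0 dF] : \forall s \near a, F s < 0.
  apply: (cvgr_lt _ cF); exact: Fa.
have [b /andP[b1 b2] Ab] := lim_a (Num.min d a) ltac:(by rewrite lt_min d0 a0).
have b0 : 0 < b by apply: le_lt_trans b1; rewrite subr_ge0 ge_min lexx orbT.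
have bd : ball a d b.
  rewrite /ball/= ger0_norm ?subr_ge0//.
  have : Num.min d a <= d by rewrite ge_min lexx.
  by move: b1; set m := Num.min d a; lra.
have := dF b bd; apply/negP; rewrite -leNgt subr_ge0.
by have /bmE := Ab K L t bK bL K0 L0 t01; rewrite gt_eqF.
Qed.

(** The supremum either equals c or is a positive limit of admissible exponents. *)
Lemma bm_exponents_largest (c U : R) : bm_exponents n p c -> 0 <= c ->
  (forall a, 0 < a -> bm_exponents n p a -> a <= U) -> c <= U ->
  exists a, is_largest (bm_exponents n p) a /\ c <= a /\ a <= U.
Proof.
move=> Ac c0 leU cU.
have ubU : ubound (bm_exponents n p) U.
  move=> a Aa; have [a0|a0] := ltP 0 a; first exact: leU.
  exact: le_trans (le_trans a0 c0) cU.
have hs : has_sup (bm_exponents n p) by split; [exists c|exists U].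
pose s := sup (bm_exponents n p).
have ubs : ubound (bm_exponents n p) s by exact: sup_upper_bound.
have cs : c <= s by exact: ubs.
have sU : s <= U by apply: ge_sup => //; exists c.
exists s; do !split=> //.
have [cs'|sc] := ltP c s; last by have -> : s = c by apply/eqP; rewrite eq_le sc cs.
apply: bm_exponents_limit; first exact: le_lt_trans cs'.
move=> d d0; have [b Ab bs] := sup_adherent d0 hs.
by exists b => //; rewrite bs; exact: ubs.
Qed.

End gaussian_exponents.

Lemma bm_lowerP (R : realType) (n : nat) (p : R) : (2 <= n)%N -> 1 <= p ->
  bm_exponents n p (bm_lower n p) /\ 0 <= bm_lower n p.
Proof.
move=> n2 p1; have n0 : (0 < n)%N by exact: leq_trans n2.
rewrite /bm_lower; case: eqVneq => [->|p1'].
  by rewrite (cvg_lim _ (bm_lower_expr_cvg0 n2))//; split=> //; exact: bm_exponents0.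
have p1'' : 1 < p by rewrite lt_neqAle eq_sym p1'.
by have [? /ltW] := bm_exponents_lower_expr n0 p1 p1''.
Qed.

(** * Cones along the first axis *)

Section closed_conditions.
Context {R : realType} {T : topologicalType}.
Implicit Types f g : T -> R.

Lemma closed_le_continuous f g : continuous f -> continuous g ->
  closed [set x | f x <= g x].
Proof.
move=> cf cg.
have cfg : continuous (fun x => f x - g x).
  by move=> x; apply: continuousB; [exact: cf|exact: cg].
have := (continuous_closedP _).1 cfg _ (@closed_le R 0).
by congr closed; apply/seteqP; split => x /=; rewrite subr_le0.
Qed.

Lemma continuous_mul_add f (a b : R) : continuous f -> continuous (fun x => a * (f x + b)).
Proof.
move=> cf x; apply: cvgM; first exact: cvg_cst.
by apply: cvgD; [exact: cf|exact: cvg_cst].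
Qed.

Lemma continuous_normr f : continuous f -> continuous (fun x => `|f x|).
Proof. by move=> cf x; apply: cvg_norm; exact: cf. Qed.

End closed_conditions.

Section cones.
Context {R : realType} {m : nat}.
Implicit Types (x y : 'rV[R]_m.+1) (e h t l : R).

(** The cone with apex - t on the first axis, with sections that are cubes so that
    their volume is elementary. *)
Definition cone (h e t : R) : set 'rV[R]_m.+1 :=
  [set x | - t <= rV_head x <= h /\
           forall j, `|(rV_tail x : 'rV[R]_m) 0 j| <= e * (rV_head x + t)].

Lemma continuous_rV_head : continuous (fun x : 'rV[R]_m.+1 => rV_head x : R).
Proof. by move=> x; exact: coord_continuous. Qed.

Lemma continuous_rV_tail j : continuous (fun x : 'rV[R]_m.+1 => (rV_tail x : 'rV[R]_m) 0 j).
Proof.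
rewrite (_ : (fun x => _) = fun x : 'rV[R]_m.+1 => (x : 'rV[R]_(1 + m)) 0 (rshift 1 j)).
  by move=> x; exact: coord_continuous.
by apply/funext => x; rewrite /rV_tail mxE.
Qed.

Lemma rV_head_comb (a b : R) x y :
  rV_head (a *: x + b *: y) = a * (rV_head x : R) + b * (rV_head y : R) :> R.
Proof. by rewrite /rV_head !mxE. Qed.

Lemma rV_tail_comb (a b : R) x y j :
  (rV_tail (a *: x + b *: y) : 'rV[R]_m) 0 j =
  a * (rV_tail x : 'rV[R]_m) 0 j + b * (rV_tail y : 'rV[R]_m) 0 j.
Proof. by rewrite /rV_tail !mxE. Qed.

Lemma cone_in_cube h e t : 0 <= e -> 0 <= t -> 0 <= h -> in_cube (h + t + e * (h + t)) (cone h e t).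
Proof.
move=> e0 t0 h0 x [/andP[x1 x2] xj] j.
have ht : 0 <= h + t by exact: addr_ge0.
have eht : 0 <= e * (h + t) by exact: mulr_ge0.
case: (split_ordP (j : 'I_(1 + m))) => k ->.
  have -> : lshift m k = 0 by rewrite (ord1 k); exact/val_inj.
  rewrite ler_norml; move: x1 x2; rewrite /rV_head => x1 x2; apply/andP; split.
    by apply: le_trans x1; rewrite lerN2 -addrA addrCA lerDl addr_ge0.
  by apply: (le_trans x2); rewrite -addrA lerDl addr_ge0.
have := xj k; rewrite /rV_tail mxE => /le_trans; apply.
apply: (@le_trans _ _ (e * (h + t))); last by rewrite lerDr.
by rewrite ler_wpM2l// lerD2r.
Qed.

Lemma cone_convex l h e s t x y : 0 <= l <= 1 -> cone h e s x -> cone h e t y ->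
  cone h e (l * s + (1 - l) * t) (l *: x + (1 - l) *: y).
Proof.
move=> /andP[l0 l1] [/andP[x1 x2] xj] [/andP[y1 y2] yj].
have l1' : 0 <= 1 - l by rewrite subr_ge0.
split.
  rewrite rV_head_comb opprD -!mulrN; apply/andP; split.
    by apply: lerD; exact: ler_wpM2l.
  have -> : h = l * h + (1 - l) * h by ring.
  by apply: lerD; exact: ler_wpM2l.
move=> j; rewrite rV_tail_comb rV_head_comb.
apply: (le_trans (ler_normD _ _)); rewrite !normrM (ger0_norm l0) (ger0_norm l1').
have -> : e * (l * (rV_head x : R) + (1 - l) * (rV_head y : R) + (l * s + (1 - l) * t)) =
  l * (e * (rV_head x + s)) + (1 - l) * (e * (rV_head y + t)) by ring.
by apply: lerD; exact: ler_wpM2l.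
Qed.

(** The apex moves linearly, and the sections of a cone depend linearly on the
    distance to the apex. *)
Lemma minkowski_comb_cone l h e s t : 0 <= l <= 1 ->
  minkowski_comb l (cone h e s) (cone h e t) `<=` cone h e (l * s + (1 - l) * t).
Proof. by move=> l01 _ [[x y] [/= xs yt] <-]; exact: cone_convex. Qed.

Lemma cone_body h e t : 0 < h -> 0 < e -> 0 <= t -> convex_body (cone h e t).
Proof.
move=> h0 e0 t0; split.
- apply: bounded_closed_compact.
    exists (h + t + e * (h + t)); split; first exact: num_real.
    move=> M hM x /(cone_in_cube (ltW e0) t0 (ltW h0)) xM.
    rewrite /Num.norm/= mx_normrE; apply: bigmax_le => [|[i j] _].
      apply: le_trans (ltW hM); have ht : 0 <= h + t by apply: addr_ge0 => //; exact: ltW.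
      by apply: addr_ge0 => //; apply: mulr_ge0 => //; exact: ltW.
    by rewrite (ord1 i); exact: le_trans (xM j) (ltW hM).
  have -> : cone h e t = [set x | - t <= (rV_head x : R)] `&` [set x | (rV_head x : R) <= h] `&`
      \bigcap_(j in [set: 'I_m]) [set x | `|(rV_tail x : 'rV[R]_m) 0 j| <= e * (rV_head x + t)].
    apply/seteqP; split => [x [/andP[x1 x2] xj]|x [[/= x1 x2] xj]].
      by split; [split|move=> j _; exact: xj].
    by split; [rewrite x1|move=> j; exact: (xj j I)].
  have ch := continuous_rV_head.
  apply: closedI; first apply: closedI.
  + by apply: (@closed_le_continuous R _ (fun=> - t)) => //; exact: cst_continuous.
  + by apply: (@closed_le_continuous R _ _ (fun=> h)) => //; exact: cst_continuous.
  + apply: closed_bigI => j _; apply: closed_le_continuous.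
      by apply: continuous_normr; exact: continuous_rV_tail.
    exact: continuous_mul_add.
- apply/convex_setP => x y l cx cy l01.
  have := cone_convex l01 cx cy.
  by rewrite (_ : l * t + (1 - l) * t = t)//; ring.
- exists (row_mx ((h / 2)%:M : 'rV[R]_1) (0 : 'rV[R]_m)).
  apply/nbhs_ballP; exists (Num.min (h / 4) (e * (h / 4))) => /=.
    by rewrite lt_min divr_gt0//= mulr_gt0// divr_gt0.
  move=> x [_ xb].
  have x0 : `|h / 2 - rV_head x| < h / 4.
    have := xb 0 0; have := @rV_cons0 R m (h / 2, 0); rewrite /rV_cons/= => ->.
    by rewrite /ball/= lt_min => /andP[].
  have xh : h / 4 < rV_head x /\ rV_head x < h.
    by move: x0; rewrite ltr_norml; set u := rV_head x; move: h0; clear; lra.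
  case: xh => x1 x2; split; first by rewrite (ltW x2) andbT; move: t0 h0 x1; set u := rV_head x; clear; lra.
  move=> j; apply: (@le_trans _ _ (e * (h / 4))); last first.
    by rewrite ler_wpM2l ?(ltW e0)//; move: t0 x1; set u := rV_head x; clear; lra.
  have := xb 0 (rshift 1 j); have := @rV_consS R m (h / 2, 0) j; rewrite /rV_cons/= => ->.
  by rewrite mxE /ball/= sub0r normrN lt_min /rV_tail mxE => /andP[_ /ltW].
Qed.

Lemma cone0 h e t : 0 <= e -> 0 <= h -> 0 <= t -> cone h e t 0.
Proof.
move=> e0 h0 t0; split; first by rewrite /rV_head mxE h0 andbT oppr_le0.
by move=> j; rewrite /rV_tail /rV_head !mxE normr0 add0r mulr_ge0.
Qed.

End cones.

(** * Masses of thin cones *)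

Section mass_of_cones.
Context {R : realType}.
Local Notation mu := (@lebesgue_measure R).
Local Notation RR := (measurableTypeR R).

Definition cube n (s : R) : set (borelRV R n) :=
  [set x | forall j, `|(x : 'rV[R]_n) 0 j| <= s].

Arguments cube n s : clear implicits.

Lemma lebesgue_rV_closed_cube n (s : R) : 0 <= s ->
  measurable (cube n s) /\ (lebesgue_rV n (cube n s) = ((2 * s) ^+ n)%:E)%E.
Proof.
move=> s0; elim: n => [|n [mQ Q]].
  rewrite (_ : cube 0 s = setT); last by apply/seteqP; split => // x _ [].
  by split; [exact: measurableT|rewrite /= diracT].
set A := [set x : R | `|x| <= s].
have AE : A = `[(- s), s]%classic.
  by apply/seteqP; split => x; rewrite /A/= in_itv/= ler_norml.
have mA : measurable (A : set (measurableTypeR R)) by rewrite AE; exact: measurable_itv.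
have -> : cube n.+1 s = @rV_head R n @^-1` A `&` @rV_tail R n @^-1` (cube n s).
  apply/seteqP; split => [x h|x [/= h0 h1] j].
    split; first exact: h.
    by move=> j; rewrite /rV_tail !mxE; exact: h.
  case: (split_ordP (j : 'I_(1 + n))) => k ->.
    by have -> : lshift n k = 0 by rewrite (ord1 k); exact/val_inj.
  by have := h1 k; rewrite /rV_tail !mxE.
split.
  apply: measurableI; rewrite -[X in measurable X]setTI.
    exact: measurable_rV_head.
  exact: measurable_rV_tail.
rewrite lebesgue_rVS// Q AE lebesgue_measure_itv/= lte_fin.
case: ltP => [_|ss]; first by rewrite -EFinD -EFinM exprS; congr EFin; ring.
have -> : s = 0 by move: s0 ss; clear; lra.
by rewrite mulr0 exprS mul0r mul0e.
Qed.

(** u + d lies on the segment from u to u + 1, where the power is convex. *)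
Lemma powR_add_le (p u d : R) : 1 <= p -> 0 <= u -> 0 <= d <= 1 ->
  (u + d) `^ p <= u `^ p + d * (u + 1) `^ p.
Proof.
move=> p1 u0 /andP[d0 d1].
have : (d * (u + 1) + (1 - d) * u) `^ p <= d * (u + 1) `^ p + (1 - d) * u `^ p.
  have := @convex_powR R p p1 (Itv01 d0 d1) (u + 1) u.
  by rewrite !inE/= !in_itv/= !andbT !convRE/=; apply => //; exact: addr_ge0.
rewrite (_ : d * (u + 1) + (1 - d) * u = u + d); last by ring.
move=> /le_trans; apply.
have := mulr_ge0 d0 (powR_ge0 u p); clear; lra.
Qed.

Variable m : nat.

Lemma enorm_cons_ge (a : R) (b : 'rV[R]_m) : `|a| <= enorm (rV_cons (a, b) : 'rV[R]_m.+1).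
Proof.
have := ler_enorm (rV_cons (a, b) : 'rV[R]_m.+1) 0.
by rewrite (_ : (rV_cons _ : 'rV[R]_m.+1) 0 0 = a)//; exact: (@rV_cons0 R m (a, b)).
Qed.

Lemma enorm_cons_le (a s : R) (b : 'rV[R]_m) : 0 <= s -> (forall j, `|b 0 j| <= s) ->
  enorm (rV_cons (a, b) : 'rV[R]_m.+1) <= `|a| + m%:R * s.
Proof.
move=> s0 bs.
have ms0 : 0 <= m%:R * s by apply: mulr_ge0.
rewrite -(@ler_pXn2r _ 2%N) ?nnegrE ?enorm_ge0 ?addr_ge0//.
rewrite sqr_enorm big_ord_recl.
rewrite (_ : (rV_cons _ : 'rV[R]_m.+1) 0 ord0 = a); last exact: (@rV_cons0 R m (a, b)).
have : \sum_(i < m) (rV_cons (a, b) : 'rV[R]_m.+1) 0 (lift ord0 i) ^+ 2 <= \sum_(i < m) s ^+ 2.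
  apply: ler_sum => i _.
  have -> : lift ord0 i = rshift 1 i :> 'I_(1 + m) by exact/val_inj.
  rewrite (_ : (rV_cons (a, b) : 'rV[R]_m.+1) 0 _ = b 0 i); last exact: (@rV_consS R m (a, b)).
  by rewrite -(real_normK (num_real _)) ler_sqr ?nnegrE.
rewrite sumr_const card_ord -(mulr_natl (s ^+ 2)) sqrrD (real_normK (num_real _)) => h.
have h2 : 0 <= `|a| * (m%:R * s) *+ 2 by apply: mulrn_wge0; apply: mulr_ge0.
have h3 : m%:R * s ^+ 2 <= (m%:R * s) ^+ 2.
  rewrite exprMn ler_wpM2r ?sqr_ge0// -natrX ler_nat; case: (m) => // k.
  by rewrite expnS leq_pmulr.
by apply: (le_trans (lerD (lexx _) h)); rewrite -addrA lerD2l (le_trans h3)// lerDr.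
Qed.

(** The density on the axis times the volume of the section, up to the factor
    (2 e)^m. *)
Definition profile (p h t : R) (a : RR) : RR :=
  ((- t <= a) && (a <= h))%R%:R * (expR (- (`|a| `^ p / p)) * (a + t) ^+ m).

Lemma profile_ge0 p h t a : 0 <= profile p h t a.
Proof.
rewrite /profile; case: (boolP ((- t <= a) && (a <= h))); last by rewrite mul0r.
move=> /andP[ta _]; rewrite mul1r mulr_ge0 ?expR_ge0// exprn_ge0//.
by rewrite -lerBlDr sub0r.
Qed.

Lemma measurable_profile p h t : measurable_fun setT (profile p h t).
Proof.
apply: measurable_funM.
  by apply: measurable_natr; apply: measurable_and; exact: measurable_fun_ler.
apply: measurable_funM.
  apply: measurableT_comp => //; apply: measurable_funN; apply: measurable_funM => //.
  by apply: (measurableT_comp (measurable_powR p)).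
by apply: measurable_funX; exact: measurable_funD.
Qed.

Section fixed_cone.
Variables (p h e t : R).
Hypotheses (p1 : 1 <= p) (h0 : 0 < h) (e0 : 0 < e) (t0 : 0 <= t).

Let d (z : borelRV R m.+1) : R := expR (- potential p (z : 'rV[R]_m.+1)).
Let C : set (borelRV R m.+1) := cone h e t.

Let mC : measurable C.
Proof. by case: (cone_body (m := m) h0 e0 t0) => kC _ _; exact: compact_borelRV. Qed.

Let mdC : measurable_fun setT (d \_ C).
Proof. by apply: measurable_restrictR => //; exact: measurable_density. Qed.

Let dC0 x : 0 <= (d \_ C) x.
Proof. by rewrite patchE; case: ifP => // _; exact: expR_ge0. Qed.

Lemma cone_cons a b : C (rV_cons (a, b)) <-> (- t <= a <= h) /\ cube m (e * (a + t)) b.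
Proof.
rewrite /C /cone/= (_ : rV_head (rV_cons (a, b)) = a); last exact: rV_cons0.
by rewrite (_ : rV_tail (rV_cons (a, b)) = b)// /rV_tail /rV_cons row_mxKr.
Qed.

Lemma mass_coneE : (mass p C = \int[mu]_a \int[lebesgue_rV m]_b ((d \_ C) (rV_cons (a, b)))%:E)%E.
Proof.
rewrite /mass (integral_restrict C d).
apply: (@ge0_integral_rVS R m (fun x => ((d \_ C) x)%:E)); first exact/measurable_EFinP.
by move=> x; rewrite lee_fin.
Qed.

Let profE (c : R) : 0 <= c ->
  ((c * (2 * e) ^+ m)%:E * \int[mu]_a (profile p h t a)%:E =
   \int[mu]_a (c * (2 * e) ^+ m * profile p h t a)%:E)%E.
Proof.
move=> c0; rewrite integralZl_real//.
- by apply: mulr_ge0 => //; apply: exprn_ge0; apply: mulr_ge0 => //; exact: ltW.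
- exact: measurable_profile.
- by move=> a; exact: profile_ge0.
Qed.

Let msec : measurable_fun setT
  (fun a : RR => \int[lebesgue_rV m]_b ((d \_ C) (rV_cons (a, b)))%:E)%E.
Proof.
apply: (@measurable_rV_marginal R m (fun x => ((d \_ C) x)%:E)); first exact/measurable_EFinP.
by move=> x; rewrite lee_fin.
Qed.

(** The density is largest on the axis. *)
Lemma mass_cone_le : (mass p C <= ((2 * e) ^+ m)%:E * \int[mu]_a (profile p h t a)%:E)%E.
Proof.
rewrite -[(2 * e) ^+ m]mul1r profE// mass_coneE; apply: ge0_le_integral => //.
- by move=> a _; apply: integral_ge0 => b _; rewrite lee_fin.
- by apply/measurable_EFinP; apply: measurable_funM => //; exact: measurable_profile.
move=> a _; have [ha|ha] := boolP (- t <= a <= h); last first.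
  rewrite integral0_eq.
    by rewrite lee_fin; apply: mulr_ge0; [apply: mulr_ge0 => //; apply: exprn_ge0; apply: mulr_ge0 => //; exact: ltW|exact: profile_ge0].
  move=> b _; rewrite patchE memNset// => /cone_cons[h1]; by rewrite h1 in ha.
have at0 : 0 <= a + t by case/andP: ha => h1 _; rewrite -lerBlDr sub0r.
have s0 : 0 <= e * (a + t) by apply: mulr_ge0 => //; exact: ltW.
pose f (b : borelRV R m) : R := (d \_ C) (rV_cons (a, b)).
have mf : measurable_fun setT f.
  apply/measurable_EFinP.
  by apply: (@measurable_rV_section R m (fun x => ((d \_ C) x)%:E)); exact/measurable_EFinP.
have p0 : 0 < p by exact: lt_le_trans ltr01 p1.
have fb b : 0 <= f b <= expR (- (`|a| `^ p / p)).
  rewrite dC0 /f patchE; case: ifP => _; last exact: expR_ge0.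
  rewrite ler_expR lerN2 ler_wpM2r ?invr_ge0 ?(ltW p0)//.
  apply: ge0_ler_powR; rewrite ?nnegrE ?enorm_ge0 ?(ltW p0)//.
  exact: enorm_cons_ge.
have fs : supported_in_cube (e * (a + t)) f.
  by move=> b /restrict_gt0[/cone_cons[_ hb] _]; exact: hb.
apply: (le_trans (integral_le_cube s0 (expR_ge0 _) mf fb fs)).
rewrite lee_fin /profile ha !mul1r.
by rewrite (mulrA 2 e) (exprMn _ (2 * e)) mulrCA.
Qed.

(** Inside the cone the norm exceeds the distance along the axis by at most
    m * e * (h + t). *)
Lemma mass_cone_ge : m%:R * (e * (h + t)) <= 1 ->
  ((expR (- (m%:R * (e * (h + t)) * ((h + t + 1) `^ p / p))) * (2 * e) ^+ m)%:E *
     \int[mu]_a (profile p h t a)%:E <= mass p C)%E.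
Proof.
move=> small; rewrite profE ?expR_ge0// mass_coneE.
set del := m%:R * _ in small *.
set k := expR _.
have k0 : 0 <= k by exact: expR_ge0.
have p0 : 0 < p by exact: lt_le_trans ltr01 p1.
have ht0 : 0 <= h + t by apply: addr_ge0 => //; exact: ltW.
have del0 : 0 <= del by rewrite /del; apply: mulr_ge0 => //; apply: mulr_ge0 => //; exact: ltW.
have kle a b : C (rV_cons (a, b)) -> k * expR (- (`|a| `^ p / p)) <= d (rV_cons (a, b)).
  move=> /cone_cons[/andP[ta ah] hb].
  have at0 : 0 <= a + t by rewrite -lerBlDr sub0r.
  have s0 : 0 <= e * (a + t) by apply: mulr_ge0 => //; exact: ltW.
  rewrite /k /d -expRD ler_expR -opprD lerN2 /potential.
  rewrite mulrA -mulrDl ler_wpM2r ?invr_ge0 ?(ltW p0)//.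
  have nle : enorm (rV_cons (a, b) : 'rV[R]_m.+1) <= `|a| + del.
    apply: (le_trans (enorm_cons_le _ s0 hb)); rewrite lerD2l.
    by rewrite ler_wpM2l// ler_wpM2l ?(ltW e0)// lerD2r.
  apply: (@le_trans _ _ ((`|a| + del) `^ p)).
    by apply: ge0_ler_powR; rewrite ?nnegrE ?enorm_ge0 ?(ltW p0) ?addr_ge0.
  have dd : 0 <= del <= 1 by rewrite del0.
  apply: (le_trans (powR_add_le p1 (normr_ge0 a) dd)).
  rewrite addrC lerD2r ler_wpM2l//.
  have ht1 : 0 <= h + t + 1 by exact: addr_ge0.
  have a1 : 0 <= `|a| + 1 by exact: addr_ge0.
  apply: (ge0_ler_powR (ltW p0) a1 ht1).
  rewrite lerD2r ler_norml; apply/andP; split.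
    by apply: le_trans ta; rewrite lerN2 lerDr ltW.
  by apply: (le_trans ah); rewrite lerDl.
clearbody k.
apply: ge0_le_integral => //.
- move=> a _; rewrite lee_fin; apply: mulr_ge0; last exact: profile_ge0.
  by apply: mulr_ge0 => //; apply: exprn_ge0; apply: mulr_ge0 => //; exact: ltW.
- by apply/measurable_EFinP; apply: measurable_funM => //; exact: measurable_profile.
move=> a _; have [ha|ha] := boolP (- t <= a <= h); last first.
  rewrite /profile (negbTE ha) mul0r mulr0.
  by apply: integral_ge0 => b _; rewrite lee_fin.
have at0 : 0 <= a + t by case/andP: ha => h1 _; rewrite -lerBlDr sub0r.
have s0 : 0 <= e * (a + t) by apply: mulr_ge0 => //; exact: ltW.
have [mQ QE] := lebesgue_rV_closed_cube m s0.
have {}kle := kle a; set g := expR (- (`|a| `^ p / p)) in kle *.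
have g0 : 0 <= g by exact: expR_ge0.
have -> : k * (2 * e) ^+ m * profile p h t a = k * g * (2 * (e * (a + t))) ^+ m.
  by rewrite /profile ha mul1r -/g (mulrA 2 e) (exprMn _ (2 * e)); ring.
clearbody g.
have c0 : 0 <= k * g by exact: mulr_ge0.
rewrite EFinM -QE.
rewrite -(setIT (cube m (e * (a + t)))) -(integral_indic (lebesgue_rV m) measurableT mQ).
have mi : measurable_fun setT (fun b : borelRV R m => \1_(cube m (e * (a + t))) b : RR).
  exact: measurable_indic.
have i0 b : 0 <= (\1_(cube m (e * (a + t))) b : RR) by rewrite indicE.
rewrite -(integralZl_real (lebesgue_rV m) c0 mi i0).
apply: ge0_le_integral => //.
- by move=> b _; rewrite lee_fin; exact: mulr_ge0.
- by apply/measurable_EFinP; exact: measurable_funM.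
- by apply: (@measurable_rV_section R m (fun x => ((d \_ C) x)%:E)); exact/measurable_EFinP.
move=> b _; rewrite lee_fin indicE.
case: (boolP (b \in _)) => [|_]; last by rewrite mulr0 dC0.
rewrite inE => hb; rewrite mulr1.
have Cab : C (rV_cons (a, b)) by apply/cone_cons.
by rewrite patchE mem_set//; exact: kle.
Qed.

End fixed_cone.

End mass_of_cones.

(** * Second-order consequences of power concavity *)

Section second_order_necessary.
Context {R : realType}.
Implicit Types (u v w t x y z : R).

Lemma le_of_linear_error u v w : 0 <= w ->
  (forall t, 0 < t <= 1 -> u <= v + t * w) -> u <= v.
Proof.
move=> w0 H; apply/ler_addgt0Pr => e e0.
have w1 : 0 < w + 1 by rewrite ltr_wpDl.
pose t := Num.min 1 (e / (w + 1)).
have t0 : 0 < t by rewrite lt_min ltr01 divr_gt0.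
have t1 : t <= 1 by rewrite ge_min lexx.
have te : t <= e / (w + 1) by rewrite ge_min lexx orbT.
apply: (le_trans (H t _)); first by rewrite t0.
rewrite lerD2l; apply: (@le_trans _ _ (t * (w + 1))).
  by rewrite ler_wpM2l ?(ltW t0)// lerDl.
by rewrite -ler_pdivlMr.
Qed.

Lemma expR_le_quadratic z : 0 <= z <= 1 / 2 -> expR z <= 1 + z + 2 * z ^+ 2.
Proof.
move=> /andP[z0 z1].
have h1 : 0 < 1 - z by move: z1; clear; lra.
have := expR_ge1Dx (- z); rewrite (expRN z) => h.
have h2 : (1 - z) * expR z <= 1 by rewrite -ler_pdivlMr ?expR_gt0// mul1r.
have h3 : 1 <= (1 - z) * (1 + z + 2 * z ^+ 2).
  have : 0 <= z ^+ 2 * (1 - 2 * z).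
    by apply: mulr_ge0; [exact: sqr_ge0|move: z1; clear; lra].
  by clear; lra.
by rewrite -(ler_pM2l h1); exact: le_trans h3.
Qed.

(** Compare the terms of first order in l. *)
Lemma tangent_bound x y z : 0 <= y -> 0 <= z ->
  (forall l : R, 0 < l < 1 -> 1 + l * x <= expR (l * y + l ^+ 2 * z)) -> x <= y.
Proof.
move=> y0 z0 H.
have yz0 : 0 <= y + z by exact: addr_ge0.
have c0 : 0 < 2 * (y + z + 1) by rewrite mulr_gt0// ltr_wpDl.
apply: (@le_of_linear_error x y (z + 2 * (y + z) ^+ 2)).
  by apply: addr_ge0 => //; apply: mulr_ge0 => //; exact: sqr_ge0.
move=> t /andP[t0 t1].
(* Small enough for expR_le_quadratic to apply. *)
pose l := t / (2 * (y + z + 1)).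
have l0 : 0 < l by exact: divr_gt0.
have lc : l * (2 * (y + z + 1)) = t by rewrite /l divfK// gt_eqF.
have l1 : l < 1.
  rewrite -(ltr_pM2r c0) lc mul1r; move: yz0 t1; clear; lra.
have lt : l <= t.
  rewrite -(ler_pM2r c0) lc; rewrite ler_peMr ?(ltW t0)//; move: yz0; clear; lra.
have zle : l * y + l ^+ 2 * z <= l * (y + z).
  rewrite mulrDr lerD2l expr2 -mulrA; apply: ler_piMl; last exact: ltW.
  by apply: mulr_ge0 => //; exact: ltW.
have ge : 0 <= l * y + l ^+ 2 * z.
  apply: addr_ge0; apply: mulr_ge0 => //; [exact: ltW|exact: sqr_ge0].
have half : l * (y + z) <= 1 / 2 by move: lc l0 t1; clear; lra.
have h01 : 0 <= l * y + l ^+ 2 * z <= 1 / 2 by rewrite ge (le_trans zle).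
have l01 : 0 < l < 1 by rewrite l0.
have := le_trans (H l l01) (expR_le_quadratic h01).
have sq : (l * y + l ^+ 2 * z) ^+ 2 <= (l * (y + z)) ^+ 2.
  by rewrite ler_sqr ?nnegrE ?(le_trans ge zle).
move=> h; have {}h : l * x <= l * (y + l * z + 2 * l * (y + z) ^+ 2).
  move: h sq; clear; lra.
rewrite (ler_pM2l l0) in h; apply: (le_trans h).
have h1 := ler_wpM2r z0 lt.
have h2 := ler_wpM2r (sqr_ge0 (y + z)) lt.
by move: h1 h2; clear; lra.
Qed.

Lemma ln_ge_quadratic y : 0 <= y -> y - y ^+ 2 / 2 <= ln (1 + y).
Proof.
move=> y0.
pose f (t : R) := ln (1 + t) - t + t ^+ 2 / 2.
pose f' (t : R) := (1 + t)^-1 - 1 + t.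
suff : f 0 <= f y by rewrite /f addr0 ln1 expr0n/=; clear; lra.
apply: (@derive_ge0_le R f f' y y0) => t /andP[t0 _].
  have p1 : 0 < 1 + t by rewrite ltr_pwDl.
  have d1 : is_derive t 1 (fun t : R => 1 + t) 1.
    by apply: is_derive_eq; rewrite /GRing.scale/=; ring.
  have d2 := @is_derive1_comp R (@ln R) (fun t => 1 + t) t _ _ (is_derive1_ln p1) d1.
  have d3 : is_derive t 1 (fun t : R => t) 1 by exact: is_derive_id.
  have d4 : is_derive t 1 (fun t : R => t ^+ 2 / 2) t.
    by apply: is_derive_eq; rewrite /GRing.scale/=; field.
  by apply: (is_derive_eq (is_deriveD (is_deriveB d2 d3) d4)); rewrite /f' mulr1.
have p1 : 0 < 1 + t by rewrite ltr_pwDl.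
have -> : f' t = t ^+ 2 / (1 + t) by rewrite /f'; field; rewrite gt_eqF.
by rewrite divr_ge0 ?sqr_ge0// ltW.
Qed.

Lemma ln_le_cubic y : 0 <= y -> ln (1 + y) <= y - y ^+ 2 / 2 + y ^+ 3 / 3.
Proof.
move=> y0.
pose f (t : R) := t - t ^+ 2 / 2 + t ^+ 3 / 3 - ln (1 + t).
pose f' (t : R) := 1 - t + t ^+ 2 - (1 + t)^-1.
suff : f 0 <= f y by rewrite /f addr0 ln1 !expr0n/=; clear; lra.
apply: (@derive_ge0_le R f f' y y0) => t /andP[t0 _].
  have p1 : 0 < 1 + t by rewrite ltr_pwDl.
  have d1 : is_derive t 1 (fun t : R => 1 + t) 1.
    by apply: is_derive_eq; rewrite /GRing.scale/=; ring.
  have d2 := @is_derive1_comp R (@ln R) (fun t => 1 + t) t _ _ (is_derive1_ln p1) d1.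
  have d4 : is_derive t 1 (fun t : R => t - t ^+ 2 / 2 + t ^+ 3 / 3) (1 - t + t ^+ 2).
    by apply: is_derive_eq; rewrite /GRing.scale/=; field.
  by apply: (is_derive_eq (is_deriveB d4 d2)); rewrite /f' mulr1.
have p1 : 0 < 1 + t by rewrite ltr_pwDl.
have -> : f' t = t ^+ 3 / (1 + t) by rewrite /f'; field; rewrite gt_eqF.
by apply: divr_ge0; [exact: exprn_ge0|exact: ltW].
Qed.

(** Letting l tend to 0 yields the tangent inequality
    (g t / A)^al <= 1 + al * (B / A) * t. Take logarithms and compare the terms of
    second order in t. *)
Lemma power_concave_second_order (g : R -> R) (al A B D K : R) : 0 < al -> 0 < A ->
  0 <= B -> 0 <= D -> 0 <= K -> g 0 = A ->
  (forall s, 0 <= s <= 1 -> 0 < g s <= A + B * s + K * s ^+ 2) ->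
  (forall t, 0 < t <= 1 -> A + B * t + (1 - t) * D * t ^+ 2 / 2 <= g t) ->
  (forall t l, 0 < t <= 1 -> 0 < l < 1 ->
     l * expR (al * ln (g t)) + (1 - l) * expR (al * ln (g 0)) <= expR (al * ln (g (l * t)))) ->
  D * A <= (1 - al) * B ^+ 2.
Proof.
move=> al0 A0 B0 D0 K0 gA gub glb gcc.
pose b := B / A; pose d := D / A.
have b0 : 0 <= b by apply: divr_ge0 => //; exact: ltW.
have d0 : 0 <= d by apply: divr_ge0 => //; exact: ltW.
suff : d <= (1 - al) * b ^+ 2.
  have A2 : 0 < A ^+ 2 by rewrite exprn_gt0.
  move/(ler_wpM2r (ltW A2)).
  have -> : d * A ^+ 2 = D * A by rewrite /d; field; rewrite gt_eqF.
  by have -> : (1 - al) * b ^+ 2 * A ^+ 2 = (1 - al) * B ^+ 2 by rewrite /b; field; rewrite gt_eqF.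
apply: (@le_of_linear_error d _ (d + b * d + d ^+ 2 + al ^+ 2 * b ^+ 3)).
  have := mulr_ge0 b0 d0; have := sqr_ge0 d.
  have := mulr_ge0 (sqr_ge0 al) (exprn_ge0 3 b0); move: d0; clear; lra.
move=> t t01; case/andP: (t01) => t0 t1.
have tt : 0 <= t <= 1 by rewrite (ltW t0).
have /andP[gt0 _] := gub t tt.
have albt : 0 <= al * b * t by apply: mulr_ge0; [apply: mulr_ge0 => //|]; exact: ltW.
have tang : expR (al * (ln (g t) - ln A)) - 1 <= al * b * t.
  apply: (@tangent_bound _ _ (al * K * t ^+ 2 / A)) => //.
    by apply: divr_ge0; [apply: mulr_ge0; [apply: mulr_ge0 => //|exact: sqr_ge0]|]; exact: ltW.
  move=> l l01; have := gcc t l t01 l01; rewrite gA.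
  case/andP: l01 => l0 l1.
  have lt01 : 0 <= l * t <= 1.
    by rewrite mulr_ge0 ?(ltW l0) ?(ltW t0)//= (le_trans _ t1)// ler_piMl ?(ltW l1) ?(ltW t0).
  have /andP[glt0 glt1] := gub _ lt01.
  have up : ln (g (l * t)) <= ln A + (b * (l * t) + K * (l * t) ^+ 2 / A).
    have E : A + B * (l * t) + K * (l * t) ^+ 2 = A * (1 + (b * (l * t) + K * (l * t) ^+ 2 / A)).
      by rewrite /b; field; rewrite gt_eqF.
    have q0 : 0 <= b * (l * t) + K * (l * t) ^+ 2 / A.
      apply: addr_ge0; first by apply: mulr_ge0 => //; case/andP: lt01.
      by apply: divr_ge0; [apply: mulr_ge0 => //; exact: sqr_ge0|exact: ltW].
    rewrite E in glt1.
    have p1 : 0 < 1 + (b * (l * t) + K * (l * t) ^+ 2 / A) by rewrite ltr_pwDl.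
    apply: (@le_trans _ _ (ln (A * (1 + (b * (l * t) + K * (l * t) ^+ 2 / A))))).
      by rewrite ler_ln ?posrE// mulr_gt0.
    rewrite lnM ?posrE// lerD2l; apply: le_ln1Dx.
    by apply: lt_le_trans q0; rewrite oppr_lt0.
  rewrite (mulrBr al (ln (g t))); move=> h.
  have e0 : 0 < expR (al * ln A) by exact: expR_gt0.
  rewrite (expRD (al * ln (g t)) (- (al * ln A))) (expRN (al * ln A)).
  rewrite -(ler_pM2r e0).
  apply: (@le_trans _ _ (l * expR (al * ln (g t)) + (1 - l) * expR (al * ln A))).
    rewrite le_eqVlt; apply/orP; left; apply/eqP; move: e0.
    move: (expR (al * ln A)) (expR (al * ln (g t))) => u v u0.
    by field; rewrite gt_eqF.
  apply: (le_trans h); rewrite -expRD ler_expR.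
  have := ler_wpM2l (ltW al0) up.
  by rewrite exprMn; move: (ln _) (ln _) => u v; clear; lra.
have y0 : 0 <= b * t + (1 - t) * d * t ^+ 2 / 2.
  apply: addr_ge0; first by apply: mulr_ge0 => //; exact: ltW.
  by apply: divr_ge0 => //; apply: mulr_ge0; [apply: mulr_ge0 => //; rewrite subr_ge0|exact: sqr_ge0].
set y := b * t + _ in y0.
have lnlow : y - y ^+ 2 / 2 <= ln (g t) - ln A.
  apply: (le_trans (ln_ge_quadratic y0)); rewrite lerBrDl -lnM ?posrE//; last by rewrite ltr_pwDl.
  rewrite ler_ln ?posrE//; last by rewrite mulr_gt0// ltr_pwDl.
  apply: le_trans (glb t t01).
  have -> : A * (1 + y) = A + B * t + (1 - t) * D * t ^+ 2 / 2.
    by rewrite /y /b /d; field; rewrite gt_eqF.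
  by [].
have lnup : al * (ln (g t) - ln A) <= al * b * t - (al * b * t) ^+ 2 / 2 + (al * b * t) ^+ 3 / 3.
  apply: le_trans (ln_le_cubic albt).
  have p1 : 0 < 1 + al * b * t by rewrite ltr_pwDl.
  rewrite -ler_expR (lnK _) ?posrE//; move: tang; clear; lra.
have := le_trans (ler_wpM2l (ltW al0) lnlow) lnup.
have -> : al * b * t - (al * b * t) ^+ 2 / 2 + (al * b * t) ^+ 3 / 3 =
  al * (b * t - al * b ^+ 2 * t ^+ 2 / 2 + al ^+ 2 * b ^+ 3 * t ^+ 3 / 3) by field.
rewrite (ler_pM2l al0) => main.
have t2 : 0 < t ^+ 2 / 2 by rewrite divr_gt0// exprn_gt0.
rewrite -(ler_pM2r t2).
have yle : y <= b * t + d * t ^+ 2 / 2.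
  have : 0 <= t * d * t ^+ 2 / 2.
    by apply: divr_ge0 => //; apply: mulr_ge0; [apply: mulr_ge0 => //; exact: ltW|exact: sqr_ge0].
  by rewrite /y; clear; lra.
have ysq : y ^+ 2 <= (b * t + d * t ^+ 2 / 2) ^+ 2 by rewrite ler_sqr ?nnegrE// (le_trans y0).
have c2 : 0 <= al ^+ 2 * b ^+ 3 * t ^+ 3.
  by apply: mulr_ge0; [apply: mulr_ge0; [exact: sqr_ge0|exact: exprn_ge0]|apply: exprn_ge0; exact: ltW].
have c4 : 0 <= t ^+ 3 * d ^+ 2.
  by apply: mulr_ge0; [apply: exprn_ge0; exact: ltW|exact: sqr_ge0].
have c3 : 0 <= t ^+ 3 * d ^+ 2 * (1 - t) by apply: mulr_ge0 => //; rewrite subr_ge0.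
move: main ysq c2 c3 c4; rewrite /y; clear; lra.
Qed.

End second_order_necessary.

(** * Power concavity of the profile *)

Section profile_concavity.
Context {R : realType} {m : nat}.
Local Notation mu := (@lebesgue_measure R).
Local Notation RR := (measurableTypeR R).
Variables (p h : R).
Hypotheses (p1 : 1 <= p) (h0 : 0 < h).

Definition profile_mass (t : R) : R := fine (\int[mu]_a (profile m p h t a)%:E)%E.

(** The exponent of the error in mass_cone_ge is linear in the aperture. *)
Lemma small_aperture (eta t : R) : 0 < eta <= 1 -> 0 <= t -> exists2 e : R, 0 < e &
  forall s, 0 <= s <= t -> m%:R * (e * (h + s)) <= 1 /\
    m%:R * (e * (h + s)) * ((h + s + 1) `^ p / p) <= eta.
Proof.
move=> /andP[eta0 eta1] t0.
have p0 : 0 < p by exact: lt_le_trans ltr01 p1.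
pose B := (h + t + 1) `^ p / p; have B0 : 0 <= B by rewrite divr_ge0 ?powR_ge0 ?ltW.
pose c := m%:R * (h + t) + 1.
have ht0 : 0 <= h + t by apply: addr_ge0 => //; exact: ltW.
have c0 : 0 < c by rewrite ltr_wpDl// mulr_ge0.
have B1 : 0 < B + 1 by rewrite ltr_wpDl.
have cB : 0 < c * (B + 1) by exact: mulr_gt0.
exists (eta / (c * (B + 1))); first exact: divr_gt0.
move=> s /andP[s0 st].
set e := eta / _; have e0 : 0 < e by exact: divr_gt0.
have hs0 : 0 <= h + s by apply: addr_ge0 => //; exact: ltW.
have d0 : 0 <= m%:R * (e * (h + s)) by apply: mulr_ge0 => //; apply: mulr_ge0 => //; exact: ltW.
have dle : m%:R * (e * (h + s)) <= eta / (B + 1).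
  apply: (@le_trans _ _ (e * c)); last first.
    by rewrite /e invfM mulrA mulrAC divfK// gt_eqF.
  rewrite mulrCA ler_wpM2l ?(ltW e0)// /c.
  apply: (@le_trans _ _ (m%:R * (h + t))); last by rewrite lerDl.
  by rewrite ler_wpM2l// lerD2l.
have d1 : eta / (B + 1) <= 1 by rewrite ler_pdivrMr// mul1r (le_trans eta1)// lerDr.
split; first exact: le_trans d1.
have BsB : (h + s + 1) `^ p / p <= B.
  rewrite /B ler_wpM2r ?invr_ge0 ?(ltW p0)//.
  have h1 : 0 <= h + s + 1 by exact: addr_ge0.
  have h2 : 0 <= h + t + 1 by exact: addr_ge0.
  by apply: (ge0_ler_powR (ltW p0) h1 h2); rewrite lerD2r lerD2l.
apply: (@le_trans _ _ (eta / (B + 1) * B)).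
  by apply: ler_pM => //; rewrite divr_ge0 ?powR_ge0 ?ltW.
by rewrite mulrAC ler_pdivrMr// ler_wpM2l ?(ltW eta0)// lerDl.
Qed.

(** The masses of the cones, which are positive and finite, sandwich the integral. *)
Lemma profile_massE (t : R) : 0 <= t ->
  0 < profile_mass t /\ (\int[mu]_a (profile m p h t a)%:E = (profile_mass t)%:E)%E.
Proof.
move=> t0; have eta01 : 0 < (1 : R) <= 1 by rewrite ltr01 lexx.
have [e e0 He] := small_aperture eta01 t0.
have [small _] := He t ltac:(by rewrite t0 lexx).
have [a a0 aE] := mass_body p1 (cone_body (m := m) h0 e0 t0).
have := @mass_cone_le R m p h e t p1 h0 e0 t0; have := mass_cone_ge (m := m) p1 h0 e0 t0 small.
rewrite aE; set I := (\int[mu]_a _)%E; set k := expR _ * _.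
have k0 : 0 < k by rewrite mulr_gt0 ?expR_gt0// exprn_gt0// mulr_gt0.
have I0 : (0 <= I)%E by apply: integral_ge0 => b _; rewrite lee_fin profile_ge0.
rewrite /profile_mass -/I.
have e20 : 0 < (2 * e) ^+ m by rewrite exprn_gt0// mulr_gt0.
case: I I0 => [r| |]//=; rewrite ?lee_fin.
- move=> r0 _ ar; split=> //.
  by have := lt_le_trans a0 ar; rewrite pmulr_rgt0.
- by move=> _; rewrite gt0_muley ?lte_fin// leye_eq.
Qed.

(** Apply the inequality to the cones with apexes - t and 0. Their combination
    lies in a cone, the factor (2 e)^m cancels, and the errors vanish with the
    aperture. *)
Lemma profile_mass_concave (al t l : R) : 0 < al -> bm_exponents m.+1 p al ->
  0 <= t -> 0 <= l <= 1 ->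
  l * expR (al * ln (profile_mass t)) + (1 - l) * expR (al * ln (profile_mass 0)) <=
  expR (al * ln (profile_mass (l * t))).
Proof.
move=> al0 Aal t0 l01; case/andP: (l01) => l0 l1.
have l1' : 0 <= 1 - l by rewrite subr_ge0.
have lt0 : 0 <= l * t by exact: mulr_ge0.
have [Gt0 GtE] := profile_massE t0.
have [G00 G0E] := profile_massE (lexx 0).
have [Gl0 GlE] := profile_massE lt0.
set S := l * _ + _; set T := expR _.
have S0 : 0 <= S by apply: addr_ge0; apply: mulr_ge0 => //; exact: expR_ge0.
apply: (@le_of_linear_error R S T (al * S)); first by apply: mulr_ge0 => //; exact: ltW.
move=> eta eta01; have [e e0 He] := small_aperture eta01 t0.
have [s1 s2] := He t ltac:(by rewrite t0 lexx).
have [s3 s4] := He 0 ltac:(by rewrite t0 lexx).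
have bK := cone_body (m := m) h0 e0 t0.
have bL := cone_body (m := m) h0 e0 (lexx 0).
have K0 := @cone0 R m h e t (ltW e0) (ltW h0) t0.
have L0 := @cone0 R m h e 0 (ltW e0) (ltW h0) (lexx 0).
have := Aal _ _ l bK bL K0 L0 l01.
move=> /(brunn_minkowski_log_mass (ltn0Sn m) p1 al bK bL l01).
rewrite gt_eqF//.
have i0 : 0 <= (0 : R) <= 1 by rewrite lexx ler01.
have i1 : 0 <= (1 : R) <= 1 by rewrite lexx ler01.
have M1 := mass_comb p1 bK bL i1; have M0 := mass_comb p1 bK bL i0.
have Ml := mass_comb p1 bK bL l01.
rewrite minkowski_comb1 in M1; last by exists 0.
rewrite minkowski_comb0 in M0; last by exists 0.
set x1 := log_mass _ _ _ 1 in M1 *; set x0 := log_mass _ _ _ 0 in M0 *.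
set xl := log_mass _ _ _ l in Ml *.
set q := (2 * e) ^+ m.
have q0 : 0 < q by rewrite exprn_gt0// mulr_gt0.
have low (s x : R) : 0 < profile_mass s -> 0 <= s -> m%:R * (e * (h + s)) <= 1 ->
   m%:R * (e * (h + s)) * ((h + s + 1) `^ p / p) <= eta ->
   mass p (cone (m := m) h e s) = (expR x)%:E -> ln q + ln (profile_mass s) - eta <= x.
  move=> G0 ss sm smeta mE; have [_ E] := profile_massE ss.
  have := mass_cone_ge (m := m) p1 h0 e0 ss sm; rewrite E mE -EFinM lee_fin -/q => H.
  rewrite -ler_expR; apply: le_trans H.
  rewrite -[X in _ <= _ * X * _](@lnK _ q) ?posrE// -[X in _ <= _ * _ * X](@lnK _ (profile_mass s)) ?posrE//.
  by rewrite -!expRD ler_expR; move: smeta; lra.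
have y1 := low t x1 Gt0 t0 s1 s2 M1.
have y0 := low 0 x0 G00 (lexx 0) s3 s4 M0.
have yl : xl <= ln q + ln (profile_mass (l * t)).
  have sub : minkowski_comb l (cone (m := m) h e t) (cone h e 0) `<=` cone h e (l * t).
    by have := @minkowski_comb_cone R m l h e t 0 l01; rewrite mulr0 addr0.
  have bC := cone_body (m := m) h0 e0 lt0.
  have := @mass_cone_le R m p h e (l * t) p1 h0 e0 lt0; rewrite GlE -EFinM -/q => H.
  have mono : (mass p (minkowski_comb l (cone (m := m) h e t) (cone h e 0)) <= mass p (cone (m := m) h e (l * t)))%E.
    apply: ge0_subset_integral => //.
    - exact: (comb_measurable bK bL l).
    - by case: bC => kC _ _; exact: compact_borelRV.
    - by apply/measurable_EFinP; apply: measurable_funTS; exact: measurable_density.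
  have := le_trans mono H; rewrite Ml lee_fin => H2.
  by rewrite -ler_expR (expRD (ln q)) [expR (ln q)]lnK ?posrE// [expR (ln (profile_mass _))]lnK ?posrE.
clearbody x1 x0 xl => H.
have E1 : l * expR (al * (ln q + ln (profile_mass t) - eta)) +
    (1 - l) * expR (al * (ln q + ln (profile_mass 0) - eta)) <=
    expR (al * (ln q + ln (profile_mass (l * t)))).
  apply: le_trans (_ : expR (al * xl) <= _); last by rewrite ler_expR ler_wpM2l ?(ltW al0).
  apply: le_trans H; apply: lerD; apply: ler_wpM2l => //; by rewrite ler_expR ler_wpM2l ?(ltW al0).
have eq (u : R) : al * (ln q + u - eta) = al * ln q - al * eta + al * u by ring.
rewrite !eq mulrDr in E1.
rewrite (expRD _ (al * ln (profile_mass t))) (expRD _ (al * ln (profile_mass 0))) (expRD (al * ln q) (al * ln (profile_mass (l * t)))) (expRD (al * ln q) (- (al * eta))) in E1.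
have Q0 : 0 < expR (al * ln q) by exact: expR_gt0.
have {}E1 : expR (- (al * eta)) * S <= T.
  rewrite -(ler_pM2l Q0); apply: le_trans E1.
  have alg (a b c u v : R) : a * (b * (c * u + (1 - c) * v)) = c * (a * b * u) + (1 - c) * (a * b * v).
    by ring.
  by rewrite /S alg.
have := expR_ge1Dx (- (al * eta)) => /(ler_wpM2r S0) h2.
by have := le_trans h2 E1; lra.
Qed.

End profile_concavity.

(** * Expansion of the profile at the origin *)

Section binomial_bounds.
Context {R : realType}.

Lemma binomial2_le (a t : R) j : 0 <= a -> 0 <= t ->
  a ^+ j.+2 + j.+2%:R * a ^+ j.+1 * t + j.+2%:R * j.+1%:R * a ^+ j * t ^+ 2 / 2 <= (a + t) ^+ j.+2.
Proof.
move=> a0 t0; elim: j => [|j IH].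
  by rewrite expr0 expr1 mulr1 le_eqVlt; apply/orP; left; apply/eqP; field.
have at0 : 0 <= a + t by exact: addr_ge0.
rewrite [leRHS]exprS; apply: le_trans (ler_wpM2l at0 IH).
have r0 : 0 <= j.+2%:R * j.+1%:R * a ^+ j * t ^+ 3 / 2.
  by apply: divr_ge0 => //; rewrite !mulr_ge0 ?exprn_ge0.
rewrite -subr_ge0; apply: le_trans r0 _.
rewrite le_eqVlt; apply/orP; left; apply/eqP.
rewrite !exprS -[j.+3%:R]natr1 -[j.+2%:R]natr1 -[j.+1%:R]natr1.
by move: (a ^+ j) (j%:R) => u v; field.
Qed.

Lemma binomial1_ge (h : R) k : 0 <= h -> exists2 C, 0 <= C & forall a t : R,
  0 <= a <= h -> 0 <= t <= 1 ->
  (a + t) ^+ k.+1 <= a ^+ k.+1 + k.+1%:R * a ^+ k * t + C * t ^+ 2.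
Proof.
move=> h0; elim: k => [|k [C C0 IH]].
  by exists 0 => // a t _ _; rewrite !expr1 expr0 mulr1 mul1r mul0r addr0.
exists (k.+1%:R * h ^+ k + C * (h + 1)).
  by rewrite addr_ge0// mulr_ge0 ?exprn_ge0 ?addr_ge0.
move=> a t ah t01; case/andP: (ah) => a0 a1; case/andP: (t01) => t0 t1.
have at0 : 0 <= a + t by exact: addr_ge0.
rewrite [leLHS]exprS; apply: (le_trans (ler_wpM2l at0 (IH a t ah t01))).
have e1 : k.+1%:R * a ^+ k * t ^+ 2 <= k.+1%:R * h ^+ k * t ^+ 2.
  by rewrite ler_wpM2r ?sqr_ge0// ler_wpM2l// lerXn2r// nnegrE (le_trans a0).
have e2 : C * t ^+ 2 * (a + t) <= C * t ^+ 2 * (h + 1).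
  by rewrite ler_wpM2l ?mulr_ge0 ?sqr_ge0//; exact: lerD.
rewrite -subr_ge0.
have -> : a ^+ k.+2 + k.+2%:R * a ^+ k.+1 * t + (k.+1%:R * h ^+ k + C * (h + 1)) * t ^+ 2 -
   (a + t) * (a ^+ k.+1 + k.+1%:R * a ^+ k * t + C * t ^+ 2) =
   (k.+1%:R * h ^+ k * t ^+ 2 - k.+1%:R * a ^+ k * t ^+ 2) +
   (C * t ^+ 2 * (h + 1) - C * t ^+ 2 * (a + t)).
  rewrite !exprS -[k.+2%:R]natr1 -[k.+1%:R]natr1.
  by move: (a ^+ k) (h ^+ k) (k%:R) => u v w; ring.
by rewrite addr_ge0// subr_ge0.
Qed.

End binomial_bounds.

Section truncated_moments.
Context {R : realType}.
Local Notation mu := (@lebesgue_measure R).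
Local Notation RR := (measurableTypeR R).
Variables (p h : R).
Hypotheses (p1 : 1 <= p) (h0 : 0 < h).

(** The interval is open at 0 because the point 0 belongs to the part of the cone
    behind the origin in profile_mass_ge. *)
Definition moment_density (j : nat) (a : RR) : RR :=
  ((0 < a) && (a <= h))%R%:R * (expR (- (`|a| `^ p / p)) * a ^+ j).

Definition moment (j : nat) : R := fine (\int[mu]_a (moment_density j a)%:E)%E.

Lemma measurable_interval (u v : R) :
  measurable_fun setT (fun a : RR => ((u < a) && (a <= v))%R%:R : RR).
Proof.
by apply: measurable_natr; apply: measurable_and;
  [exact: measurable_fun_ltr|exact: measurable_fun_ler].
Qed.

Lemma integral_interval (u v : R) : u <= v ->
  (\int[mu]_a (((u < a) && (a <= v))%R%:R : R)%:E = (v - u)%:E)%E.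
Proof.
move=> uv.
have -> : (\int[mu]_a (((u < a) && (a <= v))%R%:R : R)%:E =
   \int[mu]_(a in `]u, v]) (1%R)%:E)%E.
  rewrite -(@integral_natr_itv R `]u, v] (fun a => (u < a) && (a <= v)) (fun=> 1)).
    by apply: eq_integral => a _; rewrite mulr1.
  by move=> a; rewrite in_itv.
rewrite integral_cst//= mul1e lebesgue_measure_itv/= lte_fin.
case: ltP => [_|vu]; first by rewrite EFinB.
by have -> : v = u; [apply/eqP; rewrite eq_le vu uv|rewrite subrr].
Qed.

Lemma moment_density_ge0 j a : 0 <= moment_density j a.
Proof.
rewrite /moment_density; have [a0|a0] := ltP 0 a; last by rewrite mul0r.
by apply: mulr_ge0 => //; apply: mulr_ge0; [exact: expR_ge0|apply: exprn_ge0; exact: ltW].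
Qed.

Lemma measurable_weight : measurable_fun setT (fun a : RR => expR (- (`|a| `^ p / p)) : RR).
Proof.
apply: measurableT_comp => //; apply: measurable_funN; apply: measurable_funM => //.
by apply: (measurableT_comp (measurable_powR p)).
Qed.

Lemma measurable_moment_density j : measurable_fun setT (moment_density j).
Proof.
apply: measurable_funM; first exact: measurable_interval.
by apply: measurable_funM; [exact: measurable_weight|exact: measurable_funX].
Qed.

Lemma weight_le1 (a : R) : expR (- (`|a| `^ p / p)) <= 1.
Proof.
by rewrite expR_le1 oppr_le0 divr_ge0 ?powR_ge0// (le_trans ler01).
Qed.

Lemma momentE j : (\int[mu]_a (moment_density j a)%:E = (moment j)%:E)%E.
Proof.
rewrite /moment fineK// ge0_fin_numE; last first.
  by apply: integral_ge0 => a _; rewrite lee_fin moment_density_ge0.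
have hj : 0 <= h ^+ j by apply: exprn_ge0; exact: ltW.
apply: (@le_lt_trans _ _ (\int[mu]_a (h ^+ j * (((0 < a) && (a <= h))%R%:R : R))%:E)%E); last first.
  rewrite (integralZl_real mu hj (measurable_interval 0 h)) ?(integral_interval (ltW h0)) -?EFinM ?ltry//.
apply: ge0_le_integral => //.
- by move=> a _; rewrite lee_fin moment_density_ge0.
- by apply/measurable_EFinP; exact: measurable_moment_density.
- by apply/measurable_EFinP; apply: measurable_funM => //; exact: measurable_interval.
move=> a _; rewrite lee_fin /moment_density mulrC.
have [a0|a0] := ltP 0 a; last by rewrite !mulr0.
have [ah|ah] := leP a h; last by rewrite !mulr0.
rewrite !mulr1 -[leRHS]mul1r; apply: ler_pM; rewrite ?expR_ge0 ?exprn_ge0 ?(ltW a0) ?weight_le1//.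
by rewrite lerXn2r// nnegrE (ltW a0, ltW h0).
Qed.

Lemma moment_ge0 j : 0 <= moment j.
Proof.
by rewrite -lee_fin -momentE; apply: integral_ge0 => a _; rewrite lee_fin moment_density_ge0.
Qed.

Lemma integral_combine2 (c1 c2 I1 I2 : R) (f1 f2 : RR -> RR) : 0 <= c1 -> 0 <= c2 ->
  measurable_fun setT f1 -> measurable_fun setT f2 ->
  (forall a, 0 <= f1 a) -> (forall a, 0 <= f2 a) ->
  (\int[mu]_a (f1 a)%:E = I1%:E)%E -> (\int[mu]_a (f2 a)%:E = I2%:E)%E ->
  (\int[mu]_a (c1 * f1 a + c2 * f2 a)%:E = (c1 * I1 + c2 * I2)%:E)%E.
Proof.
move=> c10 c20 m1 m2 f10 f20 E1 E2.
under eq_integral => a _ do rewrite EFinD.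
have g1 a : (0 <= (c1 * f1 a)%:E)%E by rewrite lee_fin mulr_ge0.
have g2 a : (0 <= (c2 * f2 a)%:E)%E by rewrite lee_fin mulr_ge0.
have n1 : measurable_fun setT (fun a => (c1 * f1 a)%:E) by apply/measurable_EFinP; exact: measurable_funM.
have n2 : measurable_fun setT (fun a => (c2 * f2 a)%:E) by apply/measurable_EFinP; exact: measurable_funM.
rewrite (ge0_integralD mu measurableT (fun a _ => g1 a) n1 (fun a _ => g2 a) n2).
by rewrite (integralZl_real mu c10 m1 f10) (integralZl_real mu c20 m2 f20) E1 E2 -!EFinM -EFinD.
Qed.

Lemma le_of_integral_le (I1 I2 : R) (f1 f2 : RR -> RR) :
  measurable_fun setT f1 -> measurable_fun setT f2 ->
  (forall a, 0 <= f1 a) -> (forall a, f1 a <= f2 a) ->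
  (\int[mu]_a (f1 a)%:E = I1%:E)%E -> (\int[mu]_a (f2 a)%:E = I2%:E)%E -> I1 <= I2.
Proof.
move=> m1 m2 f10 f12 E1 E2; rewrite -lee_fin -E1 -E2; apply: ge0_le_integral => //.
- by move=> a _; rewrite lee_fin.
- exact/measurable_EFinP.
- exact/measurable_EFinP.
- by move=> a _; rewrite lee_fin.
Qed.

Lemma profile_mass0 k : profile_mass (m := k.+1) p h 0 = moment k.+1.
Proof.
rewrite /profile_mass /moment; congr fine; apply: eq_integral => a _; congr EFin.
rewrite /profile /moment_density oppr0 addr0; have [->|a0] := eqVneq a 0.
  by rewrite exprS !mul0r !mulr0.
by rewrite [0 <= a]le_eqVlt eq_sym (negbTE a0).
Qed.

(** The part of the cone behind the origin contributes at most 2 s^2. *)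
Lemma profile_mass_le k : exists2 K, 0 <= K & forall s, 0 <= s <= 1 ->
  profile_mass (m := k.+1) p h s <= moment k.+1 + k.+1%:R * moment k * s + K * s ^+ 2.
Proof.
have [C C0 bin] := binomial1_ge k (ltW h0).
exists (C * h + 2); first by apply: addr_ge0 => //; apply: mulr_ge0 => //; exact: ltW.
move=> s s01; case/andP: (s01) => s0 s1.
have [_ E] := profile_massE (m := k.+1) p1 h0 s0.
have ks0 : 0 <= k.+1%:R * s by exact: mulr_ge0.
have Cs0 : 0 <= C * s ^+ 2 by apply: mulr_ge0 => //; exact: sqr_ge0.
pose f1 (a : RR) : RR := 1 * moment_density k.+1 a + k.+1%:R * s * moment_density k a.
(* The interval from - 2 s to 0 contains [- s, 0] and is half-open like the other one. *)
pose f2 (a : RR) : RR := C * s ^+ 2 * ((0 < a) && (a <= h))%R%:R + s * ((- s - s < a) && (a <= 0))%R%:R.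
have mf1 : measurable_fun setT f1.
  by apply: measurable_funD; apply: measurable_funM => //; exact: measurable_moment_density.
have mf2 : measurable_fun setT f2.
  by apply: measurable_funD; apply: measurable_funM => //; exact: measurable_interval.
have f10 a : 0 <= f1 a.
  by apply: addr_ge0; apply: mulr_ge0 => //; exact: moment_density_ge0.
have f20 a : 0 <= f2 a by apply: addr_ge0; apply: mulr_ge0.
have E1 := integral_combine2 ler01 ks0 (measurable_moment_density k.+1) (measurable_moment_density k)
  (moment_density_ge0 k.+1) (moment_density_ge0 k) (momentE k.+1) (momentE k).
have ss : - s - s <= 0 by move: s0; lra.
have E2 := integral_combine2 Cs0 s0 (measurable_interval 0 h) (measurable_interval (- s - s) 0)
  (fun a => ler0n _ _) (fun a => ler0n _ _) (integral_interval (ltW h0)) (integral_interval ss).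
have E3 := integral_combine2 ler01 ler01 mf1 mf2 f10 f20 E1 E2.
have m3 : measurable_fun setT (fun a => 1 * f1 a + 1 * f2 a : RR).
  by apply: measurable_funD; exact: measurable_funM.
have p0 (a : R) : 0 <= profile k.+1 p h s a by exact: profile_ge0.
have := le_of_integral_le (@measurable_profile R k.+1 p h s) m3 p0 _ E E3.
have -> : 1 * (1 * moment k.+1 + k.+1%:R * s * moment k) +
    1 * (C * s ^+ 2 * (h - 0) + s * (0 - (- s - s))) =
    moment k.+1 + k.+1%:R * moment k * s + (C * h + 2) * s ^+ 2 by ring.
apply=> a; rewrite !mul1r /f1 /f2 /profile /moment_density mul1r.
have w0 := expR_ge0 (- (`|a| `^ p / p)); have w1 := weight_le1 a.
move: (expR _) w0 w1 => w w0 w1.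
have [a0|a0] := ltP 0 a.
  rewrite andbF mulr0 addr0 /=.
  have -> : - s <= a by apply: (le_trans _ (ltW a0)); rewrite oppr_le0.
  have [ah|ah] := leP a h; last first.
    by rewrite !(mul0r, mulr0, addr0).
  rewrite /= !mul1r mulr1.
  have ah' : 0 <= a <= h by rewrite (ltW a0).
  apply: (le_trans (ler_wpM2l w0 (bin a s ah' s01))).
  have : 0 <= (1 - w) * (C * s ^+ 2) by apply: mulr_ge0 => //; rewrite subr_ge0.
  by lra.
rewrite /= !(mul0r, mulr0, add0r) andbT.
have [sa|sa] := leP (- s) a; last first.
  by rewrite /= mul0r; apply: mulr_ge0.
rewrite (le_trans a0 (ltW h0)) /= mul1r.
have [s00|s00] := eqVneq s 0.
  have -> : a = 0 by apply/eqP; rewrite eq_le a0; move: sa; rewrite s00 oppr0 => ->.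
  by rewrite s00 add0r exprS mul0r mulr0 mul0r.
have sp : 0 < s by rewrite lt_neqAle eq_sym s00.
have -> : - s - s < a by apply: lt_le_trans sa; rewrite gtrDl oppr_lt0.
rewrite mulr1.
have as0 : 0 <= a + s by rewrite -lerBlDr sub0r.
have as1 : a + s <= s by rewrite gerDr.
apply: (@le_trans _ _ (1 * s ^+ k.+1)).
  by apply: ler_pM => //; [exact: exprn_ge0|rewrite lerXn2r// nnegrE].
by rewrite mul1r exprS ler_piMr// exprn_ile1.
Qed.

(** For k = 0 the second-order term comes from the part of the cone behind the
    origin, whose section grows linearly; otherwise from the binomial expansion.
    The factor 1 - t absorbs the density behind the origin. *)
Lemma profile_mass_ge k (t : R) : 0 < t <= 1 ->
  moment k.+1 + k.+1%:R * moment k * t +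
   (1 - t) * (if k is k'.+1 then k.+1%:R * k%:R * moment k' else 1) * t ^+ 2 / 2 <=
  profile_mass (m := k.+1) p h t.
Proof.
move=> t01; case/andP: (t01) => t0 t1.
have t0' := ltW t0.
have [_ E] := profile_massE (m := k.+1) p1 h0 t0'.
have kt0 : 0 <= k.+1%:R * t by exact: mulr_ge0.
have t1' : 0 <= 1 - t by rewrite subr_ge0.
pose f1 (a : RR) : RR := 1 * moment_density k.+1 a + k.+1%:R * t * moment_density k a.
have mf1 : measurable_fun setT f1.
  by apply: measurable_funD; apply: measurable_funM => //; exact: measurable_moment_density.
have f10 a : 0 <= f1 a.
  by apply: addr_ge0; apply: mulr_ge0 => //; exact: moment_density_ge0.
have E1 := integral_combine2 ler01 kt0 (measurable_moment_density k.+1) (measurable_moment_density k)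
  (moment_density_ge0 k.+1) (moment_density_ge0 k) (momentE k.+1) (momentE k).
have ta a : 0 < a -> - t <= a by move=> a0; apply: (le_trans _ (ltW a0)); rewrite oppr_le0.
have tt : 0 <= t ^+ 2 / 2 by rewrite divr_ge0 ?sqr_ge0.
case: k E kt0 @f1 mf1 f10 E1 => [|k] E kt0 f1 mf1 f10 E1; last first.
  have c0 : 0 <= (1 - t) * (k.+2%:R * k.+1%:R) * t ^+ 2 / 2.
    by rewrite -mulrA; apply: mulr_ge0 => //; apply: mulr_ge0 => //; exact: mulr_ge0.
  have E3 := integral_combine2 ler01 c0 mf1 (measurable_moment_density k) f10 (moment_density_ge0 k) E1 (momentE k).
  have m3 : measurable_fun setT (fun a => 1 * f1 a + (1 - t) * (k.+2%:R * k.+1%:R) * t ^+ 2 / 2 * moment_density k a : RR).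
    by apply: measurable_funD; apply: measurable_funM => //; exact: measurable_moment_density.
  have n3 a : 0 <= 1 * f1 a + (1 - t) * (k.+2%:R * k.+1%:R) * t ^+ 2 / 2 * moment_density k a.
    by apply: addr_ge0; apply: mulr_ge0 => //; exact: moment_density_ge0.
  have := le_of_integral_le m3 (@measurable_profile R k.+2 p h t) n3 _ E3 E.
  have -> : 1 * (1 * moment k.+2 + k.+2%:R * t * moment k.+1) +
     (1 - t) * (k.+2%:R * k.+1%:R) * t ^+ 2 / 2 * moment k =
     moment k.+2 + k.+2%:R * moment k.+1 * t +
     (1 - t) * (k.+2%:R * k.+1%:R * moment k) * t ^+ 2 / 2 by ring.
  apply=> a; rewrite /f1 /profile /moment_density.
  have w0 := expR_ge0 (- (`|a| `^ p / p)); move: (expR _) w0 => w w0.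
  have [a0|a0] := ltP 0 a; last first.
    rewrite /= !(mul0r, mulr0, addr0).
    have [sa|_] := leP (- t) a; last by rewrite mul0r.
    apply: mulr_ge0 => //; apply: mulr_ge0 => //; apply: exprn_ge0.
    by rewrite -lerBlDr sub0r.
  rewrite (ta a a0) /=; have [ah|ah] := leP a h; last by rewrite !(mul0r, mulr0, addr0).
  rewrite !mul1r.
  have := ler_wpM2l w0 (binomial2_le k (ltW a0) t0').
  apply: le_trans.
  have r0 : 0 <= t * (w * (k.+2%:R * k.+1%:R * a ^+ k * t ^+ 2 / 2)).
    apply: mulr_ge0 => //; apply: mulr_ge0 => //; apply: divr_ge0 => //; apply: mulr_ge0; last exact: sqr_ge0.
    by apply: mulr_ge0; [exact: mulr_ge0|apply: exprn_ge0; exact: ltW].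
  rewrite -subr_ge0; apply: le_trans r0 _.
  rewrite le_eqVlt; apply/orP; left; apply/eqP.
  by move: (a ^+ k.+2) (a ^+ k.+1) (a ^+ k) (k.+2%:R) (k.+1%:R) => x y z u v; ring.
pose psi (a : RR) : RR := ((0 < a + t) && (a + t <= t))%R%:R * (a + t).
have mpsi : measurable_fun setT psi.
  have mat : measurable_fun setT (fun a : RR => a + t : RR) by exact: measurable_funD.
  apply: measurable_funM => //; apply: measurable_natr; apply: measurable_and;
    [exact: measurable_fun_ltr|exact: measurable_fun_ler].
have psi0 a : 0 <= psi a.
  by rewrite /psi; have [at0|_] := ltP 0 (a + t); [rewrite mulr_ge0// ltW|rewrite mul0r].
have E2 : (\int[mu]_a (psi a)%:E = (t ^+ 2 / 2)%:E)%E.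
  pose f (s : RR) : RR := ((0 < s) && (s <= t))%R%:R * s.
  have mf : measurable_fun setT (EFin \o f).
    by apply/measurable_EFinP; apply: measurable_funM => //; exact: measurable_interval.
  have f0 s : (0 <= (EFin \o f) s)%E.
    by rewrite lee_fin /f; have [s0|_] := ltP 0 s; [rewrite mulr_ge0// ltW|rewrite mul0r].
  have := ge0_integral_affine t ltr01 mf f0; rewrite invr1 mul1e.
  have two : 0 < (2 : R) by [].
  have := integral_powR_0u two t0; rewrite powR_mulrn// => <- I.
  transitivity (\int[mu]_s (f (1 * s + t))%:E)%E.
    by apply: eq_integral => a _; rewrite /psi /f mul1r.
  rewrite I; apply: eq_integral => s _; rewrite /f/=; congr EFin.
  have [s0|_] := ltP 0 s; last by rewrite !mul0r.
  by rewrite (_ : 2 - 1 = 1) ?powRr1 ?(ltW s0)//; ring.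
have E3 := integral_combine2 ler01 t1' mf1 mpsi f10 psi0 E1 E2.
have m3 : measurable_fun setT (fun a => 1 * f1 a + (1 - t) * psi a : RR).
  by apply: measurable_funD; exact: measurable_funM.
have n3 a : 0 <= 1 * f1 a + (1 - t) * psi a by apply: addr_ge0; exact: mulr_ge0.
have := le_of_integral_le m3 (@measurable_profile R 1 p h t) n3 _ E3 E.
have -> : 1 * (1 * moment 1 + 1 * t * moment 0) + (1 - t) * (t ^+ 2 / 2) =
   moment 1 + 1 * moment 0 * t + (1 - t) * 1 * t ^+ 2 / 2 by ring.
apply=> a; rewrite /f1 /psi /profile /moment_density !expr1 expr0.
have [a0|a0] := ltP 0 a.
  have -> : (a + t <= t) = false by apply/negbTE; rewrite -ltNge ltrDr.
  rewrite andbF mul0r mulr0 addr0 (ta a a0) /=.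
  move: (expR _) => w; have [ah|ah] := leP a h; last by rewrite !(mul0r, mulr0, addr0).
  by rewrite le_eqVlt; apply/orP; left; apply/eqP; ring.
rewrite /= !(mul0r, mulr0, addr0, add0r).
have [at0|at0] := ltP 0 (a + t); last first.
  rewrite /= mul0r mulr0 -[leLHS](mul0r 0) mul0r.
  have := profile_ge0 1 p h t a; by rewrite /profile expr1.
have sa : - t <= a by rewrite -subr_ge0 opprK ltW.
rewrite sa (le_trans a0 (ltW h0)) gerDr a0 /= !mul1r.
apply: ler_wpM2r; first exact: ltW.
have na : `|a| <= t by rewrite ler_norml sa (le_trans a0 t0').
have na1 : `|a| <= 1 by exact: le_trans na t1.
have p0 : 0 < p by exact: lt_le_trans p1.
have : `|a| `^ p / p <= t.
  rewrite ler_pdivrMr//; apply: (@le_trans _ _ `|a|).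
    have [->|a0'] := eqVneq `|a| 0; first by rewrite powR0// gt_eqF.
    rewrite -[leRHS]powRr1//; apply: ger_powR => //.
    by rewrite na1 lt_neqAle eq_sym a0' normr_ge0.
  by apply: (le_trans na); rewrite ler_peMr.
by have := expR_ge1Dx (- (`|a| `^ p / p)); lra.
Qed.

End truncated_moments.

(** * Moments and the upper bound *)

Section full_moments.
Context {R : realType}.
Local Notation mu := (@lebesgue_measure R).
Local Notation RR := (measurableTypeR R).
Variable p : R.
Hypothesis p1 : 1 <= p.

(** The integral of r^j e^(-r^p/p) over the positive axis
    (integral_full_density). *)
Definition full_moment (j : nat) : R := p `^ (j.+1%:R / p - 1) * Gamma (j.+1%:R / p).

Definition full_density (j : nat) (a : RR) : RR :=
  (0 < a)%R%:R * (expR (- (`|a| `^ p / p)) * a ^+ j).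

Lemma full_density_ge0 j a : 0 <= full_density j a.
Proof.
rewrite /full_density; have [a0|a0] := ltP 0 a; last by rewrite mul0r.
by apply: mulr_ge0 => //; apply: mulr_ge0; [exact: expR_ge0|apply: exprn_ge0; exact: ltW].
Qed.

Lemma measurable_full_density j : measurable_fun setT (full_density j).
Proof.
apply: measurable_funM; first by apply: measurable_natr; exact: measurable_fun_ltr.
by apply: measurable_funM; [exact: measurable_weight|exact: measurable_funX].
Qed.

Lemma integral_rV1 (f : RR -> RR) : measurable_fun setT f -> (forall a, 0 <= f a) ->
  (\int[lebesgue_rV 1]_x (f (rV_head x))%:E = \int[mu]_a (f a)%:E)%E.
Proof.
move=> mf f0.
have mfh : measurable_fun setT (fun x : borelRV R 1 => (f (rV_head x))%:E).
  by apply/measurable_EFinP; apply: (measurableT_comp mf); exact: measurable_rV_head.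
rewrite (ge0_integral_rVS mfh) => [|x]; last by rewrite lee_fin.
apply: eq_integral => a _; rewrite ge0_integral_rV0; congr ((f _)%:E).
exact: (@rV_cons0 R 0 (a, 0)).
Qed.

Lemma enorm_rV1 (y : borelRV R 1) : enorm (y : 'rV[R]_1) = `|rV_head y|.
Proof. by rewrite /enorm big_ord1 sqrtr_sqr. Qed.

(** Polar coordinates in dimension 1 amount to the substitution r = s^(1/p). *)
Lemma integral_full_density j : (\int[mu]_a (full_density j a)%:E = (full_moment j)%:E)%E.
Proof.
have p0 : 0 < p by exact: lt_le_trans p1.
pose f (x : borelRV R 1) : RR := full_density j (rV_head x).
have mf : measurable_fun setT f.
  by apply: (measurableT_comp (measurable_full_density j)); exact: measurable_rV_head.
rewrite -(integral_rV1 (measurable_full_density j) (full_density_ge0 j)).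
rewrite (polar_integral p0 mf (fun x => full_density_ge0 j _)).
pose q : R := j.+1%:R / p; have q0 : 0 < q by rewrite divr_gt0.
pose c := p `^ q * Gamma q.
have c0 : 0 <= c by rewrite mulr_ge0 ?powR_ge0// ltW// Gamma_gt0.
pose G (a : RR) : RR := c * ((1 <= a)%R%:R * a `^ (- (p + 1))).
have mG1 : measurable_fun setT (fun a : RR => (1 <= a)%R%:R * a `^ (- (p + 1)) : RR).
  apply: measurable_funM; first by apply: measurable_natr; exact: measurable_fun_ler.
  exact: measurable_powR_fun.
have G10 (a : RR) : 0 <= (1 <= a)%R%:R * a `^ (- (p + 1)) by rewrite mulr_ge0// powR_ge0.
have mG : measurable_fun setT G by exact: measurable_funM.
have G0 a : 0 <= G a by apply: mulr_ge0.
transitivity (\int[lebesgue_rV 1]_y (G (rV_head y))%:E)%E; last first.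
  rewrite (integral_rV1 mG G0) /G (integralZl_real mu c0 mG1 G10).
  rewrite (@integral_natr_itv R `[1, +oo[ (fun a => 1 <= a)); last by move=> a; rewrite in_itv/= andbT.
  rewrite integral_powR_1y; last by rewrite ltrDr.
  rewrite -EFinM addrK; congr EFin.
  rewrite /full_moment -/q /c mulrAC; congr (_ * _).
  by rewrite -(powR_inv1 (ltW p0)) -powRD_gt0.
apply: eq_integral => y _; set a := rV_head y.
have ay s : rV_head (s *: (y : 'rV[R]_1)) = s * a :> R by rewrite /rV_head mxE.
have [a0|a0] := ltP 0 a; last first.
  rewrite integral0_eq => [|s _].
    by rewrite /G leNgt (le_lt_trans a0 ltr01) mul0r mulr0.
  rewrite /polar_integrand /f /full_density ay.
  rewrite (_ : (0 < _ * a) = false) ?mul0r ?mulr0//.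
  by apply/negbTE; rewrite -leNgt; apply: mulr_ge0_le0 => //; exact: powR_ge0.
rewrite /G.
have en : enorm (y : 'rV[R]_1) = a by rewrite enorm_rV1 -/a gtr0_norm.
have ap0 : 0 < a `^ p by exact: powR_gt0.
have -> : ((1 <= a) = (1 <= a `^ p))%R.
  have one : (1 : R) `^ p = 1 by rewrite powR1.
  apply/idP/idP => h.
    by rewrite -one; apply: ge0_ler_powR; rewrite ?nnegrE ?(ltW p0) ?(ltW a0).
  rewrite leNgt; apply/negP => a1; move: h; rewrite leNgt => /negP; apply.
  by rewrite -one; apply: gt0_ltr_powR; rewrite ?nnegrE ?(ltW a0).
pose w := a `^ p / p; have w0 : 0 < w by exact: divr_gt0.
pose C : R := (1 <= a `^ p)%R%:R * (a `^ p)^-1 * a ^+ j.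
have C0 : 0 <= C by rewrite !mulr_ge0 ?invr_ge0 ?powR_ge0 ?exprn_ge0 ?(ltW a0).
have E s : polar_integrand p f (s, y) = C * gamma_kernel q w s.
  rewrite /polar_integrand /gamma_kernel /f/= en /full_density ay.
  have [s0|_] := ltP 0 s; last by rewrite !mul0r !mulr0.
  have sp0 : 0 < s `^ p^-1 by exact: powR_gt0.
  have -> : 0 < s `^ p^-1 * a by exact: mulr_gt0.
  rewrite (gtr0_norm (mulr_gt0 sp0 a0)) powRM ?(ltW sp0) ?(ltW a0)//.
  have -> : (s `^ p^-1) `^ p = s by rewrite -powRrM mulVf ?gt_eqF// powRr1// ltW.
  have -> : s * a `^ p / p = w * s by rewrite /w -mulrA mulrC.
  have -> : s `^ (q - 1) = s `^ (1%:R / p - 1) * (s `^ p^-1) ^+ j.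
    rewrite -powR_mulrn ?(ltW sp0)// -powRrM -powRD_gt0//; congr (_ `^ _).
    by rewrite /q -natr1; field; rewrite gt_eqF.
  rewrite exprMn /C !mul1r.
  move: (expR _) (s `^ (_ - 1)) (a `^ p)^-1 (s `^ p^-1 ^+ j) (a ^+ j) (_%:R) => u1 u2 u3 u4 u5 u6.
  by ring.
rewrite (eq_integral _ _ (fun s _ => congr1 EFin (E s))).
have mg : measurable_fun setT (gamma_kernel q w : RR -> RR) by exact: measurable_gamma_kernel.
rewrite (integralZl_real mu C0 mg (gamma_kernel_ge0 q w)).
rewrite -/(gamma_integral q w) gamma_integral_scale// gamma_integral_Gamma// -!EFinM.
congr EFin; rewrite /G /C /c.
have -> : w `^ (- q) = a `^ (- j.+1%:R) * p `^ q.
  rewrite /w powRM ?powR_ge0 ?invr_ge0 ?(ltW p0)//; congr (_ * _).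
    by rewrite -powRrM; congr (_ `^ _); rewrite /q; field; rewrite gt_eqF.
  by rewrite -(powR_inv1 (ltW p0)) -powRrM; congr (_ `^ _); ring.
have -> : a `^ (- (p + 1)) = (a `^ p)^-1 * a ^+ j * a `^ (- j.+1%:R).
  rewrite -powR_inv1 ?(ltW ap0)// -powRrM -powR_mulrn ?(ltW a0)// -!powRD_gt0//; congr (_ `^ _).
  by rewrite -natr1; ring.
case: ltP => _; rewrite ?ltxx; move: (Gamma q) (p `^ q) => g u.
all: by rewrite ?a0; ring.
Qed.

Lemma moment_cvg j : (fun i : nat => moment p i.+1%:R j) @ \oo --> full_moment j.
Proof.
pose F (i : nat) : set RR := `]0, (i.+1%:R : R)]%classic.
have ndF : nondecreasing_seq F.
  apply/nondecreasing_seqP => k; rewrite subsetEset => x; rewrite /F/= !in_itv/=.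
  by move=> /andP[-> kx]; rewrite (le_trans kx)// ler_nat.
have FU : \bigcup_i F i = `]0, +oo[%classic.
  apply/seteqP; split => x; rewrite /F/= ?in_itv/=.
    by move=> [i _]; rewrite /= in_itv/= => /andP[-> _].
  rewrite andbT => x0; exists (Num.truncn x) => //=; rewrite in_itv/= x0/=.
  by rewrite ltW// truncnS_gt.
have mF i : measurable (F i) by exact: measurable_itv.
have := @ge0_nondecreasing_set_cvg_integral _ _ R F (EFin \o full_density j) mu ndF mF.
move=> /(_ _ _); rewrite FU.
have -> : (\int[mu]_(x in `]0%R, +oo[) (EFin \o full_density j) x = (full_moment j)%:E)%E.
  rewrite -integral_full_density -(@integral_natr_itv R `]0, +oo[ (fun a => 0 < a)); last first.
    by move=> a; rewrite in_itv/= andbT.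
  apply: eq_integral => a _; rewrite /full_density.
  by case: (0 < a); rewrite ?mul1r ?mul0r.
move=> cv.
have {}cv : (fun i => \int[mu]_(x in F i) (EFin \o full_density j) x)%E @ \oo --> (full_moment j)%:E.
  apply: cv.
  - by move=> k; apply/measurable_EFinP; apply: measurable_funTS; exact: measurable_full_density.
  - by move=> k x _; rewrite lee_fin full_density_ge0.
rewrite (_ : (fun i => _) = fine \o (fun i => \int[mu]_(x in F i) (EFin \o full_density j) x)%E).
  exact: fine_cvg cv.
apply/funext => i; rewrite /=.
have i0 : 0 < i.+1%:R :> R by [].
rewrite /moment; congr fine; rewrite -(@integral_natr_itv R `]0, i.+1%:R] (fun a => (0 < a) && (a <= i.+1%:R))); last first.
  by move=> a; rewrite in_itv.
apply: eq_integral => a _; rewrite /full_density /moment_density.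
by case: (0 < a); case: (a <= _); rewrite ?(mul1r, mul0r).
Qed.

(** The second-order inequality for cones of height i + 1, as i tends to infinity. *)
Lemma exponent_moment_inequality k (al : R) : 0 < al -> bm_exponents k.+2 p al ->
  (if k is k'.+1 then k.+1%:R * k%:R * full_moment k' else 1) * full_moment k.+1 <=
  (1 - al) * (k.+1%:R * full_moment k) ^+ 2.
Proof.
move=> al0 Aal.
pose D (i : nat) : R := if k is k'.+1 then k.+1%:R * k%:R * moment p i.+1%:R k' else 1.
have cc (r : R) : (fun=> r) @ \oo --> r by exact: cvg_cst.
have cD : D i @[i --> \oo] -->
    ((if k is k'.+1 then k.+1%:R * k%:R * full_moment k' else 1) : R).
  rewrite /D; case: (k) => [|k']; first exact: cc.
  by apply: cvgM; [exact: cc|exact: moment_cvg].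
have cL : (D i * moment p i.+1%:R k.+1) @[i --> \oo] -->
    ((if k is k'.+1 then k.+1%:R * k%:R * full_moment k' else 1) * full_moment k.+1 : R).
  by apply: cvgM => //; exact: moment_cvg.
have cB : (k.+1%:R * moment p i.+1%:R k) @[i --> \oo] --> k.+1%:R * full_moment k.
  by apply: cvgM; [exact: cc|exact: moment_cvg].
have cR : ((1 - al) * (k.+1%:R * moment p i.+1%:R k) ^+ 2) @[i --> \oo] -->
    (1 - al) * (k.+1%:R * full_moment k) ^+ 2.
  by apply: cvgM; [exact: cc|rewrite expr2; under eq_fun do rewrite expr2; exact: cvgM].
apply: (ler_cvg_to cL cR); near=> i.
have i0 : 0 < i.+1%:R :> R by [].
have [K K0 HK] := profile_mass_le p1 i0 k.
have [A0 _] := profile_massE (m := k.+1) p1 i0 (lexx 0).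
rewrite (profile_mass0 _ _ k) in A0.
apply: (@power_concave_second_order R (profile_mass (m := k.+1) p i.+1%:R) al _ _ _ K al0 A0).
- by apply: mulr_ge0 => //; exact: moment_ge0.
- rewrite /D; case: (k) => // k'; apply: mulr_ge0; [exact: mulr_ge0|exact: moment_ge0].
- exact: K0.
- exact: profile_mass0.
- move=> s s01; rewrite (HK s s01) andbT; case/andP: s01 => s0 _.
  by have [] := profile_massE (m := k.+1) p1 i0 s0.
- by move=> t t01; exact: profile_mass_ge.
- move=> t l /andP[/ltW t0 _] /andP[/ltW l0 /ltW l1].
  by apply: profile_mass_concave => //; rewrite l0.
Unshelve. all: by end_near. Qed.

(** Insert the moments; the powers of p combine to a common factor. *)
Lemma bm_exponent_le_upper n (al : R) : (2 <= n)%N -> 0 < al -> bm_exponents n p al ->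
  al <= bm_upper n p.
Proof.
case: n => [|[|k]]// _ al0 Aal.
have p0 : 0 < p by exact: lt_le_trans p1.
have pn : p != 0 by rewrite gt_eqF.
have pE (r : R) : p * p `^ (r - 1) = p `^ r.
  by rewrite -[X in X * _](powRr1 (ltW p0)) -powRD_gt0// addrC subrK.
have := exponent_moment_inequality al0 Aal.
have k1 : 0 < k.+1%:R :> R by [].
rewrite /bm_upper.
have -> : k.+2%:R - 1 = k.+1%:R :> R by rewrite -[k.+2%:R]natr1 addrK.
have -> : k.+2%:R + p - 2 = k%:R + p :> R by rewrite -[k.+2%:R]natr1 -[k.+1%:R]natr1; ring.
have -> : (if k is k'.+1 then k.+1%:R * k%:R * full_moment k' else 1) =
    k.+1%:R * (p `^ (k%:R / p) * Gamma ((k%:R + p) / p)).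
  have -> : (k%:R + p) / p = k%:R / p + 1 by field.
  case: (k) => [|k']; first by rewrite mul0r powRr0 add0r Gamma_1 !mulr1.
  rewrite Gamma_rec ?divr_gt0// /full_moment -mulrA; congr (_ * _).
  rewrite -(pE (k'.+1%:R / p)).
  by field.
rewrite /full_moment.
set G1 := Gamma ((k%:R + p) / p); set G2 := Gamma (k.+2%:R / p); set G3 := Gamma (k.+1%:R / p).
have G30 : 0 < G3 by rewrite Gamma_gt0// divr_gt0.
set P := p `^ (k.+1%:R / p - 1).
have P0 : 0 < P by exact: powR_gt0.
have PE : p `^ (k%:R / p) * p `^ (k.+2%:R / p - 1) = p * P ^+ 2.
  rewrite expr2 mulrA /P (pE (k.+1%:R / p)) -!powRD_gt0//; congr (_ `^ _).
  by rewrite -[k.+2%:R]natr1 -[k.+1%:R]natr1; field.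
have -> : k.+1%:R * (p `^ (k%:R / p) * G1) * (p `^ (k.+2%:R / p - 1) * G2) =
   k.+1%:R * G1 * G2 * (p `^ (k%:R / p) * p `^ (k.+2%:R / p - 1)) by ring.
rewrite PE => H.
have Q0 : 0 < k.+1%:R * P ^+ 2 by rewrite mulr_gt0// exprn_gt0.
have {}H : p * (G1 * G2) <= (1 - al) * (k.+1%:R * G3 ^+ 2).
  rewrite -(ler_pM2l Q0).
  have -> : k.+1%:R * P ^+ 2 * (p * (G1 * G2)) = k.+1%:R * G1 * G2 * (p * P ^+ 2) by ring.
  by apply: (le_trans H); rewrite le_eqVlt; apply/orP; left; apply/eqP; ring.
have Z0 : 0 < k.+1%:R * G3 ^+ 2 by rewrite mulr_gt0// exprn_gt0.
rewrite -ler_pdivrMr// in H.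
rewrite lerBrDl -lerBrDr; apply: le_trans H.
by rewrite mulf_div.
Qed.

End full_moments.

Lemma bm_upper_1 (R : realType) n : (2 <= n)%N -> bm_upper n 1 = 0 :> R.
Proof.
case: n => [|[|k]]// _; rewrite /bm_upper.
have -> : k.+2%:R - 1 = k.+1%:R :> R by rewrite -[k.+2%:R]natr1 addrK.
have -> : k.+2%:R + 1 - 2 = k.+1%:R :> R by rewrite -[k.+2%:R]natr1; ring.
rewrite !divr1 -[k.+2%:R]natr1 Gamma_rec//.
have : 0 < Gamma (k.+1%:R : R) by exact: Gamma_gt0.
by move=> g0; field; rewrite gt_eqF//= pnatr_eq0.
Qed.

Theorem theorem1p1 (R : realType) (n : nat) (p : R) (hn : (2 <= n)%N)
    (hp : 1 <= p) :
  (exists alpha : R, is_largest (bm_exponents n p) alpha /\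
     bm_lower n p <= alpha /\ alpha <= bm_upper n p) /\
  (bm_lower_expr n q @[q --> (1 : R)^'+] --> (0 : R)).
Proof.
split; last exact: bm_lower_expr_cvg0.
have n0 : (0 < n)%N by exact: leq_trans hn.
have [Ac c0] := bm_lowerP hn hp.
apply: (bm_exponents_largest n0 hp Ac c0) => [a a0 Aa|].
  exact: bm_exponent_le_upper.
have [cpos|cneg] := ltP 0 (bm_lower n p); first exact: bm_exponent_le_upper.
apply: (le_trans cneg); have [->|p1] := eqVneq p 1; first by rewrite bm_upper_1.
exfalso; have p1' : 1 < p by rewrite lt_neqAle eq_sym p1.
have [_] := bm_exponents_lower_expr n0 hp p1'.
by move: cneg; rewrite /bm_lower (negbTE p1) leNgt => /negbTE ->.
Qed.
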